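(* Let $E$ be a Banach space and let $\mathfrak A=\{\mathfrak A_k\}_k$ be an $AB$-closed multiplicative sequence of polynomial ideals which is regular at $E$ and weakly differentiable. For $f\in H_{b\mathfrak A}(E)$ let $\tilde f:M_{b\mathfrak A}(E)\to\mathbb C$, $\tilde f(\varphi)=\varphi(f)$, be its extension to the spectrum. Then for every $f\in H_{b\mathfrak A}(E)$, the restriction of $\tilde f$ to each connected component of $M_{b\mathfrak A}(E)$ is a $\mathfrak A$-holomorphic function of bounded type; that is, for each connected component $S$ of $M_{b\mathfrak A}(E)$, $\tilde f\circ(\pi|_S)^{-1}\in H_{b\mathfrak A}(E'')$.
   Context: All Banach spaces are complex. $\mathcal P^k(E)$ is the Banach space of continuous $k$-homogeneous polynomials $E\to\mathbb C$; $\check P$ is the symmetric $k$-linear form of $P\in\mathcal P^k(E)$, and for $a\in E$, $P_{a^j}(x)=\check P(a,\dots,a,x,\dots,x)$ ($a$ repeated $j$ times), $P_a=P_{a^1}$. A Banach ideal of (scalar valued continuous) $k$-homogeneous polynomials is a pair $(\mathfrak A_k,\|\cdot\|_{\mathfrak A_k})$ such that: (i) for every Banach space $E$, $\mathfrak A_k(E)=\mathfrak A_k\cap\mathcal P^k(E)$ is a linear subspace of $\mathcal P^k(E)$ and $(\mathfrak A_k(E),\|\cdot\|_{\mathfrak A_k(E)})$ is a Banach space; (ii) if $T\in\mathcal L(E_1,E)$ and $P\in\mathfrak A_k(E)$ then $P\circ T\in\mathfrak A_k(E_1)$ and $\|P\circ T\|_{\mathfrak A_k(E_1)}\le\|P\|_{\mathfrak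 A_k(E)}\|T\|^k$; (iii) $z\mapsto z^k$ belongs to $\mathfrak A_k(\mathbb C)$ and has norm 1. A sequence $\mathfrak A=\{\mathfrak A_k\}_{k\ge1}$ of such ideals is coherent if there are constants $C,D>0$ such that for every Banach space $E$ and $k\in\mathbb N$: $P\in\mathfrak A_{k+1}(E)$, $a\in E$ imply $P_a\in\mathfrak A_k(E)$ and $\|P_a\|_{\mathfrak A_k(E)}\le C\|P\|_{\mathfrak A_{k+1}(E)}\|a\|$; and $P\in\mathfrak A_k(E)$, $\gamma\in E'$ imply $\gamma P\in\mathfrak A_{k+1}(E)$ and $\|\gamma P\|_{\mathfrak A_{k+1}(E)}\le D\|\gamma\|\|P\|_{\mathfrak A_k(E)}$. It is multiplicative if it is coherent and there is a constant $M$ such that for all $k,l$, every Banach space $E$, $P\in\mathfrak A_k(E)$, $Q\in\mathfrak A_l(E)$, one has $PQ\in\mathfrak A_{k+l}(E)$ and $\|PQ\|_{\mathfrak A_{k+l}(E)}\le M^{k+l}\|P\|_{\mathfrak A_k(E)}\|Q\|_{\mathfrak A_l(E)}$. A coherent sequence is weakly differentiable if there is a constant $K$ such that for all $l<k$, every Banach space $E$, $P\in\mathfrak A_k(E)$ and $\varphi\in\mathfrak A_{k-l}(E)'$, the map $x\mapsto\varphi(P_{x^l})$ belongs to $\mathfrak A_l(E)$ with $\|x\mapsto\varphi(P_{x^l})\|_{\mathfrak A_l(E)}\le K^k\|\varphi\|_{\mathfrak A_{k-l}(E)'}\|P\|_{\mathfrak A_k(E)}$. $H_{b\mathfrak A}(E)$,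 the space of $\mathfrak A$-holomorphic functions of bounded type, is the space of entire functions $f$ on $E$ with $\frac{d^kf(0)}{k!}\in\mathfrak A_k(E)$ for all $k$ and $\lim_k\|\frac{d^kf(0)}{k!}\|_{\mathfrak A_k(E)}^{1/k}=0$; it is a Fréchet space with the seminorms $p_R(f)=\sum_{k\ge0}\|\frac{d^kf(0)}{k!}\|_{\mathfrak A_k(E)}R^k$, $R>0$ (the $k=0$ term is the constant $f(0)$ with its absolute value), and an algebra when $\mathfrak A$ is multiplicative. $M_{b\mathfrak A}(E)$ is its spectrum: the set of nonzero continuous multiplicative linear functionals on $H_{b\mathfrak A}(E)$. The map $\pi:M_{b\mathfrak A}(E)\to E''$ is $\pi(\varphi)=\varphi|_{E'}$. Aron-Berner extension: for $P\in\mathcal P^k(E)$, extend $\check P$ to $E''\times\dots\times E''$ by weak-star continuity one variable at a time in some order (each such extension is an Arens extension of $\check P$) and restrict to the diagonal; this gives $AB(P)\in\mathcal P^k(E'')$. For $f=\sum_kP_k$, $AB(f)=\sum_kAB(P_k)$. $\mathfrak A$ is $AB$-closed if there is $\alpha>0$ such that for every Banach space $E$, every $k$ and $P\in\mathfrak A_k(E)$, $AB(P)\in\mathfrak A_k(E'')$ and $\|AB(P)\|_{\mathfrak A_k(E'')}\le\alpha^k\|P\|_{\mathfrak A_k(E)}$. $\mathfrak A$ is regular at $E$ if for every $k$ and every $P\in\mathfrak A_k(E)$ every Arens extension of $\check P$ is symmetric. $J_E:E\to E''$ is the canonical injection. For $z\in E''$, $\tilde\tau_z:H_{b\mathfrak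 A}(E)\to H_{b\mathfrak A}(E)$ is $\tilde\tau_z(f)(x)=AB(f)(z+J_Ex)$; it is a well-defined continuous operator and $\varphi\circ\tilde\tau_z\in M_{b\mathfrak A}(E)$ for $\varphi\in M_{b\mathfrak A}(E)$. The topology on $M_{b\mathfrak A}(E)$ is the one with basis the sets $V_{\varphi,\varepsilon}=\{\varphi\circ\tilde\tau_z: z\in E'',\ \|z\|<\varepsilon\}$, $\varphi\in M_{b\mathfrak A}(E)$, $\varepsilon>0$. With it, for $\mathfrak A$ multiplicative, $AB$-closed and regular at $E$, $(M_{b\mathfrak A}(E),\pi)$ is a Riemann domain over $E''$, its connected components are the sets $S(\varphi)=\{\varphi\circ\tilde\tau_z:z\in E''\}$, and $\pi$ maps each of them homeomorphically onto $E''$. *)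

(* Defs.v *)
From HB Require Import structures.
From mathcomp Require Import all_boot all_order all_algebra all_fingroup.
From mathcomp Require Import complex.
From mathcomp Require Import all_classical all_reals.
From mathcomp Require Import topology normedtype sequences exp.
From mathcomp Require Import lra.

Set Implicit Arguments.
Unset Strict Implicit.
Unset Printing Implicit Defensive.

Import Order.TTheory GRing.Theory Num.Theory.
Import numFieldNormedType.Exports.

Local Open Scope classical_set_scope.
Local Open Scope ring_scope.

(* The complex field over R, as a Banach space over itself. It is a copy of R[i]
   because R[i] already carries the R-module structure of the real plane. *)
Definition cplx (R : realType) : Type := R[i].

HB.instance Definition _ (R : realType) := Num.ClosedField.copy (cplx R) R[i].
#[non_forgetful_inheritance]
HB.instance Definition _ (R : realType) :=
  GRing.ComAlgebra.copy (cplx R) (cplx R)^o.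
#[non_forgetful_inheritance]
HB.instance Definition _ (R : realType) := Vector.copy (cplx R) (cplx R)^o.
#[non_forgetful_inheritance]
HB.instance Definition _ (R : realType) :=
  NormedModule.copy (cplx R) (cplx R)^o.

(* The norms of normedModType (cplx R) take their values in cplx R. *)
Definition rnorm (R : realType) (V : normedModType (cplx R)) (x : V) : R :=
  complex.Re (`|x| : cplx R).

Section rnorm.
Variables (R : realType) (V : normedModType (cplx R)).
Implicit Types x y : V.

Definition ofR (r : R) : cplx R := real_complex R r.

Lemma ofR_lt0 (r : R) : (0 < ofR r) = (0 < r).
Proof. exact: (@ltcR R 0 r). Qed.

Lemma ofR_ltP (e : cplx R) : 0 < e -> exists2 r : R, 0 < r & e = ofR r.
Proof.
move=> e0; exists (complex.Re e).
  by move: e0; rewrite (@ltcE R) => /andP[].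
by rewrite /ofR RRe_real// gtr0_real.
Qed.

Lemma ofR_Re (z : cplx R) : 0 <= z -> ofR (complex.Re z) = z.
Proof. by move=> z0; rewrite /ofR RRe_real// ger0_real. Qed.

Lemma rnormE x : `|x| = ofR (rnorm x).
Proof. by rewrite /rnorm ofR_Re. Qed.

Lemma rnorm_lt x (e : R) : (`|x| < ofR e) = (rnorm x < e).
Proof. by rewrite rnormE; exact: ltcR. Qed.

Lemma rnorm_le x (e : R) : (`|x| <= ofR e) = (rnorm x <= e).
Proof. by rewrite rnormE; exact: lecR. Qed.

Lemma rnorm_ge0 x : 0 <= rnorm x.
Proof. by rewrite -(@lecR R) -/(ofR (rnorm x)) -rnormE; exact: normr_ge0. Qed.

Lemma rnorm0 : rnorm (0 : V) = 0.
Proof. by rewrite /rnorm normr0. Qed.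

Lemma rnorm_eq0 x : rnorm x = 0 -> x = 0.
Proof. by move=> x0; apply/normr0_eq0; rewrite rnormE x0. Qed.

Lemma rnormN x : rnorm (- x) = rnorm x.
Proof. by rewrite /rnorm normrN. Qed.

Lemma rnormB x y : rnorm (x - y) = rnorm (y - x).
Proof. by rewrite /rnorm distrC. Qed.

Lemma ler_rnormD x y : rnorm (x + y) <= rnorm x + rnorm y.
Proof.
rewrite -rnorm_le /ofR rmorphD/=; have := ler_normD x y.
by rewrite (rnormE x) (rnormE y).
Qed.

Lemma rnormZ (a : cplx R) x : rnorm (a *: x) = rnorm a * rnorm x.
Proof.
have : ofR (rnorm (a *: x)) = ofR (rnorm a * rnorm x).
    by rewrite -rnormE normrZ (rnormE x) -[`|a|]ofR_Re// /ofR rmorphM.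
exact: complexI.
Qed.

Lemma rcvgP (F : set_system V) (FF : Filter F) y :
  F --> y <-> forall e : R, 0 < e -> F [set z | rnorm (y - z) < e].
Proof.
split=> [/fcvgrPdist_lt Fy e e0|Fy].
  have := Fy (ofR e); rewrite ofR_lt0 => /(_ e0).
  by apply: filterS => z/=; rewrite rnorm_lt.
apply/fcvgrPdist_lt => _ /ofR_ltP[e e0 ->].
by apply: filterS (Fy e e0) => z/=; rewrite rnorm_lt.
Qed.

Lemma rcauchyP (F : set_system V) (FF : ProperFilter F) :
  cauchy F <-> forall e : R, 0 < e -> exists x, F [set z | rnorm (x - z) < e].
Proof.
split=> [/cauchyP Fc e e0|Fc].
  have := Fc (ofR e); rewrite ofR_lt0 => /(_ e0)[x Fx]; exists x.
  by apply: filterS Fx => z; rewrite -ball_normE/= rnorm_lt.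
apply/cauchyP => _ /ofR_ltP[e e0 ->].
have [x Fx] := Fc e e0; exists x.
by apply: filterS Fx => z/=; rewrite -ball_normE/= rnorm_lt.
Qed.

End rnorm.

Lemma cplx_complete (R : realType) (F : set_system (cplx R)) :
  ProperFilter F -> cauchy F -> cvg F.
Proof.
move=> FF /rcauchyP Fc.
have nE (z : cplx R) : rnorm z = Num.sqrt (complex.Re z ^+ 2 + complex.Im z ^+ 2).
  by rewrite /rnorm; case: z.
have ReB (z w : cplx R) : complex.Re (z - w) = complex.Re z - complex.Re w.
  by case: z w => [? ?] [? ?].
have ImB (z w : cplx R) : complex.Im (z - w) = complex.Im z - complex.Im w.
  by case: z w => [? ?] [? ?].
have leRe (z : cplx R) : `|complex.Re z| <= rnorm z.
  by rewrite nE -sqrtr_sqr ler_sqrt ?addr_ge0 ?sqr_ge0// lerDl sqr_ge0.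
have leIm (z : cplx R) : `|complex.Im z| <= rnorm z.
  by rewrite nE -sqrtr_sqr ler_sqrt ?addr_ge0 ?sqr_ge0// lerDr sqr_ge0.
have ReImle (z : cplx R) : rnorm z <= `|complex.Re z| + `|complex.Im z|.
  rewrite nE -[leRHS]ger0_norm ?addr_ge0// -sqrtr_sqr ler_sqrt ?sqr_ge0//.
  by rewrite sqrrD !real_normK ?num_real// lerD2r lerDl mulrn_wge0// mulr_ge0.
have cvg_part (p : cplx R -> R) :
    (forall z w, p (z - w) = p z - p w) -> (forall z, `|p z| <= rnorm z) ->
    exists l : R, p @ F --> l.
  move=> pB ple; apply/cvg_ex/(@R_complete R (p @ F))/cauchyP => e e0.
  have [x Fx] := Fc e e0; exists (p x).
  change (F [set z | `|p x - p z| < e]); apply: filterS Fx => z/= xz.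
  by rewrite -pB (le_lt_trans (ple _)).
have [a Fa] := cvg_part (@complex.Re R) ReB leRe.
have [b Fb] := cvg_part (@complex.Im R) ImB leIm.
apply/cvg_ex; exists (Complex a b : cplx R); apply/rcvgP => e e0.
have e20 : 0 < e / 2 by rewrite divr_gt0.
move/cvgrPdist_lt : Fa => /(_ _ e20) Fa.
move/cvgrPdist_lt : Fb => /(_ _ e20).
apply: filterS2 Fa => z az bz/=; rewrite (le_lt_trans (ReImle _))//.
by rewrite ReB ImB/= [ltRHS]splitr ltrD.
Qed.

HB.instance Definition _ (R : realType) :=
  Uniform_isComplete.Build (cplx R) (@cplx_complete R).


Definition opnorm (R : realType) (V W : normedModType (cplx R)) (f : V -> W) : R :=
  sup [set rnorm (f x) | x in [set x | rnorm x <= 1]].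

Section opnorm.
Variables (R : realType) (V W : normedModType (cplx R)) (f : V -> W).
Hypothesis fL : linear f.

Let F : {linear V -> W} := HB.pack f (GRing.isLinear.Build _ _ _ _ _ fL).

Lemma lin_bounded_continuous (M : R) :
  (forall x, rnorm (f x) <= M * rnorm x) -> continuous f.
Proof.
move=> fM; apply: (@bounded_linear_continuous _ _ _ F).
apply/linear_boundedP; near=> r => x.
have rM : ofR M <= r.
  by near: r; apply: nbhs_pinfty_ge; rewrite (complex_real M 0).
apply: (@le_trans _ _ (ofR (M * rnorm x))); first by rewrite rnorm_le.
by rewrite /ofR rmorphM/= -/(ofR (rnorm x)) -rnormE ler_wpM2r.
Unshelve. all: by end_near. Qed.

Lemma lin_continuous_bounded : continuous f ->
  exists2 M : R, 0 <= M & forall x, rnorm (f x) <= M * rnorm x.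
Proof.
move=> fC; have /linear_boundedP := @continuous_linear_bounded _ _ _ 0 F (fC 0).
move=> /pinfty_ex_gt0[_ /ofR_ltP[M M0 ->] fM]; exists M; first exact: ltW.
move=> x; rewrite -rnorm_le /ofR rmorphM/= -/(ofR (rnorm x)) -rnormE.
exact: fM.
Qed.

Let has_sup_opnorm : continuous f ->
  has_sup [set rnorm (f x) | x in [set x | rnorm x <= 1]].
Proof.
move=> /lin_continuous_bounded[M M0 fM]; split.
  by exists (rnorm (f 0)), 0 => //=; rewrite rnorm0.
exists M => _ [x x1 <-]; rewrite (le_trans (fM _))//.
by rewrite -[leRHS]mulr1 ler_wpM2l.
Qed.

Lemma opnorm_ge0 : continuous f -> 0 <= opnorm f.
Proof.
move=> fC; apply: (le_trans (rnorm_ge0 (f 0))).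
by apply: (sup_upper_bound (has_sup_opnorm fC)); exists 0; rewrite //= rnorm0.
Qed.

Lemma rnorm_opnorm x : continuous f -> rnorm (f x) <= opnorm f * rnorm x.
Proof.
move=> fC; have [x0|x0] := eqVneq (rnorm x) 0.
  rewrite (rnorm_eq0 x0) (linear0 F : f 0 = 0) rnorm0.
  exact: mulr_ge0 (opnorm_ge0 fC) (rnorm_ge0 _).
have xp : 0 < rnorm x by rewrite lt_neqAle eq_sym x0 rnorm_ge0.
have rV : rnorm (ofR (rnorm x)^-1) = (rnorm x)^-1.
  by rewrite /rnorm ger0_norm// /ofR ler0c invr_ge0 rnorm_ge0.
rewrite -ler_pdivrMr// mulrC -rV -rnormZ.
apply: (sup_upper_bound (has_sup_opnorm fC)).
exists (ofR (rnorm x)^-1 *: x); last by rewrite -[f _]/(F _) linearZ.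
by rewrite /= rnormZ rV mulVf.
Qed.

Lemma opnorm_le (M : R) : 0 <= M -> (forall x, rnorm (f x) <= M * rnorm x) ->
  opnorm f <= M.
Proof.
move=> M0 fM; apply: ge_sup.
  by exists (rnorm (f 0)), 0 => //=; rewrite rnorm0.
move=> _ [x x1 <-]; rewrite (le_trans (fM _))//.
by rewrite -[leRHS]mulr1 ler_wpM2l.
Qed.

End opnorm.

Section dual.
Variables (R : realType) (E : normedModType (cplx R)).
Local Notation C := (cplx R).

Definition cont_linear (f : E -> C) : bool := `[< linear f /\ continuous f >].

Lemma cont_linear_submod : submod_closed (cont_linear : {pred E -> C}).
Proof.
split.
  apply/asboolP; split; last exact: cst_continuous.
  by move=> a x y /=; rewrite scaler0 addr0.
move=> a f g /asboolP[fL fC] /asboolP[gL gC]; apply/asboolP; split.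
  move=> b x y; rewrite /= !fctE fL gL !scalerDr addrACA; congr (_ + _ + (_ + _)).
  by rewrite !scalerA mulrC.
move=> x; apply: cvgD; last exact: gC.
by apply: cvgZ; [exact: cvg_cst|exact: fC].
Qed.

HB.instance Definition _ :=
  GRing.isSubmodClosed.Build _ _ cont_linear cont_linear_submod.

Record dual := Dual { dual_fun :> E -> C; _ : cont_linear dual_fun }.

HB.instance Definition _ := [isSub for dual_fun].
HB.instance Definition _ := [Choice of dual by <:].
HB.instance Definition _ := [SubChoice_isSubLmodule of dual by <:].


Lemma dual_linear (f : dual) : linear f.
Proof. by case: f => f /= /asboolP[]. Qed.

Lemma dual_continuous (f : dual) : continuous f.
Proof. by case: f => f /= /asboolP[]. Qed.

Definition dual_norm (f : dual) : C := ofR (opnorm f).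

Lemma dual_normD (f g : dual) : dual_norm (f + g) <= dual_norm f + dual_norm g.
Proof.
have [fL fC gL gC] := And4 (@dual_linear f) (@dual_continuous f)
  (@dual_linear g) (@dual_continuous g).
rewrite /dual_norm /ofR -rmorphD lecR; apply: opnorm_le => [|x].
  exact: addr_ge0 (opnorm_ge0 fL fC) (opnorm_ge0 gL gC).
rewrite (le_trans (ler_rnormD (f x) (g x)))// mulrDl.
exact: lerD (rnorm_opnorm fL x fC) (rnorm_opnorm gL x gC).
Qed.

Lemma dual_normZ (a : C) (f : dual) : dual_norm (a *: f) = `|a| * dual_norm f.
Proof.
have [fL fC] := conj (@dual_linear f) (@dual_continuous f).
have [aL aC] := conj (@dual_linear (a *: f)) (@dual_continuous (a *: f)).
rewrite rnormE /dual_norm /ofR -rmorphM; congr real_complex_def.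
apply/eqP; rewrite eq_le; apply/andP; split.
  apply: opnorm_le => [|x]; first exact: mulr_ge0 (rnorm_ge0 a) (opnorm_ge0 fL fC).
  rewrite (rnormZ a (f x)) -mulrA.
  exact: ler_wpM2l (rnorm_ge0 a) _ _ (rnorm_opnorm fL x fC).
have [a0|a0] := eqVneq a 0.
  have -> : rnorm a = 0 by rewrite a0 rnorm0.
  by rewrite mul0r; exact: opnorm_ge0 aL aC.
have ap : 0 < rnorm a.
  by rewrite lt_neqAle rnorm_ge0 andbT eq_sym; apply: contra a0 => /eqP/rnorm_eq0->.
rewrite mulrC -ler_pdivlMr//; apply: opnorm_le => [|x].
  exact: divr_ge0 (opnorm_ge0 aL aC) (rnorm_ge0 a).
rewrite mulrAC ler_pdivlMr// mulrC -(rnormZ a (f x)).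
exact: (rnorm_opnorm aL x aC).
Qed.

Lemma dual_norm0_eq0 (f : dual) : dual_norm f = 0 -> f = 0.
Proof.
move=> /complexI f0; apply/val_inj/funext => x; apply: rnorm_eq0.
apply/eqP; rewrite eq_le rnorm_ge0 andbT.
have := rnorm_opnorm (@dual_linear f) x (@dual_continuous f).
by rewrite f0 mul0r.
Qed.

HB.instance Definition _ :=
  Lmodule_isNormed.Build C dual dual_normD dual_normZ dual_norm0_eq0.

Lemma dual_rnormE (f : dual) : rnorm f = opnorm f.
Proof. by []. Qed.

Lemma rnorm_dual (f : dual) x : rnorm (f x) <= rnorm f * rnorm x.
Proof. exact: rnorm_opnorm (@dual_linear f) x (@dual_continuous f). Qed.

Lemma dual_complete (F : set_system dual) :
  ProperFilter F -> cauchy F -> cvg F.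
Proof.
move=> FF /rcauchyP Fc.
have cvx x : exists l : C, (fun f : dual => f x) @ F --> l.
  apply/cvg_ex/(@cplx_complete R ((fun f : dual => f x) @ F))/rcauchyP => e e0.
  have x1 : 0 < rnorm x + 1 by rewrite ltr_wpDl ?rnorm_ge0.
  have [g Fg] := Fc (e / (rnorm x + 1)) (divr_gt0 e0 x1); exists (g x).
  change (F [set f : dual | rnorm (g x - f x) < e]).
  apply: filterS Fg => f/=; rewrite ltr_pdivlMr// => gf.
  rewrite (le_lt_trans (rnorm_dual (g - f) x))// (le_lt_trans _ gf)//.
  by rewrite ler_wpM2l ?rnorm_ge0// lerDl.
have {cvx}[g gF] := choice cvx.
have gL : linear g.
  move=> a x y; apply: (cvg_unique _ (gF (a *: x + y))) => /=.
    exact: norm_hausdorff.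
  have -> : (fun f : dual => f (a *: x + y)) = (fun f => a *: f x + f y).
    by apply/funext => f; exact: dual_linear.
  by apply: cvgD => //; apply: cvgZ => //; exact: cvg_cst.
have gclose (h : dual) (e : R) :
    F [set f | rnorm (h - f) < e] -> forall x, rnorm (h x - g x) <= e * rnorm x.
  move=> Fh x; apply/ler_addgt0Pr => d d0.
  have /rcvgP/(_ d d0) Fd := gF x.
  have /(filterI Fh)/filter_ex[f [/= hf fd]] :
    F [set f : dual | rnorm (g x - f x) < d] by exact: Fd.
  rewrite -(subrK (f x) (h x)) -addrA (le_trans (ler_rnormD _ _))//.
  rewrite lerD//; last by rewrite rnormB ltW.
  rewrite (le_trans (rnorm_dual (h - f) x))// ler_wpM2r ?rnorm_ge0//.
  exact: ltW.
have gC : continuous g.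
  have [h Fh] := Fc 1 ltr01.
  apply: (lin_bounded_continuous gL (M := rnorm h + 1)) => x.
  rewrite -[g x](subKr (h x)) (le_trans (ler_rnormD _ _))// mulrDl rnormN.
  by rewrite lerD ?rnorm_dual ?gclose.
have gcl : cont_linear g by exact/asboolP.
apply/cvg_ex; exists (Dual gcl); apply/rcvgP => e e0.
have e40 : 0 < e / 4%:R by rewrite divr_gt0.
have [h Fh] := Fc _ e40; apply: filterS (Fh) => f/= hf.
have gh : rnorm (Dual gcl - h) <= e / 4%:R.
  apply: opnorm_le; [exact: ltW|move=> x].
  rewrite -[rnorm _]/(rnorm (g x - h x)) rnormB; exact: gclose.
rewrite -(subrK h (Dual gcl)) -addrA (le_lt_trans (ler_rnormD _ _))//.
rewrite (le_lt_trans (lerD gh (ltW hf)))// -mulrDr gtr_pMr//.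
by lra.
Qed.

HB.instance Definition _ := Uniform_isComplete.Build dual dual_complete.

End dual.

Section bidual_embedding.
Variables (R : realType) (E : normedModType (cplx R)).

Lemma evalx_cont_linear (x : E) : cont_linear (fun f : dual E => f x).
Proof.
have eL : linear (fun f : dual E => f x) by [].
apply/asboolP; split; first exact: eL.
apply: (lin_bounded_continuous eL (M := rnorm x)) => f.
by rewrite mulrC; exact: rnorm_dual.
Qed.

Definition bidual_embed (x : E) : dual (dual E) := Dual (evalx_cont_linear x).

End bidual_embedding.

Notation banachType R := (completeNormedModType (cplx R)).
Notation bidual E := (dual (dual E)).

Section polynomials.
Variable R : realType.
Local Notation C := (cplx R).

Section multilinear.
Variables (E : normedModType C) (k : nat).

Definition upd (x : 'I_k -> E) (i : 'I_k) (y : E) : 'I_k -> E :=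
  fun j => if j == i then y else x j.

Definition multilinear (A : ('I_k -> E) -> C) : Prop :=
  forall (x : 'I_k -> E) (i : 'I_k), linear (fun y => A (upd x i y)).

Definition symmetric_form (A : ('I_k -> E) -> C) : Prop :=
  forall (s : 'S_k) (x : 'I_k -> E), A (x \o s) = A x.

Definition is_polar (P : E -> C) (A : ('I_k -> E) -> C) : Prop :=
  [/\ multilinear A, symmetric_form A & forall x, A (fun=> x) = P x].

Definition hpoly : set (E -> C) :=
  [set P | continuous P /\ exists A, is_polar P A].

(* The unique symmetric k-linear form whose diagonal is P. *)
Definition polar (P : E -> C) : ('I_k -> E) -> C :=
  xget (fun=> 0) [set A | is_polar P A].

(* P_{a^j} *)
Definition partial_poly (j : nat) (P : E -> C) (a : E) : E -> C :=
  fun x => polar P (fun i => if (i < j)%N then a else x).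

End multilinear.

Section aron_berner.
Variables (E : normedModType C) (k : nat).

Definition weak_star_continuous (g : bidual E -> C) : Prop :=
  continuous
    (g : initial_topology (fun z : bidual E => (z : {ptws dual E -> C})) -> C).

(* B extends A to the bidual by weak-star continuity, one variable at a time, in
   the order s 0, s 1, ...: when the variable s j is extended, the variables
   s i with i < j range over the bidual already and those with j < i still
   range over E. *)
Definition arens_extension (s : 'S_k) (A : ('I_k -> E) -> C)
    (B : ('I_k -> bidual E) -> C) : Prop :=
  (forall x : 'I_k -> E, B (fun i => bidual_embed (x i)) = A x) /\
  (forall (j : 'I_k) (z : 'I_k -> bidual E),
    (forall i : 'I_k, (j < i)%N -> range (@bidual_embed R E) (z (s i))) ->
    weak_star_continuous (fun w => B (upd z (s j) w))).

(* On the diagonal the order of extension does not matter, polar P being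
   symmetric. *)
Definition aron_berner (P : E -> C) : bidual E -> C :=
  xget (fun=> 0) [set Q | exists s B,
    arens_extension s (polar P) B /\ forall z, Q z = B (fun=> z)].

End aron_berner.

Section entire.
Variable E : normedModType C.

Definition taylor_at (f : E -> C) (a : E) (P : nat -> E -> C) : Prop :=
  (forall k, hpoly k (P k)) /\
  exists2 r : R, 0 < r &
    {uniform [set x | rnorm (x - a) < r],
      (fun n x => \sum_(k < n) P k (x - a)) @ \oo --> f}.

Definition entire (f : E -> C) : Prop := forall a, exists P, taylor_at f a P.

(* taylor f k = d^k f(0) / k!; the expansion of f at 0 is unique. *)
Definition taylor (f : E -> C) : nat -> E -> C :=
  xget (fun=> fun=> 0) [set P | taylor_at f 0 P].

Definition aron_berner_fun (f : E -> C) : bidual E -> C :=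
  fun z => limn (series (fun k => aron_berner k (taylor f k) z)).

End entire.
End polynomials.

Section ideals.
Variable R : realType.
Local Notation C := (cplx R).

(* The data of a pair (A, ||.||_A): for each Banach space E the set A(E) and the
   norm of A(E), the latter being meaningful on A(E) only. *)
Record polyclass := Polyclass {
  pmem :> forall E : banachType R, set (E -> C);
  pnorm : forall E : banachType R, (E -> C) -> R }.

Definition pow_fun (k : nat) : C -> C := fun z => z ^+ k.

Record banach_ideal (k : nat) (A : polyclass) : Prop := {
  ideal_hpoly : forall E : banachType R, A E `<=` hpoly k;
  ideal0 : forall E : banachType R, A E (0 : E -> C);
  ideal_lin : forall (E : banachType R) (a : C) (P Q : E -> C),
    A E P -> A E Q -> A E (a *: P + Q);
  ideal_normD : forall (E : banachType R) (P Q : E -> C), A E P -> A E Q ->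
    pnorm A (P + Q) <= pnorm A P + pnorm A Q;
  ideal_normZ : forall (E : banachType R) (a : C) (P : E -> C), A E P ->
    pnorm A (a *: P) = rnorm a * pnorm A P;
  ideal_norm0 : forall (E : banachType R) (P : E -> C), A E P ->
    pnorm A P = 0 -> P = 0;
  ideal_complete : forall (E : banachType R) (u : nat -> E -> C),
    (forall n, A E (u n)) ->
    (forall e : R, 0 < e -> exists N, forall m n, (N <= m)%N -> (N <= n)%N ->
      pnorm A (u m - u n) < e) ->
    exists2 P : E -> C, A E P & pnorm A (u n - P) @[n --> \oo] --> (0 : R);
  ideal_comp : forall (E1 E : banachType R) (T : E1 -> E) (P : E -> C),
    linear T -> continuous T -> A E P ->
    A E1 (P \o T) /\ pnorm A (P \o T) <= pnorm A P * opnorm T ^+ k;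
  ideal_pow : A C (pow_fun k) /\ pnorm A (pow_fun k) = 1 }.

(* Sequences (A_k)_{k >= 1} are functions on nat whose value at 0 is irrelevant. *)
Definition coherent (A : nat -> polyclass) : Prop :=
  (forall k, (0 < k)%N -> banach_ideal k (A k)) /\
  exists c d : R, [/\ 0 < c, 0 < d &
    forall (E : banachType R) (k : nat), (0 < k)%N ->
      (forall (P : E -> C) (a : E), A k.+1 E P ->
        A k E (partial_poly k.+1 1 P a) /\
        pnorm (A k) (partial_poly k.+1 1 P a) <= c * pnorm (A k.+1) P * rnorm a) /\
      (forall (P : E -> C) (g : dual E), A k E P ->
        A k.+1 E (g \* P) /\
        pnorm (A k.+1) (g \* P) <= d * rnorm g * pnorm (A k) P)].

Definition multiplicative_seq (A : nat -> polyclass) : Prop :=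
  coherent A /\
  exists M : R, forall k l, (0 < k)%N -> (0 < l)%N ->
    forall (E : banachType R) (P Q : E -> C), A k E P -> A l E Q ->
      A (k + l)%N E (P \* Q) /\
      pnorm (A (k + l)%N) (P \* Q) <= M ^+ (k + l) * pnorm (A k) P * pnorm (A l) Q.

Section functionals.
Variables (E : Type) (D : set (E -> C)).

(* A functional on D is the restriction to D of some phi : (E -> C) -> C. *)
Definition linear_on (phi : (E -> C) -> C) : Prop :=
  forall (a : C) (f g : E -> C), D f -> D g -> phi (a *: f + g) = a * phi f + phi g.

(* Continuity on D for the topology given by a directed family of seminorms
   p r, r > 0. *)
Definition continuous_on (p : R -> (E -> C) -> R) (phi : (E -> C) -> C) : Prop :=
  forall f, D f -> forall e : R, 0 < e -> exists r d : R, [/\ 0 < r, 0 < d &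
    forall g, D g -> p r (g - f) < d -> rnorm (phi g - phi f) < e].

End functionals.

Definition ideal_dual (A : polyclass) (E : banachType R) : set ((E -> C) -> C) :=
  [set phi | linear_on (A E) phi /\ continuous_on (A E) (fun=> pnorm A (E := E)) phi].

Definition ideal_dual_norm (A : polyclass) (E : banachType R)
    (phi : (E -> C) -> C) : R :=
  sup [set rnorm (phi P) | P in [set P | A E P /\ pnorm A P <= 1]].

Definition weakly_differentiable (A : nat -> polyclass) : Prop :=
  coherent A /\
  exists K : R, forall k l, (0 < l)%N -> (l < k)%N ->
    forall (E : banachType R) (P : E -> C) (phi : (E -> C) -> C),
      A k E P -> ideal_dual (A (k - l)%N) phi ->
      A l E (fun x => phi (partial_poly k l P x)) /\
      pnorm (A l) (fun x => phi (partial_poly k l P x)) <=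
        K ^+ k * ideal_dual_norm (A (k - l)%N) phi * pnorm (A k) P.

Definition AB_closed (A : nat -> polyclass) : Prop :=
  exists2 alpha : R, 0 < alpha &
    forall (E : banachType R) (k : nat) (P : E -> C), (0 < k)%N -> A k E P ->
      A k (bidual E) (aron_berner k P) /\
      pnorm (A k) (aron_berner k P : bidual E -> C) <= alpha ^+ k * pnorm (A k) P.

Definition regular_at (A : nat -> polyclass) (E : banachType R) : Prop :=
  forall (k : nat) (P : E -> C), (0 < k)%N -> A k E P ->
    forall s B, arens_extension s (polar P : ('I_k -> E) -> C) B ->
      symmetric_form B.

End ideals.

Section spectrum.
Variables (R : realType) (A : nat -> polyclass R) (E : banachType R).
Local Notation C := (cplx R).

Definition Hb : set (E -> C) :=
  [set f | [/\ entire f,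
    forall k, (0 < k)%N -> A k E (taylor f k) &
    pnorm (A k) (taylor f k) `^ k%:R^-1 @[k --> \oo] --> (0 : R)]].

Definition Hb_seminorm (r : R) (f : E -> C) : R :=
  rnorm (f 0) +
  limn (series (fun k => pnorm (A k.+1) (taylor f k.+1) * r ^+ k.+1)).

(* phi is set to 0 outside Hb, so that two elements of the spectrum are equal
   as soon as they agree on Hb. *)
Record is_character (phi : (E -> C) -> C) : Prop := {
  char_out : forall f, ~ Hb f -> phi f = 0;
  char_linear : linear_on Hb phi;
  char_mul : forall f g, Hb f -> Hb g -> phi (f \* g) = phi f * phi g;
  char_continuous : continuous_on Hb Hb_seminorm phi;
  char_nonzero : exists2 f, Hb f & phi f <> 0 }.

Record spectrum := Spectrum {
  spectrum_fun :> (E -> C) -> C;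
  _ : is_character spectrum_fun }.

HB.instance Definition _ := gen_eqMixin spectrum.
HB.instance Definition _ := gen_choiceMixin spectrum.

Definition tau (z : bidual E) (f : E -> C) : E -> C :=
  fun x => aron_berner_fun f (z + bidual_embed x).

(* phi \o tau z for ||z|| < e *)
Definition basic_nbhs (phi : spectrum) (e : R) : set spectrum :=
  [set psi | exists2 z : bidual E, rnorm z < e &
    forall f, Hb f -> psi f = phi (tau z f)].

(* The sets basic_nbhs phi e are given as a subbase; they are a basis of the
   topology when A is multiplicative, AB-closed and regular at E. *)
HB.instance Definition _ := isSubBaseTopological.Build spectrum
  (I := set spectrum)
  [set V | exists phi (e : R), 0 < e /\ V = basic_nbhs phi e] id.

(* The restriction of phi to the dual of E. *)
Definition spectrum_pi (phi : spectrum) : bidual E :=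
  xget 0 [set z : bidual E | forall g : dual E, z g = phi g].

Definition spectrum_ext (f : E -> C) (phi : spectrum) : C := phi f.

End spectrum.

(* Main.v *)
From mathcomp Require Import all_boot all_order all_algebra all_fingroup.
From mathcomp Require Import complex.
From mathcomp Require Import all_classical all_reals.
From mathcomp Require Import topology normedtype sequences exp.
From mathcomp Require Import ring lra zify.
Require Import Defs.

(** Let phi be a point of the spectrum, f = sum_k P_k a function of bounded type on E, J
    the embedding of E in its bidual and AB the Aron-Berner extension. The character
    phi o tau_z sends f to phi (x |-> AB(f)(z + J x)), and the binomial formula for the
    polynomials AB(P_k) turns this number into

      sum_k sum_(i <= k) binom(k, i) phi ((AB(P_k))_(z^i) o J).

    As a function of z, the term of index (k, i) is a polynomial of degree i of the kind
    that weak differentiability controls, on the bidual, for the polynomial AB(P_k) and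
    the functional Q |-> phi (Q o J). It belongs to the ideal of degree i, with norm at
    most K b^k times the norm of P_k for constants K and b that do not depend on i. The
    norms of the P_k decrease faster than any geometric sequence, so for each i the terms
    can be summed over k in norm, and the sums decrease in the same way: this is
    expands_array, and the result for z |-> f~(phi o tau_z) is spectrum_ext_orbit_Hb.

    It remains to compare this parametrization by z with the chart pi. The operators tau_z
    are multiplicative and satisfy tau_z tau_w = tau_(w + z) (tau_mul, tau_tau), so the
    translates phi o tau_z are characters and the orbits partition the spectrum. Orbits are
    open, hence closed, and each one is joined together by the paths t |-> phi o tau_(t z):
    the component of phi is its orbit (connected_component_orbit). Since
    pi (phi o tau_z) = pi(phi) + z, the function of the theorem is
    w |-> f~(phi o tau_(w - pi(phi))), a translate of the one above.

    Regularity makes all Arens extensions of the polar form of a P in the ideal symmetric,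
    hence weak-star continuous in each variable separately, hence unique, because E is
    weak-star dense in its bidual. The Aron-Berner extension is then read off from any
    separately weak-star continuous form with the right diagonal (aron_bernerE), which
    gives its linearity, its multiplicativity and its compatibility with freezing
    variables at points of the bidual (aron_berner_partial), on which the group law rests.

    Functions of bounded type are handled throughout by their expansions in homogeneous
    polynomials, with constants in degree 0 (expands_Hb, Hb_expands). *)

Set Implicit Arguments.
Unset Strict Implicit.
Unset Printing Implicit Defensive.

Import Order.TTheory GRing.Theory Num.Theory.
Import numFieldNormedType.Exports.

Local Open Scope classical_set_scope.
Local Open Scope ring_scope.

(** * Superexponentially small sequences and their series *)

Section rapid.
Variable R : realType.
Implicit Types (u v : nat -> R) (e B c : R).

(** For nonnegative sequences this is lim u_k^(1/k) = 0, in a form in which sums,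
    products and geometric factors are handled without extracting roots. *)
Definition rapid u := forall e, 0 < e -> exists C : R, forall k, u k <= C * e ^+ k.

Lemma rapid_bound u e : rapid u -> 0 < e ->
  exists2 C : R, 0 <= C & forall k, u k <= C * e ^+ k.
Proof.
move=> ur e0; have [C uC] := ur e e0; exists `|C| => // k.
by apply: (le_trans (uC k)); apply: ler_wpM2r (ler_norm C); rewrite exprn_ge0// ltW.
Qed.

Lemma rapid_le v u : rapid u -> (forall k, v k <= u k) -> rapid v.
Proof.
by move=> ur vu e /ur[C uC]; exists C => k; apply: le_trans (vu k) (uC k).
Qed.

Lemma rapidD u v : rapid u -> rapid v -> rapid (fun k => u k + v k).
Proof.
move=> ur vr e e0; have [C uC] := ur e e0; have [D vD] := vr e e0.
by exists (C + D) => k; rewrite mulrDl lerD.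
Qed.

Lemma rapidM_geom c B u : 0 <= c -> 0 <= B -> rapid u ->
  rapid (fun k => c * B ^+ k * u k).
Proof.
move=> c0 B0 ur e e0; have B1 : 0 < B + 1 by rewrite ltr_wpDl.
have [C C0 uC] := rapid_bound ur (divr_gt0 e0 B1).
exists (c * C) => k.
have -> : c * C * e ^+ k = c * (B + 1) ^+ k * (C * (e / (B + 1)) ^+ k).
  rewrite expr_div_n; field; exact: expf_neq0 (lt0r_neq0 B1).
apply: (@le_trans _ _ (c * B ^+ k * (C * (e / (B + 1)) ^+ k))).
  by rewrite ler_wpM2l// mulr_ge0// exprn_ge0.
rewrite ler_wpM2r//; last first.
  by rewrite ler_wpM2l// lerXn2r ?nnegrE ?lerDl// ltW.
by rewrite mulr_ge0// exprn_ge0// divr_ge0// ltW.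
Qed.

Lemma rapid_geom B u : 0 <= B -> rapid u -> rapid (fun k => B ^+ k * u k).
Proof.
move=> B0 ur; apply: (rapid_le (rapidM_geom ler01 B0 ur)) => k.
by rewrite mul1r.
Qed.

Lemma rapidZ c u : 0 <= c -> rapid u -> rapid (fun k => c * u k).
Proof.
move=> c0 ur; apply: (rapid_le (rapidM_geom c0 ler01 ur)) => k.
by rewrite expr1n mulr1.
Qed.

Lemma natr_le_exp2 k : k.+1%:R <= 2 ^+ k :> R.
Proof. by rewrite -natrX ler_nat; exact: ltn_expl. Qed.

Lemma geom_sum_le2 e n : 0 <= e -> e <= 2^-1 -> \sum_(i < n) e ^+ i <= 2.
Proof.
move=> e0 e2; have e1 : 2^-1 <= 1 - e by lra.
have : (1 - e) * \sum_(i < n) e ^+ i <= 1.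
  by rewrite -opprB mulNr -subrX1 opprB lerBlDr lerDl exprn_ge0.
have : 0 <= \sum_(i < n) e ^+ i by apply: sumr_ge0 => i _; rewrite exprn_ge0.
nra.
Qed.

(** The bound does not depend on the upper end m, so it survives in the limit. *)
Lemma rapid_tail u e : (forall k, 0 <= u k) -> rapid u -> 0 < e ->
  exists2 C : R, 0 <= C & forall n m, \sum_(n <= k < m) u k <= C * e ^+ n.
Proof.
move=> u0 ur e0; set d := Num.min e 2^-1.
have d0 : 0 < d by rewrite lt_min e0/= invr_gt0.
have de : d <= e by rewrite ge_min lexx.
have d2 : d <= 2^-1 by rewrite ge_min lexx orbT.
(* With ratio d at most 1/2 a tail is at most twice its first term. *)
have [C C0 uC] := rapid_bound ur d0; exists (2 * C); first exact: mulr_ge0.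
move=> n m; apply: (@le_trans _ _ (2 * C * d ^+ n)); last first.
  by rewrite ler_wpM2l ?mulr_ge0// lerXn2r ?nnegrE ?(ltW d0) ?(ltW e0).
apply: (@le_trans _ _ (\sum_(n <= k < m) C * d ^+ k)); first exact: ler_sum.
rewrite -mulr_sumr [2 * C]mulrC -mulrA ler_wpM2l//.
have [mn|/ltnW nm] := leqP m n.
  by rewrite big_geq// mulr_ge0// exprn_ge0// ltW.
rewrite -{1}[n]add0n big_addn.
under eq_bigr do rewrite exprD.
have H p : \sum_(0 <= i < p) d ^+ i <= 2 by rewrite big_mkord geom_sum_le2// ltW.
by rewrite -mulr_suml mulrC [leRHS]mulrC ler_wpM2l// exprn_ge0// ltW.
Qed.

(** A polynomial number of terms is absorbed by halving the ratio. *)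
Lemma sum_const_half_geom n m c e : (n <= m.+1)%N -> 0 <= c -> 0 < e ->
  \sum_(j < n) c * (e / 2) ^+ m <= c * e ^+ m.
Proof.
move=> nm c0 e0; rewrite sumr_const card_ord.
have -> : c * (e / 2) ^+ m *+ n = n%:R / 2 ^+ m * (c * e ^+ m).
  by rewrite -mulr_natl expr_div_n; ring.
rewrite ler_piMl ?mulr_ge0 ?exprn_ge0 ?(ltW e0)//.
rewrite ler_pdivrMr ?exprn_gt0// mul1r.
by apply: (le_trans _ (natr_le_exp2 _)); rewrite ler_nat.
Qed.

Lemma geom_small c e : 0 < e ->
  exists N, forall n, (N <= n)%N -> c * 2^-1 ^+ n < e.
Proof.
move=> e0; exists (Num.truncn (c / e)).+1 => n cn.
rewrite exprVn ltr_pdivrMr ?exprn_gt0// mulrC -ltr_pdivrMr//.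
apply: (lt_le_trans (truncnS_gt _)); apply: (le_trans _ (natr_le_exp2 _)).
by rewrite ler_nat leqW.
Qed.

Lemma half_gt0 : 0 < 2^-1 :> R. Proof. by rewrite invr_gt0. Qed.

Lemma rapid_small u e : rapid u -> 0 < e ->
  exists N, forall n, (N <= n)%N -> u n < e.
Proof.
move=> ur e0; have [K _ uK] := rapid_bound ur half_gt0.
have [N NK] := geom_small K e0.
by exists N => n /NK; apply: le_lt_trans.
Qed.

Lemma term_le_sum u n m : (forall k, 0 <= u k) -> (m < n)%N ->
  u m <= \sum_(k < n) u k.
Proof.
move=> u0 mn; rewrite (bigD1 (Ordinal mn))//= lerDl.
by apply: sumr_ge0 => i _.
Qed.

(** The exact form in which the radius of convergence enters the definition of
    the spaces of holomorphic functions of bounded type. *)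
Lemma rapidP u : (forall k, 0 <= u k) ->
  rapid u <-> u k `^ k%:R^-1 @[k --> \oo] --> (0 : R).
Proof.
move=> u0; split=> [ur|u_cvg e e0].
- apply/cvgrPdist_lt => e e0.
  have e4 : 0 < e / 4 by rewrite divr_gt0.
  have [C C0 uC] := rapid_bound ur e4.
  exists (Num.truncn C).+1 => // k /= Ck.
  have k0 : (0 < k)%N by apply: leq_trans Ck.
  rewrite sub0r normrN ger0_norm ?powR_ge0//.
  apply: (@le_lt_trans _ _ (e / 2)); last by rewrite ltr_pdivrMr// ltr_pMr ?ltr1n.
  have -> : e / 2 = ((e / 2) ^+ k) `^ k%:R^-1.
    rewrite -powR_mulrn; last by rewrite divr_ge0// ltW.
    by rewrite -powRrM mulfV ?pnatr_eq0 -?lt0n// powRr1// divr_ge0// ltW.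
  apply: ge0_ler_powR; rewrite ?nnegrE ?invr_ge0 ?exprn_ge0 ?divr_ge0 ?(ltW e0)//.
  apply: (le_trans (uC k)).
  have -> : e / 2 = 2 * (e / 4) by field.
  rewrite [leRHS]exprMn ler_wpM2r ?exprn_ge0 ?(ltW e4)//.
  apply: (le_trans _ (natr_le_exp2 k)).
  apply: (le_trans (ltW (truncnS_gt C))); rewrite ler_nat.
  exact: leqW Ck.
- move/cvgrPdist_lt : u_cvg => /(_ e e0)[N _ Nu].
  have uN k : (N < k)%N -> u k <= e ^+ k.
    move=> Nk; have := Nu k (ltnW Nk); rewrite /= sub0r normrN ger0_norm ?powR_ge0//.
    have k0 : k%:R != 0 :> R by rewrite pnatr_eq0 -lt0n (leq_trans _ Nk).
    move=> /ltW uke; have -> : u k = (u k `^ k%:R^-1) ^+ k.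
      by rewrite -powR_mulrn ?powR_ge0// -powRrM mulVf// powRr1.
    by rewrite lerXn2r ?nnegrE ?powR_ge0 ?(ltW e0).
  (* The summand 1 serves the large indices, the sum the finitely many others. *)
  exists (1 + \sum_(k < N.+1) u k / e ^+ k) => k.
  have ek : 0 < e ^+ k by rewrite exprn_gt0.
  rewrite -ler_pdivrMr//; have [kN|Nk] := ltnP k N.+1.
    rewrite -[leLHS]add0r lerD//.
    apply: (@term_le_sum (fun i => u i / e ^+ i)) kN => i.
    by rewrite divr_ge0// exprn_ge0// ltW.
  apply: (@le_trans _ _ 1); first by rewrite ler_pdivrMr// mul1r uN.
  rewrite lerDl sumr_ge0// => i _.
  by rewrite divr_ge0// exprn_ge0// ltW.
Qed.

End rapid.
Lemma sum_ord_split (V : nmodType) (a : nat -> V) n m : (n <= m)%N ->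
  \sum_(k < m) a k = \sum_(k < n) a k + \sum_(n <= k < m) a k.
Proof.
by move=> nm; rewrite -!(big_mkord xpredT a) (big_cat_nat _ nm).
Qed.

Lemma sum_nat_eq0 (V : nmodType) (a : nat -> V) n m :
  (forall k, (n <= k)%N -> a k = 0) -> \sum_(n <= k < m) a k = 0.
Proof.
by move=> a0; rewrite big_nat_cond big1// => k /andP[/andP[/a0]].
Qed.

Section complex_series.
Variable R : realType.
Local Notation C := (cplx R).
Implicit Types (a b : nat -> C) (l s : C).

Lemma rnormM (x y : C) : rnorm (x * y) = rnorm x * rnorm y.
Proof. exact: (rnormZ x y). Qed.

Lemma rnorm1 : rnorm (1 : C) = 1.
Proof. by rewrite /rnorm normr1. Qed.

Lemma rnorm_ofR (r : R) : rnorm (ofR r) = `|r|.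
Proof. by rewrite /rnorm /ofR /= expr0n/= addr0 sqrtr_sqr. Qed.

Lemma ofR_nat n : ofR n%:R = n%:R :> C.
Proof. by rewrite /ofR rmorph_nat. Qed.

Lemma rnorm_nat n : rnorm (n%:R : C) = n%:R.
Proof. by rewrite -ofR_nat rnorm_ofR ger0_norm. Qed.

Lemma rnormX (x : C) n : rnorm (x ^+ n) = rnorm x ^+ n.
Proof.
by elim: n => [|n IH]; rewrite ?expr0 ?rnorm1// !exprS rnormM IH.
Qed.

Lemma ler_rnorm_sum (V : normedModType C) I (r : seq I) (P : pred I) (F : I -> V) :
  rnorm (\sum_(i <- r | P i) F i) <= \sum_(i <- r | P i) rnorm (F i).
Proof.
elim/big_rec2: _ => [|i y x _ xy]; first by rewrite rnorm0.
by apply: (le_trans (ler_rnormD _ _)); rewrite lerD2l.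
Qed.

(** The expansion of a function of bounded type in homogeneous polynomials converges
    in this strong sense at every point, and the form of the definition reduces the
    algebra of such series to that of rapidly decreasing sequences. *)
Definition csum a l := rapid (fun n => rnorm (\sum_(k < n) a k - l)).

Lemma csum_cvg a l : csum a l -> series a @ \oo --> l.
Proof.
move=> al; apply/rcvgP => e e0; have [N aN] := rapid_small al e0.
by exists N => // n /= /aN; rewrite rnormB /series/= big_mkord.
Qed.

Lemma csum_lim a l : csum a l -> limn (series a) = l.
Proof. by move=> /csum_cvg; apply: cvg_lim; exact: norm_hausdorff. Qed.

Lemma csum_unique a l s : csum a l -> csum a s -> l = s.
Proof. by move=> /csum_lim <- /csum_lim <-. Qed.

Lemma csum_finite a n : (forall k, (n <= k)%N -> a k = 0) ->
  csum a (\sum_(k < n) a k).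
Proof.
move=> a0 e e0.
exists (\sum_(m < n) rnorm (\sum_(k < m) a k - \sum_(k < n) a k) / e ^+ m) => m.
have em p : 0 < e ^+ p by rewrite exprn_gt0.
have [mn|nm] := ltnP m n.
  rewrite -ler_pdivrMr//.
  pose v m := rnorm (\sum_(k < m) a k - \sum_(k < n) a k) / e ^+ m.
  apply: (term_le_sum (u := v)) mn => i.
  by rewrite divr_ge0 ?rnorm_ge0// ltW.
rewrite (sum_ord_split _ nm) sum_nat_eq0// addr0 subrr rnorm0.
rewrite mulr_ge0 ?(ltW (em _))// sumr_ge0// => i _.
by rewrite divr_ge0 ?rnorm_ge0// ltW.
Qed.

Lemma csum_lin a b l s (c : C) : csum a l -> csum b s ->
  csum (fun k => c * a k + b k) (c * l + s).
Proof.
move=> al bs; apply: (rapid_le (rapidD (rapidZ (rnorm_ge0 c) al) bs)) => n.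
rewrite -rnormM big_split/= -mulr_sumr opprD addrACA -mulrBr.
exact: ler_rnormD.
Qed.

Lemma cplx_seq_complete a :
  (forall e : R, 0 < e -> exists N, forall m n, (N <= m)%N -> (N <= n)%N ->
     rnorm (a m - a n) < e) ->
  exists l, forall e : R, 0 < e -> exists N, forall n, (N <= n)%N -> rnorm (a n - l) < e.
Proof.
move=> ac; have /cvg_ex[l al] : cvg (a @ \oo).
  apply/(@cplx_complete R (a @ \oo))/rcauchyP => e e0; have [N aN] := ac e e0.
  by exists (a N), N => // n /= Nn; exact: aN.
exists l => e e0; move/rcvgP : al => /(_ e e0)[N _ lN]; exists N => n Nn.
by rewrite rnormB; exact: lN.
Qed.

(** The bound on the remainder passes to the limit; it is stated with an
    arbitrary majorant of the tails so that it stays uniform when the series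
    depends on parameters. *)
Lemma csum_remainder a l (u w : nat -> R) : (forall k, rnorm (a k) <= u k) ->
  (forall n m, \sum_(n <= k < m) u k <= w n) -> csum a l ->
  forall n, rnorm (\sum_(k < n) a k - l) <= w n.
Proof.
move=> au uw al n; apply/ler_addgt0Pr => e e0.
have [N /(_ _ (leq_maxr n N)) aN] := rapid_small al e0.
have := leq_maxl n N; move: (maxn n N) aN => m aN nm.
rewrite -(subrK (\sum_(k < m) a k) (\sum_(k < n) a k)) -addrA.
apply: (le_trans (ler_rnormD _ _)); apply: lerD (ltW aN).
rewrite rnormB (sum_ord_split _ nm) addrC addKr.
apply: (le_trans (ler_rnorm_sum _ _ _)); apply: le_trans (uw n m).
exact: ler_sum.
Qed.

Lemma csum_norm_le a l (u : nat -> R) (w : R) : (forall k, rnorm (a k) <= u k) ->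
  (forall m, \sum_(k < m) u k <= w) -> csum a l -> rnorm l <= w.
Proof.
move=> au uw al; apply/ler_addgt0Pr => e e0.
have [N /(_ N (leqnn N)) aN] := rapid_small al e0.
rewrite -(subrK (\sum_(k < N) a k) l) addrC.
apply: (le_trans (ler_rnormD _ _)); apply: lerD; last by rewrite rnormB ltW.
apply: (le_trans (ler_rnorm_sum _ _ _)); apply: le_trans (uw N).
exact: ler_sum.
Qed.

(** Rearrangement of a triangular array (D k j), j <= k. The first N row sums and
    the first N column sums differ by N column remainders, each bounded by the
    same rapidly decreasing sequence. *)
Lemma csum_rearrange (D : nat -> nat -> C) (u : nat -> R) (t : nat -> C) :
  (forall k, 0 <= u k) -> rapid u -> (forall k j, rnorm (D k j) <= u k) ->
  (forall k j, (k < j)%N -> D k j = 0) ->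
  (forall j, csum (fun k => D k j) (t j)) ->
  rapid (fun n => rnorm (\sum_(k < n) \sum_(j < k.+1) D k j - \sum_(j < n) t j)).
Proof.
move=> u0 ur Du D0 Dt e e0.
have e2 : 0 < e / 2 by rewrite divr_gt0.
have [K K0 uK] := rapid_tail u0 ur e2; exists K => n.
have -> : \sum_(k < n) \sum_(j < k.+1) D k j = \sum_(j < n) \sum_(k < n) D k j.
  rewrite exchange_big/=; apply: eq_bigr => k _.
  rewrite (sum_ord_split _ (ltn_ord k)) sum_nat_eq0 ?addr0// => j; exact: D0.
rewrite -sumrB; apply: (le_trans (ler_rnorm_sum _ _ _)).
apply: (@le_trans _ _ (\sum_(j < n) K * (e / 2) ^+ n)).
  apply: ler_sum => j _.
  exact: (csum_remainder (fun k => Du k j) uK (Dt j) n).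
exact: sum_const_half_geom.
Qed.

Lemma csum_rows_columns (D : nat -> nat -> C) (u : nat -> R) (t : nat -> C) s :
  (forall k, 0 <= u k) -> rapid u -> (forall k j, rnorm (D k j) <= u k) ->
  (forall k j, (k < j)%N -> D k j = 0) ->
  (forall j, csum (fun k => D k j) (t j)) ->
  csum (fun k => \sum_(j < k.+1) D k j) s <-> csum t s.
Proof.
move=> u0 ur Du D0 Dt; have Dr := csum_rearrange u0 ur Du D0 Dt.
split=> h; apply: (rapid_le (rapidD Dr h)) => n; last first.
  by apply: le_trans (ler_rnormD _ _); rewrite addrA subrK.
apply: (@le_trans _ _ (rnorm (- (\sum_(k < n) \sum_(j < k.+1) D k j - \sum_(j < n) t j) +
  (\sum_(k < n) \sum_(j < k.+1) D k j - s)))).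
  by rewrite opprB addrA subrK.
by apply: (le_trans (ler_rnormD _ _)); rewrite rnormN.
Qed.

Lemma csum_term_shift a l i : csum a l ->
  csum (fun k => if (k < i)%N then 0 else a (k - i)%N) l.
Proof.
move=> al e e0; have [K K0 aK] := rapid_bound al e0.
exists (K / e ^+ i + \sum_(m < i) rnorm l / e ^+ m) => n.
have ep p : 0 < e ^+ p by rewrite exprn_gt0.
have S0 : 0 <= \sum_(m < i) rnorm l / e ^+ m.
  by apply: sumr_ge0 => m _; rewrite divr_ge0 ?rnorm_ge0// ltW.
have [ni|inn] := ltnP n i.
  rewrite big1 => [|k _]; last by rewrite (ltn_trans _ ni).
  rewrite sub0r rnormN -ler_pdivrMr//.
  rewrite -[leLHS]add0r lerD ?divr_ge0 ?(ltW (ep _))//.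
  apply: (term_le_sum (u := fun m => rnorm l / e ^+ m)) ni => m.
  by rewrite divr_ge0 ?rnorm_ge0// ltW.
rewrite (sum_ord_split (fun k => if (k < i)%N then 0 else a (k - i)%N) inn).
rewrite big1 ?add0r => [|k _]; last by rewrite ltn_ord.
rewrite -{1}(add0n i) big_addn big_mkord.
under eq_bigr => k _ do rewrite ltnNge leq_addl/= addnK.
apply: (le_trans (aK _)); rewrite mulrDl -[leLHS]addr0 lerD ?mulr_ge0 ?(ltW (ep _))//.
rewrite -mulrA ler_wpM2l// -(subnK inn) exprD addnK mulrC mulfK//.
exact: lt0r_neq0.
Qed.

(** Cauchy products are a case of rearrangement: column i of the array
    (a i * b (n - i)) is a shift of the series of b, multiplied by a i. *)
Lemma csum_cauchy_product a b l s (u v : nat -> R) :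
  (forall k, rnorm (a k) <= u k) -> (forall k, rnorm (b k) <= v k) ->
  rapid u -> rapid v -> csum a l -> csum b s ->
  csum (fun n => \sum_(i < n.+1) a i * b (n - i)%N) (l * s).
Proof.
move=> au bv ur vr al bs.
have u0 k : 0 <= u k := le_trans (rnorm_ge0 _) (au k).
have v0 k : 0 <= v k := le_trans (rnorm_ge0 _) (bv k).
pose D n i := if (n < i)%N then 0 else a i * b (n - i)%N.
have -> : (fun n => \sum_(i < n.+1) a i * b (n - i)%N) =
          (fun n => \sum_(i < n.+1) D n i).
  apply/funext => n; apply: eq_bigr => i _.
  by rewrite /D ltnNge -ltnS ltn_ord.
pose w n := \sum_(i < n.+1) u i * v (n - i)%N.
have wr : rapid w.
  move=> e e0; have e2 : 0 < e / 2 by rewrite divr_gt0.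
  have [K K0 uK] := rapid_bound ur e2; have [L L0 vL] := rapid_bound vr e2.
  exists (K * L) => n.
  apply: (@le_trans _ _ (\sum_(i < n.+1) K * L * (e / 2) ^+ n)).
    apply: ler_sum => i _; have le_in : (i <= n)%N by rewrite -ltnS.
    apply: (le_trans (ler_pM (u0 _) (v0 _) (uK i) (vL _))).
    by rewrite mulrACA -exprD subnKC.
  by apply: sum_const_half_geom => //; exact: mulr_ge0.
apply/(@csum_rows_columns D w (fun i => a i * s)) => //.
- by move=> k; apply: sumr_ge0 => i _; apply: mulr_ge0.
- move=> n i; rewrite /D; case: ltnP => ni.
    by rewrite rnorm0 sumr_ge0// => j _; rewrite mulr_ge0.
  rewrite rnormM /w.
  apply: (@le_trans _ _ (u i * v (n - i)%N)); first by rewrite ler_pM ?rnorm_ge0.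
  by apply: (term_le_sum (u := fun i => u i * v (n - i)%N)) => // j; rewrite mulr_ge0.
- by move=> n i; rewrite /D => ->.
- move=> i; have := csum_term_shift i bs.
  move=> /(csum_lin (a i)) /(_ (csum_finite (a := fun=> 0) (n := 0) (fun _ _ => erefl _))).
  rewrite big_ord0 addr0; congr (csum _ _); apply/funext => n.
  by rewrite addr0 /D; case: ifP => // _; rewrite mulr0.
- have := csum_lin s al (csum_finite (a := fun=> 0) (n := 0) (fun _ _ => erefl _)).
  rewrite big_ord0 addr0 mulrC; congr (csum _ _); apply/funext => n.
  by rewrite addr0 mulrC.
Qed.

Lemma csum_exists a (u : nat -> R) : (forall k, rnorm (a k) <= u k) -> rapid u ->
  exists l, csum a l.
Proof.
move=> au ur; have u0 k : 0 <= u k := le_trans (rnorm_ge0 _) (au k).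
have dist n m : (n <= m)%N ->
    rnorm (\sum_(k < m) a k - \sum_(k < n) a k) <= \sum_(n <= k < m) u k.
  move=> nm; rewrite (sum_ord_split _ nm) addrC addKr.
  by apply: (le_trans (ler_rnorm_sum _ _ _)); exact: ler_sum.
have [l al] : exists l, forall e : R, 0 < e -> exists N, forall n, (N <= n)%N ->
    rnorm (\sum_(k < n) a k - l) < e.
  apply: cplx_seq_complete => e e0.
  have [K K0 uK] := rapid_tail u0 ur (half_gt0 R).
  have [N KN] := geom_small K e0.
  exists N => m n Nm Nn; wlog nm : m n Nm Nn / (n <= m)%N.
    by move=> H; have [/H|/ltnW/H] := leqP n m; [exact|rewrite rnormB; exact].
  exact: le_lt_trans (dist _ _ nm) (le_lt_trans (uK _ _) (KN _ Nn)).
exists l => e e0; have [K K0 uK] := rapid_tail u0 ur e0; exists K => n.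
apply/ler_addgt0Pr => d d0; have [N /(_ _ (leq_maxr n N)) aN] := al d d0.
rewrite -(subrK (\sum_(k < maxn n N) a k) (\sum_(k < n) a k)) -addrA.
apply: (le_trans (ler_rnormD _ _)); apply: lerD (ltW aN).
by rewrite rnormB; apply: le_trans (dist _ _ (leq_maxl _ _)) (uK _ _).
Qed.

End complex_series.

(** * Symmetric multilinear forms *)

Section power_series_uniqueness.
Variable R : realType.
Local Notation C := (cplx R).

Lemma series_cvg0_bounded (a : nat -> C) : series a @ \oo --> (0 : C) ->
  exists2 M : R, 0 <= M & forall k, rnorm (a k) <= M.
Proof.
move=> /rcvgP/(_ 1 ltr01)[N _ aN].
have H n : (N <= n)%N -> rnorm (a n) <= 2.
  move=> Nn; have -> : a n = (0 - series a n) - (0 - series a n.+1).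
    by rewrite !sub0r opprK addrC /series/= big_nat_recr//= addrAC subrr add0r.
  apply: (le_trans (ler_rnormD _ _)); rewrite rnormN.
  by apply: ltW; rewrite -[2]/(1 + 1) ltrD// aN//= leqW.
exists (2 + \sum_(k < N) rnorm (a k)) => [|k].
  by rewrite addr_ge0// sumr_ge0// => i _; exact: rnorm_ge0.
have [kN|Nk] := ltnP k N; last first.
  by rewrite -[leLHS]addr0 lerD ?H// sumr_ge0// => i _; exact: rnorm_ge0.
rewrite -[leLHS]add0r lerD//.
by apply: (term_le_sum (u := fun k => rnorm (a k))) => // i; exact: rnorm_ge0.
Qed.

(** Zeros accumulating at the centre from one side suffice. This one-sided form
    is what an argument by connectedness along a segment provides. *)
Lemma power_series_eq0 (a : nat -> C) (d : R) : 0 < d ->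
  (forall t : R, 0 < t < d -> series (fun k => ofR t ^+ k * a k) @ \oo --> (0 : C)) ->
  forall k, a k = 0.
Proof.
(* If the coefficients before the m-th vanish, the value 0 at a small t shows that
   t^m (a m) is of the order of t^(m+1). *)
move=> d0 az; elim/ltn_ind => m IH.
have h0 : 0 < d / 2 < d by rewrite divr_gt0//= ltr_pdivrMr// ltr_pMr// ltr1n.
move: (d / 2) h0 => r h0; have [r0 rd] := andP h0.
have [M M0 aM] := series_cvg0_bounded (az _ h0).
have aM' k : rnorm (a k) <= M / r ^+ k.
  rewrite ler_pdivlMr ?exprn_gt0// mulrC.
  by have := aM k; rewrite rnormM rnormX rnorm_ofR ger0_norm// ltW.
apply/rnorm_eq0/le_anti; rewrite rnorm_ge0 andbT.
suff H t : 0 < t <= r / 2 -> rnorm (a m) <= t * (2 * M / r ^+ m.+1).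
  apply/ler_addgt0Pr => e e0; rewrite add0r.
  set c := 2 * M / r ^+ m.+1 in H.
  have c0 : 0 <= c by rewrite /c divr_ge0 ?mulr_ge0 ?exprn_ge0 ?(ltW r0).
  have c1 : 0 < c + 1 by rewrite ltr_wpDl.
  pose t := Num.min (r / 2) (e / (c + 1)).
  have t0 : 0 < t <= r / 2 by rewrite /t lt_min !divr_gt0//= ge_min lexx.
  apply: (le_trans (H t t0)).
  have te : t <= e / (c + 1) by rewrite /t ge_min lexx orbT.
  apply: (le_trans (ler_wpM2r c0 te)).
  by rewrite mulrAC ler_pdivrMr// ler_wpM2l ?(ltW e0)// lerDl.
move=> /andP[t0 tr]; rewrite -(ler_pM2l (exprn_gt0 m t0)).
have tpos k : 0 <= t ^+ k by rewrite exprn_ge0// ltW.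
apply/ler_addgt0Pr => e e0.
have td : 0 < t < d.
  by rewrite t0/= (le_lt_trans tr)//; lra.
have /rcvgP/(_ e e0)[N _ /(_ (maxn N m.+1) (leq_maxl _ _))/=] := az t td.
have := leq_maxr N m.+1; move: (maxn _ _) => n mn.
rewrite sub0r rnormN /series/= big_mkord.
rewrite (sum_ord_split (fun k => ofR t ^+ k * a k) mn) big_ord_recr/=.
rewrite big1 => [|k _]; last by rewrite IH// mulr0.
rewrite add0r => /ltW se.
have -> : t ^+ m * rnorm (a m) = rnorm (ofR t ^+ m * a m).
  by rewrite rnormM rnormX rnorm_ofR ger0_norm// ltW.
rewrite -(addrK (\sum_(m.+1 <= k < n) ofR t ^+ k * a k) (ofR t ^+ m * a m)) addrC.
apply: (le_trans (ler_rnormD _ _)); rewrite rnormN addrC.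
rewrite [leRHS]addrC lerD//.
apply: (le_trans (ler_rnorm_sum _ _ _)).
pose c := M / r ^+ m.+1 * t ^+ m.+1.
apply: (@le_trans _ _ (\sum_(m.+1 <= k < n) c * 2^-1 ^+ (k - m.+1))).
  rewrite big_nat_cond [leRHS]big_nat_cond; apply: ler_sum => k /andP[/andP[mk kn] _].
  rewrite rnormM rnormX rnorm_ofR (ger0_norm (ltW t0)).
  apply: (le_trans (ler_wpM2l (tpos k) (aM' k))).
  move: (k - m.+1)%N (subnKC mk) => p kE; rewrite -{}kE in mk kn *.
  have rn0 q : r ^+ q != 0 by rewrite expf_neq0// lt0r_neq0.
  have -> : t ^+ (m.+1 + p) * (M / r ^+ (m.+1 + p)) =
            M / r ^+ m.+1 * t ^+ m.+1 * (t / r) ^+ p.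
    by rewrite !exprD expr_div_n; field; rewrite !rn0.
  rewrite ler_wpM2l ?mulr_ge0 ?invr_ge0 ?exprn_ge0 ?(ltW r0) ?(ltW t0)//.
  rewrite lerXn2r ?nnegrE ?divr_ge0 ?invr_ge0 ?(ltW r0) ?(ltW t0)//.
  by rewrite ler_pdivrMr// mulrC.
rewrite -mulr_sumr.
have -> : t ^+ m * (t * (2 * M / r ^+ m.+1)) =
  M / r ^+ m.+1 * t ^+ m.+1 * 2 by rewrite [t ^+ m.+1]exprS; ring.
rewrite ler_wpM2l ?mulr_ge0 ?invr_ge0 ?exprn_ge0 ?(ltW r0) ?(ltW t0)//.
rewrite -{1}(add0n m.+1) big_addn.
under eq_bigr do rewrite addnK.
by rewrite big_mkord geom_sum_le2// ltW// half_gt0.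
Qed.

End power_series_uniqueness.

(** Forms in k + 1 variables are studied by freezing the first one. *)
Section multilinear_forms.
Variables (R : realType) (E : normedModType (cplx R)).
Local Notation C := (cplx R).

Definition fcons k (a : E) (x : 'I_k -> E) : 'I_k.+1 -> E :=
  fun i => oapp x a (unlift ord0 i).

Lemma fcons0 k a (x : 'I_k -> E) : fcons a x ord0 = a.
Proof. by rewrite /fcons unlift_none. Qed.

Lemma fconsS k a (x : 'I_k -> E) i : fcons a x (lift ord0 i) = x i.
Proof. by rewrite /fcons liftK. Qed.

Lemma fconsP k (x y : 'I_k.+1 -> E) : x ord0 = y ord0 ->
  (forall i, x (lift ord0 i) = y (lift ord0 i)) -> x = y.
Proof.
by move=> xy0 xyS; apply/funext => i; case: (unliftP ord0 i) => [j|] ->.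
Qed.

Lemma fcons_eta k (x : 'I_k.+1 -> E) : fcons (x ord0) (x \o lift ord0) = x.
Proof. by apply: fconsP => [|i]; rewrite ?fcons0 ?fconsS. Qed.

Lemma upd_fcons0 k (a y : E) (x : 'I_k -> E) : upd (fcons a x) ord0 y = fcons y x.
Proof. by apply: fconsP => [|i]; rewrite /upd/= ?fcons0 ?fconsS. Qed.

Lemma upd_fconsS k (a y : E) (x : 'I_k -> E) i :
  upd (fcons a x) (lift ord0 i) y = fcons a (upd x i y).
Proof. by apply: fconsP => [|j]; rewrite /upd/= ?fcons0 ?fconsS. Qed.

Lemma fcons_const k (x : E) : fcons x (fun=> x : E) = (fun=> x) :> ('I_k.+1 -> E).
Proof. by apply: fconsP => [|i]; rewrite ?fcons0 ?fconsS. Qed.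

Lemma ord0_fun_eq (x y : 'I_0 -> E) : x = y.
Proof. by apply/funext => -[]. Qed.

Lemma multilinear_fcons k (A : ('I_k.+1 -> E) -> C) a : multilinear A ->
  multilinear (fun x => A (fcons a x)).
Proof.
by move=> Am x i c y z; rewrite -!upd_fconsS; exact: Am.
Qed.

Lemma multilinear_head k (A : ('I_k.+1 -> E) -> C) (c : C) a b x : multilinear A ->
  A (fcons (c *: a + b) x) = c * A (fcons a x) + A (fcons b x).
Proof.
by move=> Am; have := Am (fcons 0 x) ord0 c a b; rewrite !upd_fcons0.
Qed.

Lemma symmetric_fcons k (A : ('I_k.+1 -> E) -> C) a : symmetric_form A ->
  symmetric_form (fun x => A (fcons a x)).
Proof.
move=> As s x; rewrite -(As (lift_perm ord0 ord0 s) (fcons a x)); congr (A _).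
apply: fconsP => [|i]; first by rewrite /comp lift_perm_id !fcons0.
by rewrite /comp lift_perm_lift !fconsS.
Qed.

(** The arguments of the mixed terms of the binomial formula; the forms of interest
    being symmetric, the copies of a are placed first. *)
Definition mix k j (a x : E) : 'I_k -> E := fun i => if (i < j)%N then a else x.

Lemma mix0 k a x : @mix k 0 a x = fun=> x.
Proof. by []. Qed.

Lemma mix_all k a x : @mix k k a x = fun=> a.
Proof. by apply/funext => i; rewrite /mix ltn_ord. Qed.

Lemma fcons_mix k j a x : fcons a (@mix k j a x) = mix j.+1 a x.
Proof. by apply: fconsP => [|i]; rewrite ?fcons0 ?fconsS /mix/=. Qed.

Lemma symmetric_mix_tail k (A : ('I_k.+1 -> E) -> C) j a x : symmetric_form A ->
  (j <= k)%N -> A (fcons x (mix j a x)) = A (mix j a x).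
Proof.
case: j => [|j] As jk; first by rewrite !mix0 fcons_const.
rewrite -(As (tperm ord0 (lift ord0 (Ordinal jk)))).
congr (A _); apply: fconsP => [|i].
  by rewrite /comp tpermL fconsS /mix/= ltnSn.
rewrite /comp; case: tpermP => [/(congr1 val)//|ij|_ /eqP ij].
  by rewrite fcons0 /mix ij/= /bump/= add1n ltnn.
rewrite fconsS /mix/= /bump/= add1n !ltnS ltn_neqAle.
suff -> : (i : nat) != j by [].
by apply: contra ij => /eqP ij; apply/eqP; congr lift; exact: val_inj.
Qed.

(** Splitting the first variable turns the statement into Pascal's rule. *)
Lemma multilinear_binomial k (A : ('I_k -> E) -> C) (x y : E) :
  multilinear A -> symmetric_form A ->
  A (fun=> x + y) = \sum_(j < k.+1) 'C(k, j)%:R * A (mix j x y).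
Proof.
elim: k A => [|k IH] A Am As.
  rewrite big_ord_recl big_ord0 addr0 bin0 mul1r; congr A; exact: ord0_fun_eq.
rewrite -fcons_const -{1}[x]scale1r multilinear_head// mul1r.
rewrite (IH (fun z => A (fcons x z))); [|exact: multilinear_fcons|exact: symmetric_fcons].
rewrite (IH (fun z => A (fcons y z))); [|exact: multilinear_fcons|exact: symmetric_fcons].
rewrite [RHS]big_ord_recl/= bin0 mul1r.
under [in RHS]eq_bigr => j _ do rewrite /bump/= add1n binS natrD mulrDl.
rewrite big_split/= addrA [RHS]addrC; congr (_ + _).
  by apply: eq_bigr => j _; rewrite fcons_mix.
rewrite big_ord_recl/= bin0 mul1r symmetric_mix_tail//; congr (_ + _).
rewrite [RHS]big_ord_recr/= bin_small// mul0r addr0.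
by apply: eq_bigr => j _; rewrite /bump/= add1n symmetric_mix_tail.
Qed.

Lemma multilinear_mixZ k (A : ('I_k -> E) -> C) j (c : C) a x : multilinear A ->
  (j <= k)%N -> A (mix j (c *: a) x) = c ^+ j * A (mix j a x).
Proof.
elim: k A j => [|k IH] A [|j] Am// jk; rewrite ?mix0 ?expr0 ?mul1r//.
rewrite -!fcons_mix -[c *: a]addr0 multilinear_head//.
have A0 z : A (fcons 0 z) = 0.
  have := multilinear_head 1 0 0 z Am.
  by rewrite scaler0 addr0 mul1r => /eqP; rewrite addrC -subr_eq subrr => /eqP.
rewrite A0 addr0 (IH (fun z => A (fcons a z)))//; last exact: multilinear_fcons.
by rewrite addr0 exprS mulrA.
Qed.

(** A symmetric multilinear form is determined by its diagonal: along a line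
    x + t y the diagonal is a polynomial in t, whose linear coefficient gives
    the form with one variable freed. *)
Lemma multilinear_diag0 k (A : ('I_k -> E) -> C) : multilinear A -> symmetric_form A ->
  (forall x, A (fun=> x) = 0) -> forall x, A x = 0.
Proof.
elim: k A => [|k IH] A Am As A0 x.
  by rewrite -(A0 0); congr A; exact: ord0_fun_eq.
rewrite -(fcons_eta x); apply: (IH (fun z => A (fcons (x ord0) z))).
- exact: multilinear_fcons.
- exact: symmetric_fcons.
(* p lists the coefficients in t of the value of A on the diagonal at t a + y. *)
move=> y; set a := x ord0.
pose p j := if (j < k.+2)%N then 'C(k.+1, j)%:R * A (mix j a y) else 0.
have : p 1%N = 0.
  apply: (@power_series_eq0 _ p 1 ltr01) => t t01; apply: csum_cvg.
  rewrite -[X in csum _ X](A0 (ofR t *: a + y)) (multilinear_binomial _ _ Am As).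
  rewrite [X in csum _ X](_ : _ = \sum_(j < k.+2) ofR t ^+ j * p j).
    by apply: csum_finite => j kj; rewrite /p ltnNge kj mulr0.
  apply: eq_bigr => j _; rewrite /p ltn_ord multilinear_mixZ// 1?mulrCA//.
  by rewrite -ltnS.
rewrite /p bin1 -fcons_mix mix0 => /eqP; rewrite mulf_eq0 pnatr_eq0/=.
by move/eqP.
Qed.

Lemma multilinear_lin k (A B : ('I_k -> E) -> C) (c : C) : multilinear A ->
  multilinear B -> multilinear (fun x => c * A x + B x).
Proof.
move=> Am Bm x i d y z /=; rewrite Am Bm !mulrDr scalerDr addrACA; congr (_ + _ + _).
by rewrite /= [LHS]mulrCA.
Qed.

Lemma symmetric_lin k (A B : ('I_k -> E) -> C) (c : C) : symmetric_form A ->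
  symmetric_form B -> symmetric_form (fun x => c * A x + B x).
Proof. by move=> As Bs s x; rewrite As Bs. Qed.

Lemma is_polar_unique k (P : E -> C) (A B : ('I_k -> E) -> C) :
  is_polar P A -> is_polar P B -> A = B.
Proof.
move=> [Am As AP] [Bm Bs BP]; apply/funext => x.
have := @multilinear_diag0 k (fun x => -1 * B x + A x)
  (multilinear_lin _ Bm Am) (symmetric_lin _ Bs As).
move=> /(_ _ x) H; apply/eqP; rewrite -subr_eq0 addrC -mulN1r H// => y.
by rewrite AP BP mulN1r addNr.
Qed.

Lemma polarE k (P : E -> C) (A : ('I_k -> E) -> C) : is_polar P A -> polar P = A.
Proof.
move=> PA; apply: (is_polar_unique _ PA).
exact: (@xgetPex _ (fun=> 0) [set B | is_polar P B] (ex_intro _ A PA)).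
Qed.

Lemma hpoly_polar k (P : E -> C) : hpoly k P -> is_polar P (polar P : ('I_k -> E) -> C).
Proof. by move=> [_ [A PA]]; rewrite (polarE PA). Qed.

Lemma is_polar_fcons k (P : E -> C) (A : ('I_k.+1 -> E) -> C) a : is_polar P A ->
  is_polar (partial_poly k.+1 1 P a) (fun x => A (fcons a x)).
Proof.
move=> PA; have [Am As _] := PA; split.
- exact: multilinear_fcons.
- exact: symmetric_fcons.
- by move=> x; rewrite /partial_poly (polarE PA) -/(mix 1 a x) -fcons_mix.
Qed.

(** Freezing j + 1 variables one at a time: this is how coherence, which concerns
    a single variable, is iterated. *)
Lemma partial_polyS k j (P : E -> C) a : hpoly k.+1 P ->
  partial_poly k.+1 j.+1 P a = partial_poly k j (partial_poly k.+1 1 P a) a.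
Proof.
move=> /hpoly_polar/is_polar_fcons-/(_ a)/polarE PE; apply/funext => x.
by rewrite {2}/partial_poly PE /partial_poly -!/(mix _ _ _) fcons_mix.
Qed.

Lemma partial_poly0 k (P : E -> C) a : hpoly k P -> partial_poly k 0 P a = P.
Proof.
by move=> /hpoly_polar[_ _ PE]; apply/funext => x; rewrite -PE.
Qed.

Lemma partial_poly_all k (P : E -> C) a x : hpoly k P -> partial_poly k k P a x = P a.
Proof.
by move=> /hpoly_polar[_ _ PE]; rewrite /partial_poly -/(mix k a x) mix_all.
Qed.

Lemma hpoly_binomial k (P : E -> C) a x : hpoly k P ->
  P (a + x) = \sum_(j < k.+1) 'C(k, j)%:R * partial_poly k j P a x.
Proof.
by move=> /hpoly_polar[Pm Ps PE]; rewrite -PE multilinear_binomial.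
Qed.

Lemma hpolyZ k (P : E -> C) (c : C) x : hpoly k P -> P (c *: x) = c ^+ k * P x.
Proof.
move=> /hpoly_polar[Pm Ps PE].
by rewrite -!PE -(mix_all k _ 0) multilinear_mixZ// mix_all.
Qed.

End multilinear_forms.

(** * Weak-star continuity *)

Section weak_star.
Variables (R : realType) (E : normedModType (cplx R)).
Local Notation C := (cplx R).
Local Notation J := (@bidual_embed R E).
Local Notation wstar :=
  (initial_topology (fun z : bidual E => (z : {ptws dual E -> C}))).

Lemma bidual_embed_linear : linear J.
Proof.
by move=> a x y; apply/val_inj/funext => g /=; rewrite (dual_linear g).
Qed.

Lemma rnorm_bidual_embed (x : E) : rnorm (J x) <= rnorm x.
Proof.
rewrite dual_rnormE; apply: opnorm_le => [|g]; first exact: rnorm_ge0.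
by rewrite mulrC; exact: (rnorm_dual g x).
Qed.

Lemma weak_star_cst (c : C) : @weak_star_continuous _ E (fun=> c).
Proof. exact: cst_continuous. Qed.

Lemma weak_star_lin (c : C) (g h : bidual E -> C) : weak_star_continuous g ->
  weak_star_continuous h -> weak_star_continuous (fun z => c * g z + h z).
Proof.
move=> gc hc z.
apply: (@cvgD _ _ wstar (nbhs (z : wstar)) _ (fun w => c *: g w) h); last exact: hc.
apply: (@cvgZ _ _ wstar (nbhs (z : wstar)) _ (fun=> c) g); last exact: gc.
exact: cvg_cst.
Qed.

Lemma weak_star_eval (g : dual E) : weak_star_continuous (fun z : bidual E => z g).
Proof.
pose i := fun z : bidual E => (z : {ptws dual E -> C}).
move=> z; have zc : i @ (z : wstar) --> i z by exact: initial_continuous.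
have iF : Filter (i @ (z : wstar)) by apply: fmap_filter; exact: (nbhs_filter (z : wstar)).
have H := (@pointwise_cvgP _ _ (i @ (z : wstar)) (i z) iF).1 zc g.
exact: H.
Qed.

Lemma dual_lin_eval (F : normedModType C) (z : dual F) (c : C) (x y : F) :
  z (c *: x + y) = c * z x + z y.
Proof. exact: dual_linear. Qed.

Lemma dual0 (F : normedModType C) (z : dual F) : z 0 = 0.
Proof.
have := dual_lin_eval z (-1) 0 0.
by rewrite scaler0 addr0 mulN1r addNr.
Qed.

(** The conclusion says that g is in the span of s, without naming coefficients. *)
Lemma kernel_inclusion (s : seq (dual E)) (g : dual E) :
  (forall y, (forall d, d \in s -> d y = 0) -> g y = 0) ->
  forall (z : bidual E) x, (forall d, d \in s -> z d = d x) -> z g = g x.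
Proof.
elim: s g => [|d s IH] g gs z x zx.
  have -> : g = 0 by apply/val_inj/funext => y; exact: gs.
  by rewrite dual0.
have zs e : e \in s -> z e = e x by move=> es; rewrite zx// inE es orbT.
(* Either d is independent of s, and a multiple of it is subtracted from g so that the
   difference vanishes on the common kernel of s, or d can be dropped. *)
have [[y ys dy]|noy] :=
    pselect (exists2 y, (forall e, e \in s -> e y = 0) & d y != 0).
  pose c := - (g y / d y); have := IH (c *: d + g) _ z x zs.
  rewrite dual_lin_eval zx ?mem_head// => H.
  have {}H : c * d x + z g = c * d x + g x.
    apply: H => w ws; have := gs (- (d w / d y) *: y + w).
    rewrite !dual_lin_eval => H.
    have -> : (c *: d + g) w = - (d w / d y) * g y + g w.
      by rewrite /= -[LHS]/(c * d w + g w) /c !mulNr mulrAC [d w / _ * _]mulrAC [g y * _]mulrC.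
    apply: H => e; rewrite inE => /orP[/eqP->|es].
      by rewrite dual_lin_eval mulNr divfK// addNr.
    by rewrite dual_lin_eval (ys e es) (ws e es) mulr0 addr0.
  exact: addrI H.
apply: IH zs => y ys; apply: gs => e; rewrite inE => /orP[/eqP->|/ys//].
by apply/eqP/negPn/negP => dy; apply: noy; exists y.
Qed.

(** The algebraic half of Helly's theorem: without a bound on the norm of the
    solution, consistency of the equations is enough. *)
Lemma finite_interpolation (s : seq (dual E)) (z : bidual E) :
  exists x, forall g, g \in s -> g x = z g.
Proof.
elim: s => [|g s [x xs]]; first by exists 0.
have [[y ys gy]|noy] :=
    pselect (exists2 y, (forall e, e \in s -> e y = 0) & g y != 0).
  exists (((z g - g x) / g y) *: y + x) => e; rewrite inE => /orP[/eqP->|es].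
    by rewrite dual_lin_eval divfK// subrK.
  by rewrite dual_lin_eval (ys e es) mulr0 add0r xs.
exists x => e; rewrite inE => /orP[/eqP->|/xs//].
apply/esym/(@kernel_inclusion s) => [y ys|d /xs//].
by apply/eqP/negPn/negP => gy; apply: noy; exists y.
Qed.

(** Weak-star density of E in its bidual. The approximating filter consists of
    the sets of exact solutions of finitely many equations g x = z g. *)
Lemma weak_star_ext (g h : bidual E -> C) : weak_star_continuous g ->
  weak_star_continuous h -> (forall x, g (J x) = h (J x)) -> forall z, g z = h z.
Proof.
move=> gc hc gh z.
pose S (s : seq (dual E)) := [set x : E | forall d, d \in s -> d x = z d].
pose F := filter_from setT S.
have FF : ProperFilter F.
  apply: filter_from_proper => [|s _]; last exact: finite_interpolation.
  apply: filter_from_filter; first by exists [::].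
  move=> s t _ _; exists (s ++ t) => // x Sx; split=> d ds; apply: Sx;
    by rewrite mem_cat ds// orbT.
have Jz : J @ F --> (z : wstar).
  move=> A; rewrite nbhsE => -[B [[D Dop DB] Bz] BA].
  have DF : {ptws, (fun x => (J x : dual E -> C)) @ F --> (z : dual E -> C)}.
    apply/pointwise_cvgP => d; apply/rcvgP => e e0.
    exists [:: d] => // x /= /(_ d (mem_head _ _)) dx.
    by rewrite dx subrr rnorm0.
  have : F [set x | D (J x : dual E -> C)].
    apply: DF; rewrite nbhsE; exists D; last exact: subset_refl.
    by split=> //; move: Bz; rewrite -DB.
  by apply: filterS => x Dx; apply: BA; rewrite -DB.
have Cg : (g \o J) @ F --> g z by apply: (@cvg_comp _ _ _ J g _ _ _ Jz); exact: gc.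
have Ch : (h \o J) @ F --> h z by apply: (@cvg_comp _ _ _ J h _ _ _ Jz); exact: hc.
apply: (cvg_unique _ Cg); first exact: norm_hausdorff.
by rewrite (_ : g \o J = h \o J)//; apply/funext => x; exact: gh.
Qed.

End weak_star.

(** * Arens extensions of multilinear forms *)

Section arens.
Variables (R : realType) (E : normedModType (cplx R)).
Local Notation C := (cplx R).
Local Notation J := (@bidual_embed R E).

Definition separately_weak_star k (B : ('I_k -> bidual E) -> C) : Prop :=
  forall i z, weak_star_continuous (fun w => B (upd z i w)).

Lemma upd_id k (F : normedModType C) (z : 'I_k -> F) i : upd z i (z i) = z.
Proof. by apply/funext => j; rewrite /upd; case: eqP => // ->. Qed.

(** Weak-star density, used in one variable after the other; m counts the variables
    that already range over the bidual. *)
Lemma separately_weak_star_ext k (B D : ('I_k -> bidual E) -> C) :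
  separately_weak_star B -> separately_weak_star D ->
  (forall x : 'I_k -> E, B (J \o x) = D (J \o x)) -> B = D.
Proof.
move=> Bw Dw BD; apply/funext => z.
suff H m : (m <= k)%N -> forall z : 'I_k -> bidual E,
    (forall i : 'I_k, (m <= i)%N -> range J (z i)) -> B z = D z.
  by apply: (H k) => // i; rewrite leqNgt ltn_ord.
elim: m => [|m IH] mk {}z zJ.
  have /choice[x xz] : forall i, exists x, J x = z i.
    by move=> i; have [x _ <-] := zJ i isT; exists x.
  have -> : z = J \o x by apply/funext => i /=; rewrite xz.
  exact: BD.
rewrite -(upd_id z (Ordinal mk)).
apply: (weak_star_ext (Bw _ _) (Dw _ _)) => x; apply: IH; first exact: ltnW.
move=> i; rewrite leq_eqVlt => /orP[/eqP mi|mi]; last first.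
  by rewrite /upd; case: eqP => _; [exists x|exact: zJ].
have -> : i = Ordinal mk by apply: val_inj; rewrite /= mi.
by rewrite /upd eqxx; exists x.
Qed.

Definition bounded_form k (A : ('I_k -> E) -> C) (M : R) : Prop :=
  forall x, rnorm (A x) <= M * \prod_i rnorm (x i).

Lemma bounded_form_fcons k (A : ('I_k.+1 -> E) -> C) M a :
  bounded_form A M -> bounded_form (fun x => A (fcons a x)) (M * rnorm a).
Proof.
move=> AM x; apply: (le_trans (AM _)); rewrite big_ord_recl fcons0 mulrA.
by rewrite (eq_bigr (fun i => rnorm (x i)))// => i _; rewrite fconsS.
Qed.

Lemma bounded_form_lin k (A B : ('I_k -> E) -> C) M N c :
  bounded_form A M -> bounded_form B N ->
  bounded_form (fun x => c * A x + B x) (rnorm c * M + N).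
Proof.
move=> AM BN x; apply: (le_trans (ler_rnormD _ _)).
by rewrite rnormM mulrDl -mulrA lerD// ler_wpM2l ?rnorm_ge0.
Qed.

(** The iterated limit with the last variable extended first: an element of the
    bidual is applied to the functional obtained by extending the others. *)
Fixpoint arens k : (('I_k -> E) -> C) -> ('I_k -> bidual E) -> C :=
  if k is k'.+1 return (('I_k -> E) -> C) -> ('I_k -> bidual E) -> C then
    fun A z => z ord0
      (insubd (0 : dual E) (fun x => arens (fun y => A (fcons x y)) (z \o lift ord0)))
  else fun A _ => A (fun=> 0).

Definition arens_slice k (A : ('I_k.+1 -> E) -> C) (z : 'I_k -> bidual E) : dual E :=
  insubd 0 (fun x => arens (fun y => A (fcons x y)) z).

Lemma arensS k (A : ('I_k.+1 -> E) -> C) z :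
  arens A z = z ord0 (arens_slice A (z \o lift ord0)).
Proof. by []. Qed.

(** Linearity in the form and the norm bound are proved together by induction: they
    are what makes the slices of the next degree continuous linear functionals. *)
Definition arens_controlled k : Prop :=
  (forall (A B : ('I_k -> E) -> C) M N c z, multilinear A -> multilinear B ->
     0 <= M -> 0 <= N -> bounded_form A M -> bounded_form B N ->
     arens (fun x => c * A x + B x) z = c * arens A z + arens B z) /\
  (forall (A : ('I_k -> E) -> C) M z, multilinear A -> 0 <= M -> bounded_form A M ->
     rnorm (arens A z) <= M * \prod_i rnorm (z i)).

Lemma arens_controlled_slice k (A : ('I_k.+1 -> E) -> C) M z x : arens_controlled k ->
  multilinear A -> 0 <= M -> bounded_form A M ->
  arens_slice A z x = arens (fun y => A (fcons x y)) z.
Proof.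
move=> [al ab] Am M0 AM; rewrite /arens_slice insubdK//; apply/asboolP.
have sL : linear (fun x => arens (fun y => A (fcons x y)) z).
  move=> a u v; rewrite -(al _ _ (M * rnorm u) (M * rnorm v)) ?mulr_ge0 ?rnorm_ge0//.
  - by congr arens; apply/funext => w; rewrite multilinear_head.
  - exact: multilinear_fcons.
  - exact: multilinear_fcons.
  - exact: bounded_form_fcons.
  - exact: bounded_form_fcons.
split=> //; apply: (lin_bounded_continuous sL (M := M * \prod_i rnorm (z i))) => u.
rewrite mulrAC; apply: ab; rewrite ?mulr_ge0 ?rnorm_ge0//.
- exact: multilinear_fcons.
- exact: bounded_form_fcons.
Qed.

Lemma arens_control k : arens_controlled k.
Proof.
elim: k => [|k IH].
  split=> [//|A M z Am M0 AM]; apply: (le_trans (AM _)).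
  by rewrite !big_ord0.
have [IHl IHb] := IH.
split=> [A B M N c z Am Bm M0 N0 AM BN|A M z Am M0 AM].
  rewrite !arensS -dual_lin_eval; congr (z ord0 _); apply/val_inj/funext => x.
  have cN : 0 <= rnorm c * M + N by rewrite addr_ge0 ?mulr_ge0 ?rnorm_ge0.
  apply: (etrans (arens_controlled_slice _ x IH (multilinear_lin c Am Bm) cN
    (bounded_form_lin c AM BN))).
  have -> := IHl _ _ (M * rnorm x) (N * rnorm x) c (z \o lift ord0)
    (multilinear_fcons x Am) (multilinear_fcons x Bm)
    (mulr_ge0 M0 (rnorm_ge0 x)) (mulr_ge0 N0 (rnorm_ge0 x))
    (bounded_form_fcons x AM) (bounded_form_fcons x BN).
  congr (c * _ + _); apply: esym; first exact: (arens_controlled_slice _ x IH Am M0 AM).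
  exact: (arens_controlled_slice _ x IH Bm N0 BN).
rewrite arensS big_ord_recl; apply: (le_trans (rnorm_dual _ _)).
rewrite mulrCA ler_wpM2l ?rnorm_ge0// dual_rnormE.
apply: opnorm_le => [|x].
  by rewrite mulr_ge0// prodr_ge0// => i _; exact: rnorm_ge0.
rewrite mulrAC.
have -> := congr1 (@rnorm R C) (arens_controlled_slice (z \o lift ord0) x IH Am M0 AM).
apply: IHb; rewrite ?mulr_ge0 ?rnorm_ge0//.
- exact: multilinear_fcons.
- exact: bounded_form_fcons.
Qed.

Lemma arens_sliceE k (A : ('I_k.+1 -> E) -> C) M z x : multilinear A -> 0 <= M ->
  bounded_form A M -> arens_slice A z x = arens (fun y => A (fcons x y)) z.
Proof. exact: arens_controlled_slice (arens_control k). Qed.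

Lemma arens_embed k (A : ('I_k -> E) -> C) M x : multilinear A -> 0 <= M ->
  bounded_form A M -> arens A (J \o x) = A x.
Proof.
elim: k A M x => [|k IH] A M x Am M0 AM; first by congr A; exact: ord0_fun_eq.
rewrite arensS; apply: (etrans (arens_sliceE _ (x ord0) Am M0 AM)).
rewrite -[X in arens _ X]/(J \o (x \o lift ord0)).
rewrite (IH _ (M * rnorm (x ord0))) ?fcons_eta ?mulr_ge0 ?rnorm_ge0//.
- exact: multilinear_fcons.
- exact: bounded_form_fcons.
Qed.

Lemma upd0_lift k (z : 'I_k.+1 -> bidual E) w : upd z ord0 w \o lift ord0 = z \o lift ord0.
Proof. by apply/funext => i. Qed.

Lemma updS_lift k (z : 'I_k.+1 -> bidual E) i w :
  upd z (lift ord0 i) w \o lift ord0 = upd (z \o lift ord0) i w.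
Proof. by apply/funext => j; rewrite /upd/= (inj_eq lift_inj). Qed.

Lemma arens_multilinear k (A : ('I_k -> E) -> C) M : multilinear A -> 0 <= M ->
  bounded_form A M -> multilinear (arens A).
Proof.
elim: k A M => [|k IH] A M Am M0 AM z i a u v; first by case: i.
rewrite !arensS; case: (unliftP ord0 i) => [j|] ->; last first.
  by rewrite !upd0_lift /upd eqxx.
rewrite !updS_lift -dual_lin_eval; congr (z ord0 _); apply/val_inj/funext => x.
pose SE v := arens_sliceE v x Am M0 AM.
apply: (etrans (SE _)); apply: esym.
apply: (etrans (congr2 (fun p q : C => a * p + q) (SE _) (SE _))); apply: esym.
apply: (IH _ (M * rnorm x)); rewrite ?mulr_ge0 ?rnorm_ge0//.
- exact: multilinear_fcons.
- exact: bounded_form_fcons.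
Qed.

Lemma arens_weak_star k (A : ('I_k -> E) -> C) M (i : 'I_k) z : multilinear A -> 0 <= M ->
  bounded_form A M -> (forall j : 'I_k, (j < i)%N -> range J (z j)) ->
  weak_star_continuous (fun w => arens A (upd z i w)).
Proof.
elim: k A M i z => [|k IH] A M i z Am M0 AM; first by case: i.
case: (unliftP ord0 i) => [j|] -> zJ; last first.
  rewrite (_ : (fun w => _) = fun w : bidual E => w (arens_slice A (z \o lift ord0))).
    exact: weak_star_eval.
  by apply/funext => w; rewrite arensS upd0_lift /upd eqxx.
have [x _ xz] := zJ ord0 isT.
rewrite (_ : (fun w => _) =
    fun w => arens (fun y => A (fcons x y)) (upd (z \o lift ord0) j w)).
  apply: (IH _ (M * rnorm x)); rewrite ?mulr_ge0 ?rnorm_ge0//.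
  - exact: multilinear_fcons.
  - exact: bounded_form_fcons.
  - by move=> m mj; apply: zJ; rewrite /= /bump/= !add1n.
apply/funext => w; rewrite arensS updS_lift {1}/upd/= -xz.
exact: (arens_sliceE _ _ Am M0 AM).
Qed.

(** The order of extension is the reversal, the recursion reaching the innermost
    variable first. *)
Lemma arens_extension_ex k (A : ('I_k -> E) -> C) M : multilinear A -> 0 <= M ->
  bounded_form A M -> exists s, arens_extension s A (arens A).
Proof.
move=> Am M0 AM; exists (perm (@rev_ord_inj k)); split=> [x|j z zJ].
  exact: (arens_embed _ Am M0 AM).
apply: (arens_weak_star Am M0 AM) => i; rewrite permE /= => ij.
have -> : i = perm (@rev_ord_inj k) (rev_ord i) by rewrite permE rev_ordK.
apply: zJ => /=; have := ltn_ord i; have := ltn_ord j; lia.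
Qed.

(** In a symmetric extension every variable can play the part of the one that was
    extended last, the only one for which continuity is unconditional. *)
Lemma symmetric_arens_extension k (s : 'S_k) (A : ('I_k -> E) -> C) B :
  arens_extension s A B -> symmetric_form B -> separately_weak_star B.
Proof.
case: k s A B => [|k] s A B [_ Bw] Bs i z; first by case: i.
set l := s ord_max.
rewrite (_ : (fun w => _) = fun w => B (upd (z \o tperm i l) l w)).
  by apply: Bw => j; rewrite ltnNge -ltnS ltn_ord.
apply/funext => w; rewrite -(Bs (tperm i l)); congr B; apply/funext => j.
rewrite /upd/=; case: (tpermP i l j) => [->|->|/eqP ji /eqP jl].
- by rewrite eq_sym; case: eqVneq => // ->; rewrite eqxx.
- by rewrite !eqxx.
- by rewrite (negbTE ji) (negbTE jl).
Qed.

(** Forms with a prescribed diagonal, such as tensor products, come without symmetry;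
    symmetrization restores it and keeps the diagonal. *)
Definition symmetrize k (B : ('I_k -> bidual E) -> C) : ('I_k -> bidual E) -> C :=
  fun z => k`!%:R^-1 * \sum_(s : 'S_k) B (z \o s).

Lemma upd_perm k (z : 'I_k -> bidual E) (s : 'S_k) i w :
  upd z i w \o s = upd (z \o s) ((s^-1)%g i) w.
Proof.
apply/funext => j; rewrite /upd/=.
by rewrite -[in RHS](inj_eq (@perm_inj _ s)) permKV.
Qed.

Lemma symmetrize_multilinear k (B : ('I_k -> bidual E) -> C) :
  multilinear B -> multilinear (symmetrize B).
Proof.
move=> Bm z i a u v; rewrite /symmetrize.
rewrite -[X in _ = X + _]/(a * _) mulrCA -mulrDr; congr (_ * _).
rewrite mulr_sumr -big_split/=; apply: eq_bigr => s _.
by rewrite !upd_perm Bm.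
Qed.

Lemma symmetrize_symmetric k (B : ('I_k -> bidual E) -> C) :
  symmetric_form (symmetrize B).
Proof.
move=> s z; congr (_ * _); rewrite [RHS](reindex_inj (mulIg s)).
by apply: eq_bigr => t _; congr B; apply/funext => i; rewrite /= permM.
Qed.

Lemma symmetrize_weak_star k (B : ('I_k -> bidual E) -> C) :
  separately_weak_star B -> separately_weak_star (symmetrize B).
Proof.
move=> Bw i z.
have H (r : seq 'S_k) : weak_star_continuous (fun w => \sum_(s <- r) B (upd z i w \o s)).
  elim: r => [|s r IH].
    rewrite (_ : (fun w => _) = fun=> 0); first exact: weak_star_cst.
    by apply/funext => w; rewrite big_nil.
  rewrite (_ : (fun w => _) = fun w => 1 * B (upd (z \o s) ((s^-1)%g i) w) +
      \sum_(t <- r) B (upd z i w \o t)); first exact: weak_star_lin (Bw _ _) IH.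
  by apply/funext => w; rewrite big_cons mul1r upd_perm.
rewrite (_ : (fun w => _) =
  fun w => k`!%:R^-1 * (\sum_(s : 'S_k) B (upd z i w \o s)) + 0).
  by apply: weak_star_lin; [exact: H|exact: weak_star_cst].
by apply/funext => w; rewrite addr0.
Qed.

Lemma symmetrize_diag k (B : ('I_k -> bidual E) -> C) z :
  symmetrize B (fun=> z) = B (fun=> z).
Proof.
rewrite /symmetrize; under eq_bigr do rewrite -[_ \o _]/(fun=> z).
rewrite sumr_const card_Sn -[X in _ * X]mulr_natl mulKf// pnatr_eq0.
by rewrite -lt0n fact_gt0.
Qed.

(** What regularity at E and coherence provide for a polynomial in one of the ideals. *)
Definition arens_regular k (P : E -> C) : Prop :=
  [/\ hpoly k P, exists2 M : R, 0 <= M & bounded_form (polar P : ('I_k -> E) -> C) M &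
    forall s B, arens_extension s (polar P : ('I_k -> E) -> C) B -> symmetric_form B].

(** All Arens extensions of the polar form being symmetric, they are separately
    weak-star continuous and hence equal; the value of the Aron-Berner extension is
    then determined. *)
Lemma aron_berner_form k (P : E -> C) : arens_regular k P ->
  exists B : ('I_k -> bidual E) -> C, [/\ multilinear B, symmetric_form B,
    separately_weak_star B, forall x, B (J \o x) = polar P x &
    forall z, aron_berner k P z = B (fun=> z)].
Proof.
move=> [Ph [M M0 PM] Preg]; have [Pm _ _] := hpoly_polar Ph.
have [s sB] := arens_extension_ex Pm M0 PM; set B := arens _ in sB.
have Bs := Preg _ _ sB; have Bw := symmetric_arens_extension sB Bs.
have BJ x : B (J \o x) = polar P x by exact: (arens_embed _ Pm M0 PM).
exists B; split=> //; first exact: (arens_multilinear Pm M0 PM).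
move=> z; rewrite /aron_berner (@xget_unique _ _ _ (fun z => B (fun=> z)))//.
  by exists s, B.
move=> Q [t [D [tD QD]]]; apply/funext => y; rewrite QD.
have Dw := symmetric_arens_extension tD (Preg _ _ tD).
rewrite (separately_weak_star_ext Dw Bw)// => x.
by rewrite BJ; exact: (tD.1 x).
Qed.

(** Any separately weak-star continuous multilinear form with the right diagonal
    on E computes the Aron-Berner extension, symmetric or not. *)
Lemma aron_bernerE k (P : E -> C) (B : ('I_k -> bidual E) -> C) : arens_regular k P ->
  multilinear B -> separately_weak_star B -> (forall x, B (fun=> J x) = P x) ->
  forall z, aron_berner k P z = B (fun=> z).
Proof.
move=> Pr Bm Bw BP z; have [D [Dm Ds Dw DJ ->]] := aron_berner_form Pr.
rewrite -[RHS]symmetrize_diag; suff -> : D = symmetrize B by [].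
apply: (separately_weak_star_ext Dw); first exact: symmetrize_weak_star.
move=> x; rewrite DJ (@polarE _ _ _ _ (fun x => symmetrize B (J \o x)))//; split.
- move=> y i a u v.
  have H w : J \o upd y i w = upd (J \o y) i (J w).
    by apply/funext => j; rewrite /upd/=; case: eqP.
  rewrite !H bidual_embed_linear.
  exact: (symmetrize_multilinear Bm (J \o y) i a (J u) (J v)).
- by move=> s y; exact: (@symmetrize_symmetric _ B s (J \o y)).
- by move=> y; rewrite -BP; exact: symmetrize_diag.
Qed.

End arens.

(** * Banach ideals of polynomials *)

Section one_ideal.
Variables (R : realType) (k : nat) (A : polyclass R) (AI : banach_ideal k A).
Local Notation C := (cplx R).
Variable E : banachType R.
Implicit Types (P Q : E -> C) (c : C).

Lemma ideal_scale c P : A E P -> A E (c *: P).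
Proof. by move=> AP; rewrite -[_ *: _]addr0; exact: (ideal_lin AI c AP (ideal0 AI E)). Qed.

Lemma ideal_add P Q : A E P -> A E Q -> A E (P + Q).
Proof. by move=> AP AQ; rewrite -[P]scale1r; exact: (ideal_lin AI). Qed.

Lemma ideal_sub P Q : A E P -> A E Q -> A E (P - Q).
Proof. by move=> AP AQ; rewrite addrC -scaleN1r; exact: (ideal_lin AI). Qed.

Lemma ideal_sumr I (r : seq I) (p : pred I) (F : I -> E -> C) :
  (forall i, p i -> A E (F i)) -> A E (\sum_(i <- r | p i) F i).
Proof.
move=> AF; apply: big_ind => //; [exact: (ideal0 AI)|exact: ideal_add].
Qed.

Lemma pnorm0 : pnorm A (0 : E -> C) = 0.
Proof.
have := ideal_normZ AI 0 (ideal0 AI E).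
by rewrite scale0r rnorm0 mul0r.
Qed.

Lemma pnormN P : A E P -> pnorm A (- P) = pnorm A P.
Proof.
by move=> AP; rewrite -scaleN1r (ideal_normZ AI)// rnormN rnorm1 mul1r.
Qed.

Lemma pnorm_ge0 P : A E P -> 0 <= pnorm A P.
Proof.
move=> AP; have AN : A E (- P) by rewrite -scaleN1r; exact: ideal_scale.
have := ideal_normD AI AP AN; rewrite subrr pnorm0 pnormN//; lra.
Qed.

Lemma pnormB P Q : A E P -> A E Q -> pnorm A (P - Q) = pnorm A (Q - P).
Proof. by move=> AP AQ; rewrite -opprB pnormN//; exact: ideal_sub. Qed.

Lemma ler_pnorm_sum I (r : seq I) (p : pred I) (F : I -> E -> C) :
  (forall i, p i -> A E (F i)) ->
  pnorm A (\sum_(i <- r | p i) F i) <= \sum_(i <- r | p i) pnorm A (F i).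
Proof.
move=> AF; elim: r => [|i r IH]; first by rewrite !big_nil pnorm0.
rewrite !big_cons; case: ifPn => // pi.
apply: (le_trans (ideal_normD AI (AF _ pi) (ideal_sumr _ AF))).
by rewrite lerD2l.
Qed.

(** Restriction to the line through x, where the ideal norm is the modulus of the
    coefficient. *)
Lemma rnorm_eval_le P x : A E P -> rnorm (P x) <= pnorm A P * rnorm x ^+ k.
Proof.
move=> AP; pose T := fun z : C => z *: x.
have TL : linear T by move=> a u v; rewrite /T scalerDl scalerA.
have TM z : rnorm (T z) <= rnorm x * rnorm z by rewrite /T rnormZ mulrC.
have TC : continuous T := lin_bounded_continuous TL TM.
have [_ PT] := ideal_comp AI TL TC AP.
have PTE : P \o T = P x *: @pow_fun R k.
  by apply/funext => z /=; rewrite (hpolyZ _ _ (ideal_hpoly AI AP)) mulrC.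
have [Apow pow1] := ideal_pow AI.
rewrite PTE (ideal_normZ AI)// pow1 mulr1 in PT.
apply: (le_trans PT); rewrite ler_wpM2l ?pnorm_ge0// lerXn2r ?nnegrE ?rnorm_ge0//.
  exact: opnorm_ge0.
by apply: opnorm_le => //; exact: rnorm_ge0.
Qed.

Lemma ideal_comp_contraction (F : banachType R) (T : F -> E) P :
  linear T -> (forall x, rnorm (T x) <= rnorm x) -> A E P ->
  A F (P \o T) /\ pnorm A (P \o T) <= pnorm A P.
Proof.
move=> TL T1 AP.
have TM x : rnorm (T x) <= 1 * rnorm x by rewrite mul1r.
have TC : continuous T := lin_bounded_continuous TL TM.
have [AT PT] := ideal_comp AI TL TC AP; split=> //.
apply: (le_trans PT); rewrite ler_piMr ?pnorm_ge0//.
by rewrite exprn_ile1// ?opnorm_ge0// opnorm_le.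
Qed.

Lemma fct_sum_apply I (r : seq I) (p : pred I) (F : I -> E -> C) x :
  (\sum_(i <- r | p i) F i) x = \sum_(i <- r | p i) F i x.
Proof. by elim/big_rec2: _ => // i y1 y2 _ <-. Qed.

Lemma ideal_series (a : nat -> E -> C) (u : nat -> R) :
  (forall n, A E (a n)) -> (forall n, pnorm A (a n) <= u n) -> rapid u ->
  exists T, [/\ A E T, forall x, csum (fun n => a n x) (T x) &
    forall n w, (forall m, \sum_(n <= i < m) u i <= w) ->
      pnorm A (T - \sum_(i < n) a i) <= w].
Proof.
move=> Aa au ur; have u0 n : 0 <= u n := le_trans (pnorm_ge0 (Aa n)) (au n).
pose s n := \sum_(i < n) a i.
have As n : A E (s n) by exact: ideal_sumr.
have dist n m : (n <= m)%N -> pnorm A (s m - s n) <= \sum_(n <= i < m) u i.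
  move=> nm; rewrite /s (sum_ord_split _ nm) addrC addKr.
  by apply: (le_trans (ler_pnorm_sum _ _)) => //; exact: ler_sum.
have [T AT sT] : exists2 T, A E T & pnorm A (s n - T) @[n --> \oo] --> (0 : R).
  apply: (ideal_complete AI As) => e e0.
  have [K K0 uK] := rapid_tail u0 ur (half_gt0 R).
  have [N KN] := geom_small K e0.
  exists N => m n Nm Nn; wlog nm : m n Nm Nn / (n <= m)%N.
    by move=> H; have [/H|/ltnW/H] := leqP n m; [exact|rewrite pnormB//; exact].
  exact: le_lt_trans (dist _ _ nm) (le_lt_trans (uK _ _) (KN _ Nn)).
have rem n w : (forall m, \sum_(n <= i < m) u i <= w) -> pnorm A (T - s n) <= w.
  move=> uw; apply/ler_addgt0Pr => d d0.
  move/cvgrPdist_lt : sT => /(_ d d0)[N _ /(_ _ (leq_maxr n N))/=].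
  rewrite sub0r normrN ger0_norm ?pnorm_ge0//; last exact: ideal_sub.
  have := leq_maxl n N; move: (maxn n N) => m nm sTd.
  rewrite -(subrK (s m) T) -addrA.
  apply: (le_trans (ideal_normD AI (ideal_sub AT (As m)) (ideal_sub (As m) (As n)))).
  rewrite [leRHS]addrC lerD//; first by rewrite pnormB// ltW.
  exact: le_trans (dist _ _ nm) (uw m).
exists T; split=> // x e e0.
have [K K0 uK] := rapid_tail u0 ur e0; exists (K * rnorm x ^+ k) => n.
have -> : \sum_(i < n) a i x - T x = (s n - T) x by rewrite -[RHS]/(s n x - T x) /s fct_sum_apply.
apply: (le_trans (rnorm_eval_le _ (ideal_sub (As n) AT))).
rewrite pnormB// mulrAC ler_wpM2r ?exprn_ge0 ?rnorm_ge0//.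
exact: rem.
Qed.

End one_ideal.

Section with_constants.
Variables (R : realType) (A : nat -> polyclass R).
Local Notation C := (cplx R).

(** Degree 0 is filled in with the constants, so that the homogeneous components
    of a function obey the same rules in all degrees. *)
Definition with_constants (k : nat) : polyclass R :=
  if k is 0 then
    Polyclass (fun E => [set P : E -> C | exists c, P = fun=> c]) (fun E P => rnorm (P 0))
  else A k.

Local Notation B := with_constants.

Lemma with_constantsS k : (0 < k)%N -> B k = A k. Proof. by case: k. Qed.

Lemma constants_ideal : banach_ideal 0 (B 0).
Proof.
split=> /=.
- move=> E P [c ->]; split; first exact: cst_continuous.
  by exists (fun=> c); split=> // x [].
- by move=> E; exists 0.
- by move=> E a _ _ [c ->] [d ->]; exists (a *: c + d).
- by move=> E P Q _ _; exact: ler_rnormD.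
- by move=> E a P _; exact: rnormZ.
- by move=> E _ [c ->] /rnorm_eq0 ->.
- move=> E u uc uC.
  have [l ul] := cplx_seq_complete uC.
  exists (fun=> l); first by exists l.
  apply/cvgrPdist_lt => e e0; have [N Nul] := ul e e0; exists N => // n /= /Nul.
  by rewrite sub0r normrN ger0_norm ?rnorm_ge0.
- move=> E1 E T _ TL TC [c ->]; split; first by exists c.
  by rewrite expr0 mulr1.
- split; last by rewrite /pow_fun expr0 rnorm1.
  by exists 1; apply/funext => z; rewrite /pow_fun expr0.
Qed.

Lemma with_constants_ideal : coherent A -> forall k, banach_ideal k (B k).
Proof. by move=> [AI _] [|k]; [exact: constants_ideal|exact: AI]. Qed.

Lemma with_constants_partial : coherent A ->
  exists2 c : R, 1 <= c & forall (E : banachType R) k (P : E -> C) a, B k.+1 E P ->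
    B k E (partial_poly k.+1 1 P a) /\
    pnorm (B k) (partial_poly k.+1 1 P a) <= c * pnorm (B k.+1) P * rnorm a.
Proof.
move=> Ac; have BI := with_constants_ideal Ac; have [AI [c [d [c0 d0 Acd]]]] := Ac.
exists (1 + c); first by rewrite lerDl ltW.
move=> E [|k] P a BP.
  have Pa : partial_poly 1 1 P a = fun=> P a.
    by apply/funext => x; rewrite partial_poly_all//; exact: (ideal_hpoly (BI 1%N)).
  rewrite Pa; split; first by exists (P a).
  apply: (le_trans (rnorm_eval_le (BI 1%N) a BP)).
  rewrite expr1 ler_wpM2r ?rnorm_ge0// ler_peMl ?lerDl ?(ltW c0)//.
  exact: (pnorm_ge0 (BI 1%N)).
have [H _] := Acd E k.+1 isT; have [H1 H2] := H P a BP; split=> //.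
apply: (le_trans H2); rewrite ler_wpM2r ?rnorm_ge0// ler_wpM2r ?lerDr//.
exact: (pnorm_ge0 (BI k.+2)).
Qed.

Lemma with_constants_mul : multiplicative_seq A ->
  exists2 M : R, 1 <= M & forall (E : banachType R) k l (P Q : E -> C),
    B k E P -> B l E Q -> B (k + l) E (P \* Q) /\
    pnorm (B (k + l)%N) (P \* Q) <= M ^+ (k + l) * (pnorm (B k) P * pnorm (B l) Q).
Proof.
move=> [Ac [M AM]]; have BI := with_constants_ideal Ac.
exists (1 + `|M|); first by rewrite lerDl.
have M1 n : 1 <= (1 + `|M|) ^+ n by rewrite exprn_ege1// lerDl.
have mulc (E : banachType R) l (c : C) (Q : E -> C) : B l E Q ->
    B l E ((fun=> c) \* Q) /\ pnorm (B l) ((fun=> c) \* Q) <=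
      (1 + `|M|) ^+ l * (rnorm c * pnorm (B l) Q).
  move=> BQ; split; first exact: (ideal_scale (BI l) c BQ).
  rewrite -[_ \* _]/(c *: Q) (ideal_normZ (BI l))// ler_peMl//.
  by rewrite mulr_ge0 ?rnorm_ge0//; exact: (pnorm_ge0 (BI l)).
move=> E [|k] l P Q BP BQ; first by case: BP => c ->; exact: mulc.
case: l BQ => [|l] BQ.
  case: BQ => c ->; rewrite addn0 (_ : P \* _ = (fun=> c) \* P).
    by rewrite [pnorm (B 0) _]/= [_ * rnorm c]mulrC; exact: mulc.
  by apply/funext => x /=; rewrite mulrC.
have [H1 H2] := AM k.+1 l.+1 isT isT E P Q BP BQ; split=> //.
apply: (le_trans H2); rewrite -mulrA ler_wpM2r//.
  by rewrite mulr_ge0//; [exact: (pnorm_ge0 (BI k.+1))|exact: (pnorm_ge0 (BI l.+1))].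
apply: (le_trans (ler_norm _)); rewrite normrX lerXn2r ?nnegrE ?addr_ge0//.
by rewrite lerDr.
Qed.

(** For l = 0 the map is constant, for l = k it is a multiple of P; the dual norm is
    replaced by any bound N, the form in which functionals are controlled later. *)
Lemma with_constants_weak_diff : weakly_differentiable A ->
  exists2 K : R, 1 <= K & forall (E : banachType R) k l (P : E -> C) (phi : (E -> C) -> C)
      (N : R), (l <= k)%N -> B k E P -> linear_on (B (k - l) E) phi -> 0 <= N ->
    (forall Q, B (k - l) E Q -> rnorm (phi Q) <= N * pnorm (B (k - l)%N) Q) ->
    B l E (fun x => phi (partial_poly k l P x)) /\
    pnorm (B l) (fun x => phi (partial_poly k l P x)) <= K ^+ k * N * pnorm (B k) P.
Proof.
move=> [Ac [K AK]]; have BI := with_constants_ideal Ac.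
exists (1 + `|K|); first by rewrite lerDl.
have K1 n : 1 <= (1 + `|K|) ^+ n by rewrite exprn_ege1// lerDl.
move=> E k l P phi N lk BP phiL N0 phiN.
have P0 := pnorm_ge0 (BI k) BP; have Ph := ideal_hpoly (BI k) BP.
have [l0|l0] := posnP l.
  rewrite {}l0 subn0 in phiN phiL *.
  rewrite (_ : (fun x => _) = fun=> phi P); last first.
    by apply/funext => x; rewrite partial_poly0.
  split; first by exists (phi P).
  apply: (le_trans (phiN P BP)); rewrite -mulrA ler_peMl// mulr_ge0//.
have [kl|lk'] := leqP k l.
  have kE : k = l by apply/eqP; rewrite eqn_leq kl lk.
  subst l; rewrite subnn in phiL phiN.
  have one0 : B 0 E (fun=> 1) by exists 1.
  have phi0 : phi 0 = 0.
    have := phiL (-1) _ _ (ideal0 (BI 0) E) (ideal0 (BI 0) E).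
    by rewrite scaler0 addr0 mulN1r addNr.
  have E1 : (fun x => phi (partial_poly k k P x)) = phi (fun=> 1) *: P.
    apply/funext => x.
    have -> : partial_poly k k P x = P x *: (fun=> 1 : C) + 0.
      apply/funext => y; rewrite partial_poly_all//.
      by rewrite -[RHS]/(P x * 1 + 0) mulr1 addr0.
    rewrite phiL//; last exact: (ideal0 (BI 0)).
    by rewrite phi0 addr0 mulrC.
  rewrite E1; split; first exact: (ideal_scale (BI k)).
  rewrite (ideal_normZ (BI k))// ler_wpM2r//.
  apply: (le_trans (phiN _ one0)); rewrite /= rnorm1 mulr1 ler_peMl//.
have kl0 : (0 < k - l)%N by rewrite subn_gt0.
have k0 : (0 < k)%N by apply: leq_ltn_trans lk'.
rewrite (with_constantsS l0); rewrite (with_constantsS k0) in BP P0 *.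
have BIkl := BI (k - l)%N; rewrite (with_constantsS kl0) in phiL phiN BIkl.
have phi0 : phi 0 = 0.
  have := phiL (-1) _ _ (ideal0 BIkl E) (ideal0 BIkl E).
  by rewrite scaler0 addr0 mulN1r addNr.
have phiB P1 P2 : A (k - l)%N E P1 -> A (k - l)%N E P2 -> phi (P1 - P2) = phi P1 - phi P2.
  by move=> AP AQ; rewrite addrC -scaleN1r phiL// mulN1r addrC.
have phiD : ideal_dual (A (k - l)%N) phi.
  split=> // f Af e e0; exists 1, (e / (N + 1)).
  have N1 : 0 < N + 1 by rewrite ltr_wpDl.
  rewrite divr_gt0//; split=> // g Ag; rewrite ltr_pdivlMr// => fg.
  rewrite -phiB//; apply: le_lt_trans fg.
  apply: (le_trans (phiN _ (ideal_sub BIkl Ag Af))).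
  by rewrite mulrC ler_wpM2l ?lerDl//; exact: (pnorm_ge0 BIkl (ideal_sub BIkl Ag Af)).
have [H1 H2] := AK k l l0 lk' E P phi BP phiD; split=> //.
apply: (le_trans H2); rewrite ler_wpM2r//.
set S := [set rnorm (phi Q) | Q in [set Q | A (k - l)%N E Q /\ pnorm (A (k - l)%N) Q <= 1]].
have S0 : S 0.
  by exists 0; rewrite ?phi0 ?rnorm0//=; split; [exact: (ideal0 BIkl)|rewrite (pnorm0 BIkl)].
have SN r : S r -> r <= N.
  move=> [Q [AQ Q1] <-]; apply: (le_trans (phiN Q AQ)).
  by rewrite -[leRHS]mulr1 ler_wpM2l.
have supN : ideal_dual_norm (A (k - l)%N) phi <= N.
  by apply: ge_sup => //; exists 0.
have sup0 : 0 <= ideal_dual_norm (A (k - l)%N) phi.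
  by apply: (@sup_upper_bound _ S) => //; split; [exists 0|exists N].
apply: (@le_trans _ _ ((1 + `|K|) ^+ k * ideal_dual_norm (A (k - l)%N) phi)).
  rewrite ler_wpM2r//.
  by apply: (le_trans (ler_norm _)); rewrite normrX lerXn2r ?nnegrE ?addr_ge0// lerDr.
by rewrite ler_wpM2l// (le_trans ler01).
Qed.

End with_constants.

(** * Expansions in homogeneous polynomials *)

Section expansions.
Variables (R : realType) (B : nat -> polyclass R).
Hypothesis BI : forall k, banach_ideal k (B k).
Local Notation C := (cplx R).

Definition expands (E : banachType R) (f : E -> C) (P : nat -> E -> C) : Prop :=
  [/\ forall k, B k E (P k), rapid (fun k => pnorm (B k) (P k)) &
    forall x, csum (fun k => P k x) (f x)].

Section basics.
Variable E : banachType R.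
Implicit Types (f g : E -> C) (P Q : nat -> E -> C).

Lemma expands_lin (c : C) f g P Q : expands f P -> expands g Q ->
  expands (c *: f + g) (fun k => c *: P k + Q k).
Proof.
move=> [BP Pr fP] [BQ Qr gQ]; split=> [k||x]; first exact: (ideal_lin (BI k)).
  apply: (rapid_le (rapidD (rapidZ (rnorm_ge0 c) Pr) Qr)) => k.
  rewrite -(ideal_normZ (BI k))//; apply: (ideal_normD (BI k)) => //.
  exact: (ideal_scale (BI k)).
exact: csum_lin.
Qed.

Lemma expands_monomial n (p : E -> C) : B n E p ->
  expands p (fun k => if k == n then p else 0).
Proof.
move=> Bp; split=> [k||x].
- by case: eqVneq => [->//|_]; exact: (ideal0 (BI k)).
- move=> e e0; exists (pnorm (B n) p / e ^+ n) => k; case: eqVneq => [->|_].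
    by rewrite divfK// expf_neq0// lt0r_neq0.
  by rewrite (pnorm0 (BI k)) mulr_ge0 ?divr_ge0 ?exprn_ge0 ?(ltW e0)// (pnorm_ge0 (BI n)).
- have := @csum_finite _ (fun k => (if k == n then p else 0) x) n.+1.
  rewrite big_ord_recr/= eqxx big1 ?add0r => [|k _].
    apply=> k nk; case: eqVneq => // kn; by rewrite kn ltnn in nk.
  by case: eqVneq => // kn; have := ltn_ord k; rewrite kn ltnn.
Qed.

Lemma pnorm_eval_rapid P x : (forall k, B k E (P k)) ->
  rapid (fun k => pnorm (B k) (P k)) -> rapid (fun k => rnorm (P k x)).
Proof.
move=> BP Pr; apply: (rapid_le (rapidM_geom ler01 (rnorm_ge0 x) Pr)) => k.
by rewrite mul1r mulrC; exact: (rnorm_eval_le (BI k)).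
Qed.

(** Homogeneous components of a sum of a triangular array of polynomials: the
    columns are summed in norm, and the rearrangement is pointwise. *)
Lemma expands_array f (D : nat -> nat -> E -> C) (u : nat -> R) :
  (forall k j, B j E (D k j)) -> (forall k j, pnorm (B j) (D k j) <= u k) ->
  rapid u -> (forall k j, (k < j)%N -> D k j = 0) ->
  (forall x, csum (fun k => \sum_(j < k.+1) D k j x) (f x)) ->
  exists T, [/\ expands f T, forall j x, csum (fun k => D k j x) (T j x),
    forall j, rapid (fun n => pnorm (B j) (T j - \sum_(k < n) D k j)) &
    forall j w, (forall m, \sum_(j <= k < m) u k <= w) -> pnorm (B j) (T j) <= w].
Proof.
move=> BD Du ur D0 fD.
have u0 k : 0 <= u k := le_trans (pnorm_ge0 (BI 0%N) (BD k 0%N)) (Du k 0%N).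
have /choice[T TP] : forall j, exists Tj, [/\ B j E Tj,
    forall x, csum (fun k => D k j x) (Tj x) &
    forall n w, (forall m, \sum_(n <= i < m) u i <= w) ->
      pnorm (B j) (Tj - \sum_(i < n) D i j) <= w].
  by move=> j; apply: (ideal_series (BI j)).
have Tw j w : (forall m, \sum_(j <= k < m) u k <= w) -> pnorm (B j) (T j) <= w.
  have [BT _ Tu] := TP j; move=> /Tu; rewrite big1 ?subr0// => k _; exact: D0.
have Tcs j x : csum (fun k => D k j x) (T j x) by case: (TP j).
exists T; split=> // [|j e e0]; last first.
  have [K K0 uK] := rapid_tail u0 ur e0; exists K => n.
  by have [_ _] := TP j; apply; exact: uK.
split=> [j|e e0|x]; first by case: (TP j).
  have [K K0 uK] := rapid_tail u0 ur e0; exists K => j.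
  by apply: Tw; exact: uK.
have x1 : 0 <= 1 + rnorm x by rewrite addr_ge0 ?rnorm_ge0.
pose v k := 1 * (1 + rnorm x) ^+ k * u k.
apply/(@csum_rows_columns _ (fun k j => D k j x) v); last exact: fD.
- by move=> k; rewrite /v mul1r mulr_ge0// exprn_ge0.
- exact: rapidM_geom.
- move=> k j; have [kj|jk] := ltnP k j.
    by rewrite D0// rnorm0 /v mul1r mulr_ge0// exprn_ge0.
  apply: (le_trans (rnorm_eval_le (BI j) x (BD k j))).
  rewrite /v mul1r mulrC ler_pM ?exprn_ge0 ?rnorm_ge0 ?(pnorm_ge0 (BI j))//.
  apply: (@le_trans _ _ ((1 + rnorm x) ^+ j)).
    by rewrite lerXn2r ?nnegrE ?rnorm_ge0// lerDr.
  by rewrite ler_weXn2l// lerDl rnorm_ge0.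
- by move=> k j kj; rewrite D0.
- by [].
Qed.

End basics.

Lemma expands_mul (M : R) (E : banachType R) (f g : E -> C) P Q : 1 <= M ->
  (forall k l (p q : E -> C), B k E p -> B l E q -> B (k + l) E (p \* q) /\
    pnorm (B (k + l)%N) (p \* q) <= M ^+ (k + l) * (pnorm (B k) p * pnorm (B l) q)) ->
  expands f P -> expands g Q ->
  expands (f \* g) (fun n => \sum_(i < n.+1) P i \* Q (n - i)%N).
Proof.
move=> M1 BM [BP Pr fP] [BQ Qr gQ].
have PQ n (i : 'I_n.+1) : B n E (P i \* Q (n - i)%N) /\
    pnorm (B n) (P i \* Q (n - i)%N) <=
      M ^+ n * (pnorm (B i) (P i) * pnorm (B (n - i)%N) (Q (n - i)%N)).
  have := BM i (n - i)%N _ _ (BP i) (BQ (n - i)%N).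
  by rewrite subnKC// -ltnS.
split=> [n||x]; first by apply: (ideal_sumr (BI n)) => i _; case: (PQ n i).
  move=> e e0; have M0 : 0 < M by apply: lt_le_trans M1.
  have e2 : 0 < e / M / 2 by rewrite !divr_gt0.
  have [K K0 PK] := rapid_bound Pr e2; have [L L0 QL] := rapid_bound Qr e2.
  exists (K * L) => n.
  apply: (le_trans (ler_pnorm_sum (BI n) _ _)) => [i _|]; first by case: (PQ n i).
  apply: (@le_trans _ _ (\sum_(i < n.+1) K * L * (e / 2) ^+ n)); last first.
    by apply: sum_const_half_geom => //; rewrite mulr_ge0.
  apply: ler_sum => i _; have [_ le1] := PQ n i; apply: (le_trans le1).
  have le_in : (i <= n)%N by rewrite -ltnS.
  have p0 j := pnorm_ge0 (BI j) (BP j); have q0 j := pnorm_ge0 (BI j) (BQ j).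
  apply: (@le_trans _ _ (M ^+ n * (K * (e / M / 2) ^+ i * (L * (e / M / 2) ^+ (n - i))))).
    by rewrite ler_wpM2l ?exprn_ge0 ?(ltW M0)// ler_pM.
  rewrite mulrACA -exprD subnKC// mulrCA ler_wpM2l ?mulr_ge0// -exprMn.
  have -> : M * (e / M / 2) = e / 2 by field; rewrite lt0r_neq0.
  by [].
have := csum_cauchy_product (fun k => lexx _) (fun k => lexx _)
  (pnorm_eval_rapid x BP Pr) (pnorm_eval_rapid x BQ Qr) (fP x) (gQ x).
by congr (csum _ _); apply/funext => n; rewrite fct_sum_apply.
Qed.

Lemma bin_le_exp2 k j : ('C(k, j) <= 2 ^ k)%N.
Proof.
elim: k j => [|k IH] [|j]; rewrite ?bin0 ?expn_gt0// binS expnS mul2n -addnn.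
exact: leq_add.
Qed.

Section affine.
Variable c : R.
Hypothesis c1 : 1 <= c.
Hypothesis Bpart : forall (E : banachType R) k (P : E -> C) a, B k.+1 E P ->
  B k E (partial_poly k.+1 1 P a) /\
  pnorm (B k) (partial_poly k.+1 1 P a) <= c * pnorm (B k.+1) P * rnorm a.

Let c0 : 0 <= c. Proof. by apply: le_trans c1. Qed.

Lemma partial_poly_ideal (E : banachType R) i k (P : E -> C) a : (i <= k)%N -> B k E P ->
  B (k - i) E (partial_poly k i P a) /\
  pnorm (B (k - i)%N) (partial_poly k i P a) <= (c * rnorm a) ^+ i * pnorm (B k) P.
Proof.
elim: i k P => [|i IH] [|k] P // ik BP.
- by rewrite partial_poly0 ?expr0 ?mul1r//; exact: (ideal_hpoly (BI _) BP).
- by rewrite partial_poly0 ?expr0 ?mul1r//; exact: (ideal_hpoly (BI _) BP).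
rewrite partial_polyS ?subSS; last exact: (ideal_hpoly (BI _) BP).
have [BPa Pa] := Bpart a BP; have [BPi Pi] := IH k _ ik BPa; split=> //.
apply: (le_trans Pi); rewrite exprSr -mulrA ler_wpM2l ?exprn_ge0 ?mulr_ge0 ?rnorm_ge0//.
by rewrite mulrAC.
Qed.

(** The polar form is bounded because coherence can be applied once per variable. *)
Lemma polar_bounded (E : banachType R) k (P : E -> C) : B k E P ->
  bounded_form (polar P : ('I_k -> E) -> C) (c ^+ k * pnorm (B k) P).
Proof.
elim: k P => [|k IH] P BP x.
  have /hpoly_polar[_ _ PE] := ideal_hpoly (BI 0%N) BP.
  rewrite big_ord0 expr0 mul1r mulr1 (ord0_fun_eq x (fun=> 0)) PE.
  by have := rnorm_eval_le (BI 0%N) 0 BP; rewrite expr0 mulr1.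
have [BPa Pa] := Bpart (x ord0) BP.
have /hpoly_polar/is_polar_fcons/polarE Pp := ideal_hpoly (BI k.+1) BP.
have := IH _ BPa (x \o lift ord0); rewrite Pp fcons_eta => /le_trans; apply.
rewrite big_ord_recl mulrA; apply: ler_wpM2r.
  by apply: prodr_ge0 => i _; exact: rnorm_ge0.
rewrite exprSr -!mulrA ler_wpM2l ?exprn_ge0//.
by rewrite mulrA.
Qed.

Section array.
Variables (E F : banachType R) (T : E -> F) (a : F) (Q : nat -> F -> C).
Hypotheses (TL : linear T) (T1 : forall x, rnorm (T x) <= rnorm x).
Hypothesis BQ : forall k, B k F (Q k).

(** Entry (k, j) is the term of degree j in x of the polynomial Q k at a + T x. The
    choices T = id and T = the embedding in the bidual give the two translations. *)
Definition affine_array k j : E -> C :=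
  if (j <= k)%N then 'C(k, j)%:R *: (partial_poly k (k - j) (Q k) a \o T) else 0.

Lemma affine_array_ideal k j : B j E (affine_array k j).
Proof.
rewrite /affine_array; case: leqP => jk; last exact: (ideal0 (BI j)).
apply: (ideal_scale (BI j)); apply: (ideal_comp_contraction (BI j) TL T1 _).1.
by have := (partial_poly_ideal a (leq_subr j k) (BQ k)).1; rewrite subKn.
Qed.

Lemma affine_array_le k j :
  pnorm (B j) (affine_array k j) <= (2 * (c * (1 + rnorm a))) ^+ k * pnorm (B k) (Q k).
Proof.
have q0 := pnorm_ge0 (BI k) (BQ k); have a0 := rnorm_ge0 a.
rewrite /affine_array; case: leqP => jk; last first.
  by rewrite (pnorm0 (BI j)) mulr_ge0// exprn_ge0// !mulr_ge0// addr_ge0.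
have := partial_poly_ideal a (leq_subr j k) (BQ k); rewrite subKn// => -[BQa Qa].
have [BQT QT] := ideal_comp_contraction (BI j) TL T1 BQa.
rewrite (ideal_normZ (BI j))// rnorm_nat exprMn -mulrA.
apply: ler_pM => //; first exact: (pnorm_ge0 (BI j)).
  by rewrite -natrX ler_nat bin_le_exp2.
apply: (le_trans QT); apply: (le_trans Qa); rewrite ler_wpM2r//.
apply: (@le_trans _ _ ((c * (1 + rnorm a)) ^+ (k - j))).
  by rewrite lerXn2r ?nnegrE ?mulr_ge0 ?addr_ge0// ler_wpM2l// lerDr.
by rewrite ler_weXn2l ?leq_subr// mulr_ege1// lerDl.
Qed.

Lemma affine_array_triangular k j : (k < j)%N -> affine_array k j = 0.
Proof. by rewrite /affine_array ltnNge => /negbTE->. Qed.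

Lemma affine_array_sum k x : \sum_(j < k.+1) affine_array k j x = Q k (a + T x).
Proof.
rewrite (hpoly_binomial _ _ (ideal_hpoly (BI k) (BQ k))) (reindex_inj rev_ord_inj)/=.
apply: eq_bigr => j _; have jk : (j <= k)%N by rewrite -ltnS.
by rewrite /affine_array subSS leq_subr subKn// bin_sub.
Qed.

Hypothesis Qr : rapid (fun k => pnorm (B k) (Q k)).

Lemma affine_array_rapid :
  rapid (fun k => (2 * (c * (1 + rnorm a))) ^+ k * pnorm (B k) (Q k)).
Proof.
have a0 := rnorm_ge0 a; apply: rapid_geom Qr.
by rewrite !mulr_ge0// addr_ge0.
Qed.

Lemma expands_affine (h : E -> C) : (forall x, csum (fun k => Q k (a + T x)) (h x)) ->
  exists H, [/\ expands h H, forall j x, csum (fun k => affine_array k j x) (H j x) &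
    forall j, rapid (fun n => pnorm (B j) (H j - \sum_(k < n) affine_array k j))].
Proof.
move=> hQ; have [] := @expands_array _ h affine_array _ affine_array_ideal
  affine_array_le affine_array_rapid affine_array_triangular.
  by move=> x; under eq_fun do rewrite affine_array_sum; exact: hQ.
by move=> H [hH HD Hr _]; exists H.
Qed.

End array.

Lemma expands_translate (E : banachType R) (f : E -> C) P a : expands f P ->
  exists Q, expands (fun x => f (a + x)) Q.
Proof.
move=> [BP Pr fP].
have [] := @expands_affine E E id a P _ _ BP Pr (fun x => f (a + x)) (fun x => fP (a + x)).
- by [].
- by [].
- by move=> Q [fQ _ _]; exists Q.
Qed.

End affine.
End expansions.

(** * Holomorphic functions of bounded type *)

Lemma cplx_cvg_unique (R : realType) (u : nat -> cplx R) (l l' : cplx R) :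
  u @ \oo --> l -> u @ \oo --> l' -> l = l'.
Proof.
move=> ul; have <- : limn u = l by apply: cvg_lim ul; exact: norm_hausdorff.
by move=> ul'; apply: cvg_lim ul'; exact: norm_hausdorff.
Qed.

Section taylor_expansions.
Variables (R : realType) (E : normedModType (cplx R)).
Local Notation C := (cplx R).
Implicit Types (f g : E -> C) (P Q : nat -> E -> C).

Lemma taylor_at_cvg f a P : taylor_at f a P -> exists2 r : R, 0 < r &
  forall x, rnorm x < r -> series (fun k => P k x) @ \oo --> f (a + x).
Proof.
move=> [_ [r r0 fP]]; exists r => // x xr.
have ar : [set a + x] `<=` [set y | rnorm (y - a) < r].
  by move=> _ ->; rewrite /= addrC addKr.
have -> : series (fun k => P k x) = fun n => \sum_(k < n) P k (a + x - a).
  apply/funext => n; rewrite /series/= big_mkord.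
  by apply: eq_bigr => k _; rewrite addrC addKr.
by have := uniform_subset_cvg _ ar fP; rewrite uniform_set1 => H; exact: H.
Qed.

Lemma taylor_at_uniform f a P (r : R) : (forall k, hpoly k (P k)) -> 0 < r ->
  (forall e : R, 0 < e -> exists N, forall n, (N <= n)%N -> forall x, rnorm x < r ->
     rnorm (\sum_(k < n) P k x - f (a + x)) < e) -> taylor_at f a P.
Proof.
move=> Ph r0 fP; split=> //; exists r => // W /uniform_nbhs[V [+ VW]].
rewrite -entourage_ballE => -[_ /ofR_ltP[e e0 ->] eV].
have [N NfP] := fP e e0; exists N => // n /= Nn; apply: VW => y yr.
apply: eV; rewrite /= -ball_normE/= rnorm_lt rnormB.
by have := NfP n Nn _ yr; rewrite (addrC a) subrK.
Qed.

Lemma rnormZ_ofR (t : R) (x : E) : 0 <= t -> rnorm (ofR t *: x) = t * rnorm x.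
Proof. by move=> t0; rewrite rnormZ rnorm_ofR ger0_norm. Qed.

(** Along a ray two expansions are power series in the parameter. *)
Lemma series_ray_unique P Q (l : R -> C) (d : R) x :
  (forall k, hpoly k (P k)) -> (forall k, hpoly k (Q k)) -> 0 < d ->
  (forall t, 0 < t < d -> series (fun k => P k (ofR t *: x)) @ \oo --> l t) ->
  (forall t, 0 < t < d -> series (fun k => Q k (ofR t *: x)) @ \oo --> l t) ->
  forall k, P k x = Q k x.
Proof.
move=> Ph Qh d0 Pl Ql k; apply/eqP; rewrite -subr_eq0; apply/eqP; move: k.
apply: (power_series_eq0 d0) => t t0.
rewrite -(subrr (l t)).
rewrite (_ : series _ = series (fun k => P k (ofR t *: x)) - series (fun k => Q k (ofR t *: x))).
  exact: (cvgB (Pl t t0) (Ql t t0)).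
apply/funext => n; rewrite -[RHS]/(series _ n - series _ n) /series/= -sumrB.
by apply: eq_bigr => k _; rewrite (hpolyZ _ _ (Ph k)) (hpolyZ _ _ (Qh k)) mulrBr.
Qed.

Lemma taylor_at_unique f P Q : taylor_at f 0 P -> taylor_at f 0 Q -> P = Q.
Proof.
move=> fP fQ; apply/funext => k; apply/funext => x.
have [r r0 Pr] := taylor_at_cvg fP; have [s s0 Qs] := taylor_at_cvg fQ.
have x1 : 0 < rnorm x + 1 by rewrite ltr_wpDl ?rnorm_ge0.
have rs0 : 0 < Num.min r s by rewrite lt_min r0.
have small t : 0 < t < Num.min r s / (rnorm x + 1) ->
    rnorm (ofR t *: x) < Num.min r s.
  move=> /andP[t0]; rewrite ltr_pdivlMr// => /(le_lt_trans _); apply.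
  by rewrite rnormZ_ofR ?(ltW t0)// ler_wpM2l ?lerDl// (ltW t0).
apply: (@series_ray_unique P Q (fun t => f (0 + ofR t *: x)) _ x fP.1 fQ.1
  (divr_gt0 rs0 x1)) => t /small; rewrite lt_min => /andP[tr ts].
  exact: Pr.
exact: Qs.
Qed.

Lemma taylorE f P : taylor_at f 0 P -> taylor f = P.
Proof.
move=> fP; apply: xget_unique => // Q fQ; exact: taylor_at_unique fQ fP.
Qed.

(** Identity theorem. On the segment from 0 to x, at the end s x of the largest
    initial piece on which f and g agree, the two Taylor series have the same
    homogeneous terms in the direction x, because they agree on the side of 0;
    hence f and g agree a little further. *)
Lemma entire_identity f g P : entire f -> entire g -> taylor_at f 0 P ->
  taylor_at g 0 P -> f = g.
Proof.
move=> fe ge fP gP; apply/funext => x; apply: contrapT => fgx.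
have x1 : 0 < rnorm x + 1 by rewrite ltr_wpDl ?rnorm_ge0.
pose Z := [set t : R | 0 <= t /\ forall s, 0 <= s <= t -> f (ofR s *: x) = g (ofR s *: x)].
have Z1 t : Z t -> t <= 1.
  move=> [t0 tZ]; rewrite leNgt; apply/negP => t1; apply: fgx.
  have := tZ 1; rewrite ler01 ltW// => /(_ isT).
  by rewrite (_ : ofR 1 = 1 :> C)// scale1r.
have small r t : 0 < r -> 0 <= t < r / (rnorm x + 1) -> rnorm (ofR t *: x) < r.
  move=> r0 /andP[t0]; rewrite ltr_pdivlMr// => /(le_lt_trans _); apply.
  by rewrite rnormZ_ofR// ler_wpM2l// lerDl.
have [r0 r00 r0Z] : exists2 r : R, 0 < r & Z r.
  have [r r0 fr] := taylor_at_cvg fP; have [s s0 gs] := taylor_at_cvg gP.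
  have rs0 : 0 < Num.min r s by rewrite lt_min r0.
  have d0 := divr_gt0 rs0 x1.
  exists (Num.min r s / (rnorm x + 1) / 2); first by rewrite divr_gt0.
  split=> [|t /andP[t0 td]]; first by rewrite ltW// divr_gt0.
  have td' : 0 <= t < Num.min r s / (rnorm x + 1).
    by rewrite t0/= (le_lt_trans td)// ltr_pdivrMr// ltr_pMr// ltr1n.
  have := small _ _ rs0 td'; rewrite lt_min => /andP[tr ts].
  have := cplx_cvg_unique (fr _ tr) (gs _ ts).
  by rewrite !add0r.
have Zsup : has_sup Z by split; [exists r0|exists 1].
set s := sup Z.
have s0 : 0 < s by apply: lt_le_trans r00 _; exact: (sup_upper_bound Zsup).
have before t : 0 <= t < s -> f (ofR t *: x) = g (ofR t *: x).
  move=> /andP[t0 ts]; have d0 : 0 < s - t by rewrite subr_gt0.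
  have [z [z0 zZ] zs] := sup_adherent d0 Zsup.
  by apply: zZ; rewrite t0 ltW//; move: zs; rewrite -/s opprB addrCA subrr addr0.
have [Pf fPf] := fe (ofR s *: x); have [Pg gPg] := ge (ofR s *: x).
have [r r_gt0 fr] := taylor_at_cvg fPf; have [r' r'0 gr] := taylor_at_cvg gPg.
have rr0 : 0 < Num.min r r' by rewrite lt_min r_gt0.
set d := Num.min r r' / (rnorm x + 1).
have d0 : 0 < d by rewrite divr_gt0.
have ofRD t : ofR s *: x + ofR t *: x = ofR (s + t) *: x.
  by rewrite -scalerDl /ofR rmorphD.
have ofRN t : ofR t *: (- x) = ofR (- t) *: x.
  by rewrite scalerN -scaleNr /ofR rmorphN.
have PfPg k : Pf k x = Pg k x.
  have H : Pf k (- x) = Pg k (- x).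
    have m0 : 0 < Num.min d s by rewrite lt_min d0.
    apply: (@series_ray_unique Pf Pg (fun t => f (ofR s *: x + ofR t *: (- x)))
      _ (- x) fPf.1 gPg.1 m0) => t /andP[t0]; rewrite lt_min => /andP[td ts].
      apply: fr; rewrite scalerN rnormN.
      have := @small _ t rr0; rewrite ltW// td => /(_ isT).
      by rewrite lt_min => /andP[].
    rewrite ofRN ofRD before -?ofRD -?ofRN; last first.
      by rewrite subr_ge0 ltW//= gtrBl.
    apply: gr; rewrite scalerN rnormN.
    have := @small _ t rr0; rewrite ltW// td => /(_ isT).
    by rewrite lt_min => /andP[].
  move: H; rewrite -scaleN1r (hpolyZ _ _ (fPf.1 k)) (hpolyZ _ _ (gPg.1 k)).
  by apply: mulfI; rewrite expf_neq0// oppr_eq0 oner_neq0.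
have after t : 0 <= t < d -> f (ofR (s + t) *: x) = g (ofR (s + t) *: x).
  move=> td; have := small _ _ rr0 td; rewrite lt_min => /andP[tr tr'].
  rewrite -ofRD; apply: (cplx_cvg_unique (fr _ tr)).
  rewrite (_ : series _ = series (fun k => Pg k (ofR t *: x))); first exact: gr.
  congr series; apply/funext => k.
  by rewrite (hpolyZ _ _ (fPf.1 k)) (hpolyZ _ _ (gPg.1 k)) PfPg.
have : Z (s + d / 2).
  split=> [|t /andP[t0 tsd]]; first by rewrite ltW// addr_gt0// divr_gt0.
  have [ts|st] := ltP t s; first by apply: before; rewrite t0.
  rewrite -(subrK s t) addrC; apply: after.
  by rewrite subr_ge0 st/= ltrBlDl (le_lt_trans tsd)// ltrD2l ltr_pdivrMr// ltr_pMr// ltr1n.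
move=> /(sup_upper_bound Zsup); rewrite -/s gerDl leNgt.
by rewrite divr_gt0.
Qed.

End taylor_expansions.

Section bounded_type.
Variables (R : realType) (A : nat -> polyclass R).
Hypothesis Ac : coherent A.
Local Notation C := (cplx R).
Local Notation B := (with_constants A).
Let BI := with_constants_ideal Ac.

Variable E : banachType R.
Implicit Types (f g : E -> C) (P Q : nat -> E -> C).

Lemma expands_taylor_at f a Q : expands B (fun x => f (a + x)) Q -> taylor_at f a Q.
Proof.
move=> [BQ Qr fQ]; apply: (taylor_at_uniform _ (@ltr01 R)).
  by move=> k; exact: (ideal_hpoly (BI k)).
move=> e e0; have Q0 k : 0 <= pnorm (B k) (Q k) by exact: (pnorm_ge0 (BI k)).
have [K K0 QK] := rapid_tail Q0 Qr (half_gt0 R).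
have [N NK] := geom_small K e0; exists N => n Nn x x1.
apply: le_lt_trans (NK n Nn).
have xQ k : rnorm (Q k x) <= pnorm (B k) (Q k).
  apply: (le_trans (rnorm_eval_le (BI k) x (BQ k))).
  by rewrite ler_piMr// exprn_ile1 ?rnorm_ge0// ltW.
exact: (csum_remainder xQ QK (fQ x) n).
Qed.

Lemma expands_entire f P : expands B f P -> entire f.
Proof.
move=> fP a; have [c c1 Bc] := with_constants_partial Ac.
have [Q fQ] := expands_translate BI c1 Bc a fP.
by exists Q; exact: expands_taylor_at.
Qed.

Lemma expands_taylor f P : expands B f P -> taylor f = P.
Proof.
move=> fP; apply: taylorE; apply: expands_taylor_at.
by rewrite (_ : (fun x => f (0 + x)) = f)//; apply/funext => x; rewrite add0r.
Qed.

Lemma expands_Hb f P : expands B f P -> Hb A f.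
Proof.
move=> fP; have [BP Pr _] := fP; split; first exact: expands_entire fP.
  by move=> k k0; have := BP k; rewrite (with_constantsS _ k0) (expands_taylor fP).
have P0 k : 0 <= pnorm (B k) (P k) by exact: (pnorm_ge0 (BI k)).
apply: cvg_trans ((rapidP P0).1 Pr); apply: near_eq_cvg.
by exists 1%N => // k /= k0; rewrite (expands_taylor fP) (with_constantsS _ k0).
Qed.

(** The definition gives the Taylor series near 0 only. Its sum is an entire function
    with the same expansion at 0, and the identity theorem does the rest. *)
Lemma Hb_expands f : Hb A f -> expands B f (taylor f).
Proof.
move=> [fe fA fr]; have [P fP] := fe 0; rewrite (taylorE fP) in fA fr *.
have BP k : B k E (P k).
  case: k => [|k]; last exact: fA.
  have [_ _ P0] := hpoly_polar (fP.1 0%N).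
  exists (P 0%N 0); apply/funext => x; rewrite -!P0; congr polar; exact: ord0_fun_eq.
have P0 k : 0 <= pnorm (B k) (P k) by exact: (pnorm_ge0 (BI k)).
have Pr : rapid (fun k => pnorm (B k) (P k)).
  apply/(rapidP P0); apply: cvg_trans fr; apply: near_eq_cvg.
  by exists 1%N => // k /= k0; rewrite (with_constantsS _ k0).
have /choice[g gP] : forall x, exists l, csum (fun k => P k x) l.
  move=> x; apply: (csum_exists (u := fun k => rnorm (P k x))) => //.
  exact: (pnorm_eval_rapid BI).
have {}gP : expands B g P by [].
have gP0 : taylor_at g 0 P.
  by rewrite -(expands_taylor gP); have [Q gQ] := expands_entire gP 0; rewrite (taylorE gQ).
by rewrite (entire_identity fe (expands_entire gP) fP gP0).
Qed.

Lemma Hb_seminorm_partial f P r n : expands B f P ->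
  \sum_(k < n.+1) pnorm (B k) (P k) * r ^+ k =
  rnorm (f 0) + series (fun k => pnorm (A k.+1) (taylor f k.+1) * r ^+ k.+1) n.
Proof.
move=> fP; have [BP Pr fx] := fP; rewrite (expands_taylor fP) big_ord_recl.
congr (_ + _); last by rewrite /series/= big_mkord.
have -> : f 0 = P 0%N 0; last by rewrite expr0 mulr1.
apply: (csum_unique (fx 0)).
have := @csum_finite _ (fun k => P k 0) 1; rewrite big_ord_recl big_ord0 addr0.
apply=> -[//|k] _.
by rewrite -(scale0r 0) (hpolyZ _ _ (ideal_hpoly (BI _) (BP _))) expr0n mul0r.
Qed.

Lemma Hb_seminorm_cvg f P r : 0 <= r -> expands B f P ->
  let s := series (fun k => pnorm (A k.+1) (taylor f k.+1) * r ^+ k.+1) in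
  nondecreasing_seq s /\ cvgn s.
Proof.
move=> r0 fP s; have [BP Pr _] := fP.
have P0 k : 0 <= pnorm (B k) (P k) * r ^+ k.
  by rewrite mulr_ge0 ?exprn_ge0//; exact: (pnorm_ge0 (BI k) (BP k)).
have snd : nondecreasing_seq s.
  apply: nondecreasing_series => k _ _.
  by rewrite (expands_taylor fP); exact: (P0 k.+1).
split=> //; apply: nondecreasing_is_cvgn => //.
have Sr : rapid (fun k => pnorm (B k) (P k) * r ^+ k).
  by apply: (rapid_le (rapidM_geom ler01 r0 Pr)) => k; rewrite mul1r mulrC.
have [K K0 SK] := rapid_tail P0 Sr (@ltr01 R).
exists K => _ [m _ <-]; have := SK 0%N m.+1; rewrite expr0 mulr1; apply: le_trans.
by rewrite big_mkord (Hb_seminorm_partial _ _ fP) lerDr rnorm_ge0.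
Qed.

Lemma Hb_seminorm_le f P r (w : R) : 0 <= r -> expands B f P ->
  (forall n, \sum_(k < n) pnorm (B k) (P k) * r ^+ k <= w) -> Hb_seminorm A r f <= w.
Proof.
move=> r0 fP Pw; have [_ scvg] := Hb_seminorm_cvg r0 fP.
rewrite /Hb_seminorm addrC -lerBrDr; apply: limr_le => //.
by apply: nearW => n; rewrite lerBrDr addrC -(Hb_seminorm_partial _ _ fP).
Qed.

Lemma Hb_seminorm_ge f P r n : 0 <= r -> expands B f P ->
  \sum_(k < n) pnorm (B k) (P k) * r ^+ k <= Hb_seminorm A r f.
Proof.
move=> r0 fP; have [snd scvg] := Hb_seminorm_cvg r0 fP.
apply: (@le_trans _ _ (\sum_(k < n.+1) pnorm (B k) (P k) * r ^+ k)).
  rewrite [leRHS]big_ord_recr/= lerDl mulr_ge0 ?exprn_ge0//.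
  by case: fP => BP _ _; exact: (pnorm_ge0 (BI n)).
rewrite (Hb_seminorm_partial _ _ fP) lerD2l.
exact: nondecreasing_cvgn_le.
Qed.

Lemma Hb_lin (c : C) f g : Hb A f -> Hb A g -> Hb A (c *: f + g).
Proof.
by move=> /Hb_expands fP /Hb_expands gQ; apply: expands_Hb (expands_lin BI c fP gQ).
Qed.

Lemma Hb0 : Hb A (0 : E -> C).
Proof. exact: expands_Hb (expands_monomial BI (ideal0 (BI 0%N) E)). Qed.

Lemma Hb_ideal k (P : E -> C) : B k E P -> Hb A P.
Proof. by move=> BP; apply: expands_Hb (expands_monomial BI BP). Qed.

End bounded_type.

(** * Continuous functionals on the space of functions of bounded type *)

Section functionals.
Variables (R : realType) (A : nat -> polyclass R).
Hypothesis Ac : coherent A.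
Local Notation C := (cplx R).
Local Notation B := (with_constants A).
Let BI := with_constants_ideal Ac.

Variable E : banachType R.
Implicit Types (f g : E -> C) (P : nat -> E -> C).

Lemma expandsZ (c : C) f P : expands B f P -> expands B (c *: f) (fun k => c *: P k).
Proof.
move=> fP; have f0 : expands B 0 (fun=> 0 : E -> C).
  have := expands_monomial BI (ideal0 (BI 0%N) E).
  by congr expands; apply/funext => k; rewrite if_same.
have := expands_lin BI c fP f0; rewrite addr0.
by congr expands; apply/funext => k; rewrite addr0.
Qed.

Lemma Hb_sum I (r : seq I) (F : I -> E -> C) : (forall i, Hb A (F i)) ->
  Hb A (\sum_(i <- r) F i).
Proof.
move=> HF; elim: r => [|i r IH]; first by rewrite big_nil; exact: Hb0.
by rewrite big_cons -(scale1r (F i)); exact: (Hb_lin Ac 1 (HF i) IH).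
Qed.

Section one_functional.
Variable phi : (E -> C) -> C.
Hypothesis phiL : linear_on (@Hb R A E) phi.

Lemma functional0 : phi 0 = 0.
Proof.
have N1 (c : C) : -1 * c + c = 0 by rewrite mulN1r addNr.
apply: etrans (N1 (phi 0)); apply: etrans (phiL (-1) (Hb0 Ac E) (Hb0 Ac E)).
by congr phi; rewrite addr0 scaler0.
Qed.

Lemma functionalZ c f : Hb A f -> phi (c *: f) = c * phi f.
Proof.
move=> Hf; rewrite -(addr0 (c *: f)); apply: (etrans (phiL c Hf (Hb0 Ac E))).
by rewrite functional0 addr0.
Qed.

Lemma functionalD f g : Hb A f -> Hb A g -> phi (f + g) = phi f + phi g.
Proof.
by move=> Hf Hg; rewrite -{1}(scale1r f); apply: (etrans (phiL 1 Hf Hg)); rewrite mul1r.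
Qed.

Lemma functionalB f g : Hb A f -> Hb A g -> phi (f - g) = phi f - phi g.
Proof.
move=> Hf Hg; rewrite (addrC f) -(scaleN1r g); apply: (etrans (phiL (-1) Hg Hf)).
by rewrite mulN1r addrC.
Qed.

Lemma functional_sum I (r : seq I) (F : I -> E -> C) : (forall i, Hb A (F i)) ->
  phi (\sum_(i <- r) F i) = \sum_(i <- r) phi (F i).
Proof.
move=> HF; elim: r => [|i r IH]; first by rewrite !big_nil functional0.
by rewrite !big_cons functionalD ?IH//; exact: Hb_sum.
Qed.

Lemma bounded_functional_continuous K r : 0 <= K -> 0 < r ->
  (forall f, Hb A f -> rnorm (phi f) <= K * Hb_seminorm A r f) ->
  continuous_on (@Hb R A E) (Hb_seminorm A (E := E)) phi.
Proof.
move=> K0 r0 phiK f Hf e e0; have K1 : 0 < K + 1 by rewrite ltr_wpDl.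
exists r, (e / (K + 1)); split=> //; first by rewrite divr_gt0.
move=> g Hg; rewrite ltr_pdivlMr// => gf; rewrite -functionalB//.
have Hgf : Hb A (g - f) by rewrite addrC -scaleN1r; exact: (Hb_lin Ac).
apply: (le_lt_trans (phiK _ Hgf)); apply: le_lt_trans gf.
rewrite mulrC ler_wpM2l ?lerDl//.
by have := Hb_seminorm_ge Ac 0 (ltW r0) (Hb_expands Ac Hgf); rewrite big_ord0.
Qed.

Hypothesis phiC : continuous_on (@Hb R A E) (Hb_seminorm A (E := E)) phi.

Lemma continuous_functional_bounded : exists K r : R, [/\ 0 <= K, 0 < r &
  forall f P w, expands B f P -> (forall n, \sum_(k < n) pnorm (B k) (P k) * r ^+ k <= w) ->
    rnorm (phi f) <= K * w].
Proof.
have [r [d [r0 d0 phid]]] := phiC (Hb0 Ac E) (@ltr01 R).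
exists d^-1, r; split=> //; first by rewrite invr_ge0 ltW.
move=> f P w fP Pw; rewrite ler_pdivlMl//; apply/ler_addgt0Pr => e e0.
have w0 : 0 <= w by have := Pw 0%N; rewrite big_ord0.
have we : 0 < w + e by rewrite ltr_wpDl.
(* w may vanish, whence e in the denominator. *)
pose t := d / (w + e); have t0 : 0 < t by rewrite divr_gt0.
have rt : rnorm (ofR t) = t by rewrite rnorm_ofR ger0_norm// ltW.
have := phid (ofR t *: f); rewrite subr0 functional0 subr0.
move=> /(_ (expands_Hb Ac (expandsZ (ofR t) fP))) H.
have {}H : rnorm (phi (ofR t *: f)) < 1.
  apply: H; apply: (@le_lt_trans _ _ (t * w)); last first.
    by rewrite /t mulrAC ltr_pdivrMr// ltr_pM2l// ltrDl.
  apply: (Hb_seminorm_le Ac (ltW r0) (expandsZ (ofR t) fP)) => n.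
  apply: le_trans (ler_wpM2l (ltW t0) (Pw n)); rewrite mulr_sumr.
  apply: ler_sum => k _; rewrite (ideal_normZ (BI k)) ?rt ?mulrA//.
  by case: fP.
move: H; rewrite functionalZ ?rnormM ?rt; last exact: expands_Hb fP.
rewrite /t mulrAC ltr_pdivrMr// mul1r => H; exact: ltW.
Qed.

Lemma functional_monomial K r : 0 <= r ->
  (forall f P w, expands B f P -> (forall n, \sum_(k < n) pnorm (B k) (P k) * r ^+ k <= w) ->
    rnorm (phi f) <= K * w) ->
  forall k p, B k E p -> rnorm (phi p) <= K * (r ^+ k * pnorm (B k) p).
Proof.
move=> r0 phiK k p Bp; apply: (phiK _ _ _ (expands_monomial BI Bp)) => n.
have p0 : 0 <= r ^+ k * pnorm (B k) p.
  by rewrite mulr_ge0 ?exprn_ge0//; exact: (pnorm_ge0 (BI k)).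
have H (i : 'I_n) : (i : nat) != k ->
    pnorm (B i) (if (i : nat) == k then p else 0) * r ^+ i = 0.
  by move=> /negbTE->; rewrite (pnorm0 (BI i)) mul0r.
have [kn|nk] := ltnP k n.
  rewrite (bigD1 (Ordinal kn))//= big1 => [|i ik].
    by rewrite addr0 eqxx mulrC.
  by apply: H; apply: contra ik => /eqP ik; apply/eqP/val_inj.
by rewrite big1// => i _; apply: H; rewrite neq_ltn (leq_trans (ltn_ord i)).
Qed.

(** Termwise evaluation of a functional on a triangular array: the sum of the rows
    from N on is again of bounded type, and its seminorms decrease rapidly in N. *)
Lemma functional_array f (D : nat -> nat -> E -> C) (u : nat -> R) :
  (forall k j, B j E (D k j)) -> (forall k j, pnorm (B j) (D k j) <= u k) ->
  rapid u -> (forall k j, (k < j)%N -> D k j = 0) ->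
  (forall x, csum (fun k => \sum_(j < k.+1) D k j x) (f x)) ->
  csum (fun k => \sum_(j < k.+1) phi (D k j)) (phi f).
Proof.
move=> BD Du ur D0 fD e e0.
have u0 k : 0 <= u k := le_trans (pnorm_ge0 (BI 0%N) (BD k 0%N)) (Du k 0%N).
have [K [r [K0 r0 phiK]]] := continuous_functional_bounded.
(* The factor q^j makes the seminorm of index r converge, what is left of u is still
   rapidly decreasing and gives e^N. *)
have [q [q0 q1 rq]] : exists q : R, [/\ 0 < q, q <= 1 & r * q <= 2^-1].
  have r1 : 0 < r + 1 by rewrite ltr_wpDl// ltW.
  exists (2 * (r + 1))^-1; split; first by rewrite invr_gt0 mulr_gt0.
    by rewrite invf_le1 ?mulr_gt0//; lra.
  by rewrite invfM mulrCA ler_piMr ?invr_ge0// ler_pdivrMr ?mul1r ?lerDl.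
pose v k := 1 * q^-1 ^+ k * u k.
have v0 k : 0 <= v k by rewrite /v mul1r mulr_ge0// exprn_ge0// invr_ge0 ltW.
have vr : rapid v by apply: rapidM_geom => //; rewrite invr_ge0 ltW.
have uv k : u k = q ^+ k * v k.
  by rewrite /v mul1r exprVn mulVKf// expf_neq0// lt0r_neq0.
have [L L0 vL] := rapid_tail v0 vr e0.
exists (K * (2 * L)) => N.
pose DN k j := if (k < N)%N then 0 else D k j.
pose uN k := if (k < N)%N then 0 else u k.
pose fN := f - \sum_(k < N) \sum_(j < k.+1) D k j.
have Hf : Hb A f.
  have [T [fT _ _ _]] := expands_array BI BD Du ur D0 fD.
  exact: expands_Hb fT.
have HD k j : Hb A (D k j) := Hb_ideal Ac (BD k j).
have HS k : Hb A (\sum_(j < k.+1) D k j) by apply: Hb_sum => j; exact: HD.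
have BDN k j : B j E (DN k j).
  by rewrite /DN; case: ifP => // _; exact: (ideal0 (BI j)).
have DuN k j : pnorm (B j) (DN k j) <= uN k.
  by rewrite /DN /uN; case: ifP => // _; rewrite (pnorm0 (BI j)).
have uNr : rapid uN by apply: (rapid_le ur) => k; rewrite /uN; case: ifP.
have DN0 k j : (k < j)%N -> DN k j = 0 by move=> kj; rewrite /DN D0// if_same.
have fND x : csum (fun k => \sum_(j < k.+1) DN k j x) (fN x).
  pose b k := if (k < N)%N then \sum_(j < k.+1) D k j x else 0.
  have bs : csum b (\sum_(k < N) b k).
    by apply: csum_finite => k Nk; rewrite /b ltnNge Nk.
  have := csum_lin (-1) bs (fD x); congr (csum _ _).
    apply/funext => k; rewrite /b /DN; case: ifP => _; rewrite mulN1r.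
      by rewrite addNr big1.
    by rewrite oppr0 add0r.
  rewrite mulN1r addrC -[RHS]/(f x - (\sum_(k < N) \sum_(j < k.+1) D k j) x).
  congr (_ - _); rewrite fct_sum_apply; apply: eq_bigr => k _.
  by rewrite /b ltn_ord fct_sum_apply.
have [T [fT _ _ TwN]] := expands_array BI BDN DuN uNr DN0 fND.
have phi_fN : phi fN = phi f - \sum_(k < N) \sum_(j < k.+1) phi (D k j).
  apply: (etrans (functionalB Hf (Hb_sum _ (fun k : 'I_N => HS k)))); congr (_ - _).
  apply: (etrans (functional_sum _ (fun k : 'I_N => HS k))); apply: eq_bigr => k _.
  exact: (functional_sum _ (fun j : 'I_k.+1 => HD k j)).
rewrite -opprB -phi_fN.
rewrite rnormN -!mulrA; apply: (phiK _ _ _ fT) => n.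
apply: (@le_trans _ _ (\sum_(j < n) L * e ^+ N * (r * q) ^+ j)).
  apply: ler_sum => j _; rewrite exprMn mulrCA mulrC ler_wpM2l ?exprn_ge0 ?(ltW r0)//.
  apply: TwN => m; rewrite mulrC.
  apply: (@le_trans _ _ (q ^+ j * \sum_(N <= k < m) v k)); last first.
    by rewrite ler_wpM2l// exprn_ge0// ltW.
  rewrite mulr_sumr; have [mN|/ltnW Nm] := leqP m N.
    rewrite [leRHS]big_geq// big_nat_cond big1// => k /andP[/andP[_ km] _].
    by rewrite /uN (leq_trans km mN).
  apply: (@le_trans _ _ (\sum_(0 <= k < m) if (j <= k)%N then uN k else 0)).
    have [mj|/ltnW jm] := leqP m j.
      rewrite [leLHS]big_geq// sumr_ge0// => k _.
      by rewrite /uN; do 2 case: ifP => // _.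
    rewrite [leRHS](big_cat_nat (leq0n j) jm)/= -[leLHS]add0r lerD//.
      by apply: sumr_ge0 => k _; rewrite /uN; do 2 case: ifP => // _.
    by rewrite [leLHS]big_nat [leRHS]big_nat; apply: ler_sum => k /andP[-> _].
  rewrite [leLHS](big_cat_nat (leq0n N) Nm)/= [X in X + _]big_nat big1 => [|k /andP[_ kN]]; last first.
    by rewrite /uN kN if_same.
  rewrite add0r.
  rewrite [leLHS]big_nat [leRHS]big_nat; apply: ler_sum => k /andP[Nk _].
  rewrite /uN ltnNge Nk/=; case: ifP => jk; last first.
    by rewrite mulr_ge0 ?exprn_ge0 ?(ltW q0).
  by rewrite uv ler_wpM2r// ler_wiXn2l// ltW.
rewrite -mulr_sumr mulrC ler_wpM2r ?mulr_ge0 ?exprn_ge0 ?(ltW e0)//.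
by apply: geom_sum_le2 => //; rewrite mulr_ge0// ltW.
Qed.

End one_functional.
End functionals.

(** * Aron-Berner extension of polynomials in the ideals *)

Section aron_berner_ideals.
Variables (R : realType) (A : nat -> polyclass R) (E : banachType R).
Hypotheses (Ac : coherent A) (A_reg : regular_at A E).
Local Notation C := (cplx R).
Local Notation B := (with_constants A).
Local Notation J := (@bidual_embed R E).
Let BI := with_constants_ideal Ac.

Lemma ideal_arens_regular k (P : E -> C) : B k E P -> arens_regular k P.
Proof.
move=> BP; split; first exact: (ideal_hpoly (BI k)).
  have [c c1 Bc] := with_constants_partial Ac.
  have PM := polar_bounded BI c1 Bc BP; exists (c ^+ k * pnorm (B k) P) => //.
  by rewrite mulr_ge0 ?exprn_ge0 ?(le_trans ler01 c1)//; exact: (pnorm_ge0 (BI k)).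
case: k BP => [|k] BP; last exact: (A_reg (k := k.+1)).
by move=> s D _ t x; congr D; exact: ord0_fun_eq.
Qed.

Lemma aron_berner_embed k (P : E -> C) x : B k E P -> aron_berner k P (J x) = P x.
Proof.
move=> BP; have Pr := ideal_arens_regular BP.
have [D [_ _ _ DJ ->]] := aron_berner_form Pr.
have [Ph _ _] := Pr; have [_ _ <-] := hpoly_polar Ph.
exact: (DJ (fun=> x)).
Qed.

Lemma aron_berner_lin k (c : C) (P Q : E -> C) z : B k E P -> B k E Q ->
  aron_berner k (c *: P + Q) z = c * aron_berner k P z + aron_berner k Q z.
Proof.
move=> BP BQ; have [D [Dm _ Dw _ DE]] := aron_berner_form (ideal_arens_regular BP).
have [F [Fm _ Fw _ FE]] := aron_berner_form (ideal_arens_regular BQ).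
rewrite (@aron_bernerE _ _ _ _ (fun z => c * D z + F z)).
- by rewrite DE FE.
- exact: (ideal_arens_regular (ideal_lin (BI k) c BP BQ)).
- exact: multilinear_lin.
- by move=> i y; apply: weak_star_lin; [exact: Dw|exact: Fw].
- by move=> x; rewrite -DE -FE !aron_berner_embed.
Qed.

Lemma aron_berner0 k z : aron_berner k (0 : E -> C) z = 0.
Proof.
rewrite (@aron_bernerE _ _ _ _ (fun=> 0))//.
- exact: (ideal_arens_regular (ideal0 (BI k) E)).
- by move=> x i a u v; rewrite scaler0 addr0.
- by move=> i y; exact: weak_star_cst.
Qed.

Lemma aron_berner_sum k I (r : seq I) (F : I -> E -> C) z : (forall i, B k E (F i)) ->
  aron_berner k (\sum_(i <- r) F i) z = \sum_(i <- r) aron_berner k (F i) z.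
Proof.
move=> BF; elim: r => [|i r IH]; first by rewrite !big_nil aron_berner0.
rewrite !big_cons -IH -(scale1r (F i)).
apply: (etrans (aron_berner_lin 1 z (BF i) (ideal_sumr (BI k) r (fun i _ => BF i)))).
by rewrite scale1r mul1r.
Qed.

(** A form with the diagonal of a product of polynomials. *)
Definition tensor k l (D : ('I_k -> bidual E) -> C) (F : ('I_l -> bidual E) -> C)
    (z : 'I_(k + l) -> bidual E) : C :=
  D (z \o lshift l) * F (z \o @rshift k l).

Lemma tensor_updl k l (z : 'I_(k + l) -> bidual E) i w :
  (upd z (lshift l i) w \o lshift l = upd (z \o lshift l) i w) /\
  (upd z (lshift l i) w \o @rshift k l = z \o @rshift k l).
Proof.
split; apply/funext => j; rewrite /upd/=; first by rewrite (inj_eq (@lshift_inj _ _)).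
by rewrite eq_rlshift.
Qed.

Lemma tensor_updr k l (z : 'I_(k + l) -> bidual E) i w :
  (upd z (rshift k i) w \o lshift l = z \o lshift l) /\
  (upd z (rshift k i) w \o @rshift k l = upd (z \o @rshift k l) i w).
Proof.
split; apply/funext => j; rewrite /upd/=; last by rewrite (inj_eq (@rshift_inj _ _)).
by rewrite eq_lrshift.
Qed.

Lemma aron_berner_mul k l (P Q : E -> C) z : B k E P -> B l E Q ->
  B (k + l) E (P \* Q) ->
  aron_berner (k + l) (P \* Q) z = aron_berner k P z * aron_berner l Q z.
Proof.
move=> BP BQ BPQ; have [D [Dm _ Dw _ DE]] := aron_berner_form (ideal_arens_regular BP).
have [F [Fm _ Fw _ FE]] := aron_berner_form (ideal_arens_regular BQ).
rewrite (aron_bernerE (B := tensor D F) (ideal_arens_regular BPQ)).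
- by rewrite DE FE.
- move=> y i a u v; rewrite /tensor; case: (splitP i) => j ij.
    have -> : i = lshift l j by apply: val_inj.
    by rewrite !(tensor_updl _ _ _).1 !(tensor_updl _ _ _).2 Dm mulrDl -scalerAl.
  have -> : i = rshift k j by apply: val_inj.
  by rewrite !(tensor_updr _ _ _).1 !(tensor_updr _ _ _).2 Fm mulrDr -scalerAr.
- move=> i y; rewrite /tensor; case: (splitP i) => j ij.
    have -> : i = lshift l j by apply: val_inj.
    rewrite (_ : (fun w => _) = fun w => F (y \o @rshift k l) * D (upd (y \o lshift l) j w) + 0).
      by apply: weak_star_lin; [exact: Dw|exact: weak_star_cst].
    by apply/funext => w; rewrite (tensor_updl _ _ _).1 (tensor_updl _ _ _).2 addr0 mulrC.
  have -> : i = rshift k j by apply: val_inj.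
  rewrite (_ : (fun w => _) = fun w => D (y \o lshift l) * F (upd (y \o @rshift k l) j w) + 0).
    by apply: weak_star_lin; [exact: Fw|exact: weak_star_cst].
  by apply/funext => w; rewrite (tensor_updr _ _ _).1 (tensor_updr _ _ _).2 addr0.
- by move=> x; rewrite /tensor -DE -FE !aron_berner_embed.
Qed.

(** In degree 0 the extension of a constant is that constant. *)
Lemma with_constants_AB : AB_closed A ->
  exists2 alpha : R, 1 <= alpha & forall k (P : E -> C), B k E P ->
    B k (bidual E) (aron_berner k P) /\
    pnorm (B k) (aron_berner k P : bidual E -> C) <= alpha ^+ k * pnorm (B k) P.
Proof.
move=> [al al0 AB]; exists (1 + al); first by rewrite lerDl ltW.
move=> [|k] P BP.
  have [c PE] := BP.
  have -> : aron_berner 0 P = fun=> c.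
    apply/funext => z; rewrite (@aron_bernerE _ _ _ _ (fun=> c) (ideal_arens_regular BP))//.
    - by move=> x [].
    - by move=> i y; exact: weak_star_cst.
    - by move=> x; rewrite PE.
  by rewrite expr0 mul1r PE; split=> //; exists c.
have [H1 H2] := AB E k.+1 P isT BP; split=> //; apply: (le_trans H2).
rewrite ler_wpM2r ?(pnorm_ge0 (BI k.+1) BP)//.
by rewrite lerXn2r ?nnegrE ?addr_ge0 ?(ltW al0)// lerDr.
Qed.

Hypothesis A_AB : forall k (P : E -> C), B k E P -> B k (bidual E) (aron_berner k P).

Lemma partial_embed_ideal k i (P : E -> C) (z : bidual E) : (i <= k)%N -> B k E P ->
  B (k - i) E (partial_poly k i (aron_berner k P) z \o J).
Proof.
move=> ik BP; have [c c1 Bc] := with_constants_partial Ac.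
have [H _] := partial_poly_ideal BI c1 Bc z ik (A_AB BP).
exact: (ideal_comp_contraction (BI (k - i)%N) (@bidual_embed_linear R E)
  (@rnorm_bidual_embed R E) H).1.
Qed.

Lemma aron_berner_partial1 k (P : E -> C) (z : bidual E) : B k.+1 E P ->
  aron_berner k (partial_poly k.+1 1 (aron_berner k.+1 P) z \o J) =
  partial_poly k.+1 1 (aron_berner k.+1 P) z.
Proof.
move=> BP; have [D [Dm Ds Dw _ DE]] := aron_berner_form (ideal_arens_regular BP).
have Dpol : is_polar (aron_berner k.+1 P) D by split=> // y; rewrite DE.
have [Dzm _ DzE] := is_polar_fcons z Dpol.
have BPz := partial_embed_ideal z (isT : (1 <= k.+1)%N) BP; rewrite subn1 in BPz.
apply/funext => y; rewrite -DzE.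
rewrite (aron_bernerE (B := fun y => D (fcons z y)) (ideal_arens_regular BPz))//.
move=> i u; rewrite (_ : (fun w => _) = fun w => D (upd (fcons z u) (lift ord0 i) w)).
  exact: Dw.
by apply/funext => w; rewrite upd_fconsS.
Qed.

(** A separately weak-star continuous form stays one when some of its variables are
    frozen at a point of the bidual, so it still computes the extension in the others. *)
Lemma aron_berner_partial k i (P : E -> C) (z : bidual E) : (i <= k)%N -> B k E P ->
  aron_berner (k - i) (partial_poly k i (aron_berner k P) z \o J) =
  partial_poly k i (aron_berner k P) z.
Proof.
elim: i k P => [|i IH] k P.
  move=> _ BP; rewrite subn0 partial_poly0; last exact: (ideal_hpoly (BI k) (A_AB BP)).
  congr aron_berner; apply/funext => x; exact: aron_berner_embed.
case: k P => // k P ik BP; rewrite subSS.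
have BPz := partial_embed_ideal z (isT : (1 <= k.+1)%N) BP; rewrite subn1 in BPz.
rewrite partial_polyS; last exact: (ideal_hpoly (BI k.+1) (A_AB BP)).
rewrite -(aron_berner_partial1 z BP); exact: IH.
Qed.

End aron_berner_ideals.

(** * Translation by elements of the bidual *)

Section translations.
Variables (R : realType) (A : nat -> polyclass R) (E : banachType R).
Hypotheses (A_mult : multiplicative_seq A) (A_AB : AB_closed A) (A_reg : regular_at A E).
Local Notation C := (cplx R).
Local Notation B := (with_constants A).
Local Notation J := (@bidual_embed R E).
Let Ac : coherent A := A_mult.1.
Let BI := with_constants_ideal Ac.
Implicit Types (f g : E -> C) (P Q : nat -> E -> C) (z w : bidual E).

Lemma aron_berner_ideal k (p : E -> C) : B k E p -> B k (bidual E) (aron_berner k p).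
Proof.
by move=> Bp; have [al _ AB] := with_constants_AB Ac A_reg A_AB; case: (AB k p Bp).
Qed.

Lemma aron_berner_rapid P : (forall k, B k E (P k)) -> rapid (fun k => pnorm (B k) (P k)) ->
  rapid (fun k => pnorm (B k) (aron_berner k (P k) : bidual E -> C)).
Proof.
move=> BP Pr; have [al al1 AB] := with_constants_AB Ac A_reg A_AB.
apply: (rapid_le (rapidM_geom ler01 (le_trans ler01 al1) Pr)) => k.
by rewrite mul1r; case: (AB k _ (BP k)).
Qed.

Lemma aron_berner_funP f P z : expands B f P ->
  csum (fun k => aron_berner k (P k) z) (aron_berner_fun f z).
Proof.
move=> fP; have [BP Pr _] := fP.
have ABr := pnorm_eval_rapid BI z (fun k => aron_berner_ideal (BP k)) (aron_berner_rapid BP Pr).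
have [l Pl] := csum_exists (fun k => lexx _) ABr.
rewrite /aron_berner_fun (expands_taylor Ac fP).
by rewrite (csum_lim Pl).
Qed.

Lemma aron_berner_fun_embed f x : Hb A f -> aron_berner_fun f (J x) = f x.
Proof.
move=> /(Hb_expands Ac) fP; have [BP _ fx] := fP.
apply: (csum_unique (aron_berner_funP (J x) fP)).
by under eq_fun do rewrite (aron_berner_embed Ac A_reg _ (BP _)); exact: fx.
Qed.

Definition tau_array z P k j : E -> C :=
  affine_array J z (fun k => aron_berner k (P k)) k j.

Lemma tau_array_ideal z P k j : (forall k, B k E (P k)) -> B j E (tau_array z P k j).
Proof.
move=> BP; have [c c1 Bc] := with_constants_partial Ac.
exact: (affine_array_ideal BI c1 Bc z (@bidual_embed_linear R E)
  (@rnorm_bidual_embed R E) (fun k => aron_berner_ideal (BP k))).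
Qed.

Lemma tau_array_triangular z P k j : (k < j)%N -> tau_array z P k j = 0.
Proof. exact: affine_array_triangular. Qed.

Lemma tau_array_bounded z : exists2 b : R, 0 <= b &
  forall P, (forall k, B k E (P k)) -> forall k j,
    pnorm (B j) (tau_array z P k j) <= b ^+ k * pnorm (B k) (P k).
Proof.
have [c c1 Bc] := with_constants_partial Ac.
have [al al1 AB] := with_constants_AB Ac A_reg A_AB.
have z1 : 0 <= 2 * (c * (1 + rnorm z)).
  by rewrite !mulr_ge0 ?addr_ge0 ?rnorm_ge0 ?(le_trans ler01 c1).
exists (2 * (c * (1 + rnorm z)) * al); first by rewrite mulr_ge0 ?(le_trans ler01 al1).
move=> P BP k j; have BAB i : B i (bidual E) (aron_berner i (P i)) by exact: aron_berner_ideal.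
apply: (le_trans (affine_array_le BI c1 Bc z (@bidual_embed_linear R E)
    (@rnorm_bidual_embed R E) BAB k j)).
by rewrite [(_ * al) ^+ k]exprMn -mulrA ler_wpM2l ?exprn_ge0//; case: (AB k _ (BP k)).
Qed.

Lemma tau_array_sum z P k x : (forall k, B k E (P k)) ->
  \sum_(j < k.+1) tau_array z P k j x = aron_berner k (P k) (z + J x).
Proof.
move=> BP; exact: (affine_array_sum BI J z (fun k => aron_berner_ideal (BP k))).
Qed.

Lemma tau_array_csum z f P x : expands B f P ->
  csum (fun k => \sum_(j < k.+1) tau_array z P k j x) (tau z f x).
Proof.
move=> fP; have := aron_berner_funP (z + J x) fP; congr (csum _ _).
by apply/funext => k; rewrite tau_array_sum//; case: fP.
Qed.

Lemma tau_expands z f P : expands B f P ->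
  exists T, [/\ expands B (tau z f) T, forall j x, csum (fun k => tau_array z P k j x) (T j x) &
    forall j, rapid (fun n => pnorm (B j) (T j - \sum_(k < n) tau_array z P k j))].
Proof.
move=> fP; have [BP Pr _] := fP; have [b b0 Db] := tau_array_bounded z.
have [T [H1 H2 H3 _]] := expands_array BI (fun k j => tau_array_ideal z k j BP) (Db P BP)
  (rapid_geom b0 Pr) (tau_array_triangular z P) (fun x => tau_array_csum z x fP).
by exists T.
Qed.

Lemma tau_Hb z f : Hb A f -> Hb A (tau z f).
Proof.
by move=> /(Hb_expands Ac)/(tau_expands z)[T [fT _ _]]; exact: expands_Hb fT.
Qed.

Lemma aron_berner_fun_lin (c : C) f g z : Hb A f -> Hb A g ->
  aron_berner_fun (c *: f + g) z = c * aron_berner_fun f z + aron_berner_fun g z.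
Proof.
move=> /(Hb_expands Ac) fP /(Hb_expands Ac) gQ.
have [BP _ _] := fP; have [BQ _ _] := gQ.
apply: (csum_unique (aron_berner_funP z (expands_lin BI c fP gQ))).
have := csum_lin c (aron_berner_funP z fP) (aron_berner_funP z gQ).
congr (csum _ _); apply/funext => k.
by rewrite (aron_berner_lin Ac A_reg c z (BP k) (BQ k)).
Qed.

Lemma Hb_mul f g : Hb A f -> Hb A g -> Hb A (f \* g).
Proof.
move=> /(Hb_expands Ac) fP /(Hb_expands Ac) gQ.
have [M M1 BM] := with_constants_mul A_mult.
exact: (expands_Hb Ac (expands_mul BI M1 (@BM E) fP gQ)).
Qed.

Lemma aron_berner_fun_mul f g z : Hb A f -> Hb A g ->
  aron_berner_fun (f \* g) z = aron_berner_fun f z * aron_berner_fun g z.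
Proof.
move=> /(Hb_expands Ac) fP /(Hb_expands Ac) gQ.
have [BP Pr _] := fP; have [BQ Qr _] := gQ.
have [M M1 BM] := with_constants_mul A_mult.
apply: (csum_unique (aron_berner_funP z (expands_mul BI M1 (@BM E) fP gQ))).
have Pz := pnorm_eval_rapid BI z (fun k => aron_berner_ideal (BP k)) (aron_berner_rapid BP Pr).
have Qz := pnorm_eval_rapid BI z (fun k => aron_berner_ideal (BQ k)) (aron_berner_rapid BQ Qr).
have := csum_cauchy_product (fun k => lexx _) (fun k => lexx _) Pz Qz
  (aron_berner_funP z fP) (aron_berner_funP z gQ).
congr (csum _ _); apply/funext => n.
have BPQ (i : 'I_n.+1) : B n E (taylor f i \* taylor g (n - i)%N).
  by have [] := BM E i (n - i)%N _ _ (BP i) (BQ (n - i)%N); rewrite subnKC// -ltnS.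
apply: esym; apply: (etrans (aron_berner_sum Ac A_reg _ z BPQ)).
apply: eq_bigr => i _; have le_in : (i <= n)%N by rewrite -ltnS.
have := @aron_berner_mul R A E Ac A_reg i (n - i)%N _ _ z (BP i) (BQ (n - i)%N).
by rewrite subnKC//; apply.
Qed.

Lemma tau_lin z (c : C) f g : Hb A f -> Hb A g ->
  tau z (c *: f + g) = c *: tau z f + tau z g.
Proof. by move=> Hf Hg; apply/funext => x; exact: aron_berner_fun_lin. Qed.

Lemma tau_mul z f g : Hb A f -> Hb A g -> tau z (f \* g) = tau z f \* tau z g.
Proof. by move=> Hf Hg; apply/funext => x; exact: aron_berner_fun_mul. Qed.

Lemma tau0 f : Hb A f -> tau 0 f = f.
Proof.
by move=> Hf; apply/funext => x; rewrite /tau add0r aron_berner_fun_embed.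
Qed.

Lemma tau_cst z (c : C) : tau z (fun=> c) = (fun=> c) :> (E -> C).
Proof.
have Bc : B 0 E (fun=> c) by exists c.
apply/funext => x; rewrite /tau.
apply: (csum_unique (aron_berner_funP (z + J x) (expands_monomial BI Bc))).
pose p k : E -> C := if k == 0%N then fun=> c else 0.
have := @csum_finite _ (fun k => aron_berner k (p k) (z + J x)) 1.
rewrite big_ord_recl big_ord0 addr0/=.
rewrite (@aron_bernerE _ _ _ _ (fun=> c) (ideal_arens_regular Ac A_reg Bc))//.
- by apply=> -[//|k] _; exact: (aron_berner0 Ac A_reg).
- by move=> y [].
- by move=> i y; exact: weak_star_cst.
Qed.

Lemma dual_ideal (g : dual E) : B 1 E g /\ pnorm (B 1%N) (g : E -> C) <= rnorm g.
Proof.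
have [Bp p1] := ideal_pow (BI 1%N).
have [] := ideal_comp (BI 1%N) (@dual_linear _ _ g) (@dual_continuous _ _ g) Bp.
by rewrite p1 mul1r expr1.
Qed.

Lemma tau_dual z (g : dual E) : tau z g = (fun=> z g) + (g : E -> C).
Proof.
have [Bg _] := dual_ideal g.
apply/funext => x; rewrite /tau.
apply: (csum_unique (aron_berner_funP (z + J x) (expands_monomial BI Bg))).
pose p k : E -> C := if k == 1%N then g : E -> C else 0.
have := @csum_finite _ (fun k => aron_berner k (p k) (z + J x)) 2.
rewrite big_ord_recl big_ord_recl big_ord0 addr0/= (aron_berner0 Ac A_reg) add0r.
rewrite (@aron_bernerE _ _ _ _ (fun y => y ord0 g) (ideal_arens_regular Ac A_reg Bg))//.
- by apply=> -[|[//|k]] _ //; exact: (aron_berner0 Ac A_reg).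
- by move=> y i a u v; rewrite /upd/= (ord1 i) eqxx.
- move=> i y; rewrite (_ : (fun w => _) = fun w : bidual E => w g).
    exact: weak_star_eval.
  by apply/funext => w; rewrite /upd (ord1 i) eqxx.
Qed.

(** The homogeneous components of tau w f extend to those of AB f translated by w;
    both sides are sums of the same array, and the extension is continuous in norm. *)
Lemma aron_berner_fun_tau w f u : Hb A f ->
  aron_berner_fun (tau w f) u = aron_berner_fun f (w + u).
Proof.
move=> /(Hb_expands Ac) fP; have [BP Pr _] := fP.
have [T [fT TD Tr]] := tau_expands w fP; have [BT _ _] := fT.
have BAB k : B k (bidual E) (aron_berner k (taylor f k)) by exact: aron_berner_ideal.
have [c c1 Bc] := with_constants_partial Ac.
have BD k j := tau_array_ideal w k j BP.
have [] := @expands_affine _ _ BI _ c1 Bc _ _ id w _ (fun _ _ _ => erefl)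
  (fun x => lexx _) BAB (aron_berner_rapid BP Pr) (fun u => aron_berner_fun f (w + u)).
  by move=> v; exact: aron_berner_funP.
move=> H [[BH _ fH] HD _].
have ABD k j : aron_berner j (tau_array w (taylor f) k j) =
    affine_array id w (fun k => aron_berner k (taylor f k)) k j.
  rewrite /tau_array /affine_array; case: leqP => jk; last first.
    by apply/funext => v; exact: (aron_berner0 Ac A_reg).
  have := partial_embed_ideal Ac aron_berner_ideal w (leq_subr j k) (BP k).
  rewrite subKn// => BPk; apply/funext => v; rewrite -(addr0 ('C(k, j)%:R *: _)).
  apply: (etrans (aron_berner_lin Ac A_reg _ v BPk (ideal0 (BI j) E))).
  rewrite (aron_berner0 Ac A_reg) addr0.
  have := aron_berner_partial Ac A_reg aron_berner_ideal w (leq_subr j k) (BP k).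
  by rewrite subKn// => ->.
have TH j : aron_berner j (T j) u = H j u.
  apply: csum_unique (HD j u).
  have [al al1 AB] := with_constants_AB Ac A_reg A_AB.
  have r0 : 0 <= al ^+ j * rnorm u ^+ j.
    by rewrite mulr_ge0 ?exprn_ge0 ?rnorm_ge0 ?(le_trans ler01 al1).
  apply: (rapid_le (rapidZ r0 (Tr j))) => n.
  have BS : B j E (\sum_(k < n) tau_array w (taylor f) k j).
    by apply: (ideal_sumr (BI j)) => k _.
  have BTS := ideal_sub (BI j) (BT j) BS.
  (* AB is linear and bounded in the ideal norm, so it can be applied to the remainder. *)
  have -> : \sum_(k < n) affine_array id w (fun k => aron_berner k (taylor f k)) k j u -
      aron_berner j (T j) u = - aron_berner j (T j - \sum_(k < n) tau_array w (taylor f) k j) u.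
    have := aron_berner_lin Ac A_reg (-1) u BS (BT j).
    rewrite scaleN1r (addrC (- _)) => ->; rewrite mulN1r opprD opprK.
    congr (_ - _); rewrite (aron_berner_sum Ac A_reg _ u (fun k : 'I_n => BD k j)).
    by apply: eq_bigr => k _; rewrite ABD.
  rewrite rnormN; apply: (le_trans (rnorm_eval_le (BI j) u (aron_berner_ideal BTS))).
  rewrite mulrAC ler_wpM2r ?exprn_ge0 ?rnorm_ge0//.
  by case: (AB j _ BTS).
apply: (csum_unique (aron_berner_funP u fT)).
by under eq_fun do rewrite TH; exact: fH.
Qed.

(** The group law, on which the description of the orbits rests. *)
Lemma tau_tau z w f : Hb A f -> tau z (tau w f) = tau (w + z) f.
Proof.
by move=> Hf; apply/funext => x; rewrite /tau aron_berner_fun_tau// addrA.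
Qed.

End translations.

(** * The spectrum *)

Section spectrum_translations.
Variables (R : realType) (A : nat -> polyclass R) (E : banachType R).
Hypotheses (A_mult : multiplicative_seq A) (A_AB : AB_closed A) (A_reg : regular_at A E).
Local Notation C := (cplx R).
Local Notation B := (with_constants A).
Local Notation J := (@bidual_embed R E).
Let Ac : coherent A := A_mult.1.
Let BI := with_constants_ideal Ac.
Implicit Types (f g : E -> C) (phi psi : spectrum A E) (z w : bidual E).

Lemma spectrumP phi : is_character A phi.
Proof. by case: phi. Qed.

Lemma spectrum_eq phi psi : (forall f, Hb A f -> phi f = psi f) -> phi = psi.
Proof.
move=> pq; have {pq} : (phi : (E -> C) -> C) = psi.
  apply/funext => f; have [/pq//|nf] := pselect (Hb A f).
  by rewrite (char_out (spectrumP phi) nf) (char_out (spectrumP psi) nf).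
case: phi psi => p pP [q qP] /= pq; subst q; congr Spectrum; exact: Prop_irrelevance.
Qed.

Lemma Hb_cst (c : C) : @Hb R A E (fun=> c).
Proof. by apply: (Hb_ideal Ac (k := 0%N)); exists c. Qed.

Lemma Hb_dual (g : dual E) : Hb A (g : E -> C).
Proof. exact: (Hb_ideal Ac (dual_ideal A_mult g).1). Qed.

Lemma spectrum_cst phi (c : C) : phi (fun=> c) = c.
Proof.
have [f Hf f0] := char_nonzero (spectrumP phi).
have one : phi (fun=> 1) = 1.
  have := char_mul (spectrumP phi) Hf (Hb_cst 1).
  rewrite (_ : f \* _ = f); last by apply/funext => x /=; rewrite mulr1.
  by move=> H; apply: (mulfI (_ : phi f != 0)); [exact/eqP|rewrite mulr1 -H].
rewrite (_ : (fun=> c) = c *: (fun=> 1 : C)); last first.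
  by apply/funext => x; rewrite -[RHS]/(c * 1) mulr1.
by rewrite (functionalZ Ac (char_linear (spectrumP phi)) c (Hb_cst 1)) one mulr1.
Qed.

Lemma spectrum_bounded phi : exists K r : R, [/\ 0 <= K, 0 < r &
  forall k p, B k E p -> rnorm (phi p) <= K * (r ^+ k * pnorm (B k) p)].
Proof.
have [K [r [K0 r0 phiK]]] := continuous_functional_bounded Ac
  (char_linear (spectrumP phi)) (char_continuous (spectrumP phi)).
exists K, r; split=> // k p Bp; exact: (functional_monomial Ac (ltW r0) phiK Bp).
Qed.

Lemma spectrum_tau phi z f P : expands B f P ->
  csum (fun k => \sum_(j < k.+1) phi (tau_array z P k j)) (phi (tau z f)).
Proof.
move=> fP; have [BP Pr _] := fP.
have [b b0 Db] := tau_array_bounded A_mult A_AB A_reg z.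
exact: (functional_array Ac (char_linear (spectrumP phi)) (char_continuous (spectrumP phi))
  (fun k j => tau_array_ideal A_mult A_AB A_reg z k j BP) (Db P BP)
  (rapid_geom b0 Pr) (tau_array_triangular z P) (fun x => tau_array_csum A_mult A_AB A_reg z x fP)).
Qed.

Lemma spectrum_tau_bounded phi z : exists K r : R, [/\ 0 <= K, 0 < r &
  forall f, Hb A f -> rnorm (phi (tau z f)) <= K * Hb_seminorm A r f].
Proof.
have [K [r [K0 r0 phiK]]] := spectrum_bounded phi.
have [b b0 Db] := tau_array_bounded A_mult A_AB A_reg z.
pose q := 2 * ((1 + r) * (1 + b)).
have q0 : 0 < q.
  by rewrite /q !mulr_gt0// ltr_pwDl// ltW.
exists K, q; split=> // f /(Hb_expands Ac) fP; have [BP Pr _] := fP.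
have P0 k : 0 <= pnorm (B k) (taylor f k) := pnorm_ge0 (BI k) (BP k).
apply: (csum_norm_le (u := fun k => K * (pnorm (B k) (taylor f k) * q ^+ k)) _ _
  (spectrum_tau phi z fP)) => [k|m]; last first.
  by rewrite -mulr_sumr ler_wpM2l// (Hb_seminorm_ge Ac _ (ltW q0) fP).
apply: (le_trans (ler_rnorm_sum _ _ _)).
apply: (@le_trans _ _ (\sum_(j < k.+1) K * ((1 + r) ^+ k * (b ^+ k * pnorm (B k) (taylor f k))))).
  apply: ler_sum => j _; have jk : (j <= k)%N by rewrite -ltnS.
  have BD := tau_array_ideal A_mult A_AB A_reg z k j BP.
  apply: (le_trans (phiK _ _ BD)); rewrite ler_wpM2l//.
  apply: ler_pM; [exact: exprn_ge0 (ltW r0)|exact: (pnorm_ge0 (BI j) BD)| |exact: Db].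
  apply: (@le_trans _ _ ((1 + r) ^+ j)).
    by rewrite lerXn2r ?nnegrE ?addr_ge0 ?(ltW r0)// lerDr.
  by rewrite ler_weXn2l// lerDl ltW.
rewrite sumr_const card_ord -mulr_natl mulrCA ler_wpM2l// mulrC.
rewrite /q !exprMn mulrC [leRHS]mulrC -!mulrA ler_pM//.
- by rewrite !mulr_ge0 ?exprn_ge0 ?addr_ge0 ?(ltW r0).
- exact: natr_le_exp2.
rewrite ler_wpM2l ?exprn_ge0 ?addr_ge0 ?(ltW r0)// ler_wpM2r//.
by rewrite lerXn2r ?nnegrE ?addr_ge0// lerDr.
Qed.

(** phi \o tau z, with the value 0 outside the algebra as the type of characters
    demands. *)
Definition spectrum_shift_fun phi z : (E -> C) -> C :=
  fun f => if `[< Hb A f >] then phi (tau z f) else 0.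

Lemma spectrum_shift_funE phi z f : Hb A f -> spectrum_shift_fun phi z f = phi (tau z f).
Proof. by move=> Hf; rewrite /spectrum_shift_fun asboolT. Qed.

Lemma spectrum_shift_character phi z : is_character A (spectrum_shift_fun phi z).
Proof.
have [pL pM] := (char_linear (spectrumP phi), char_mul (spectrumP phi)).
have sL : linear_on (@Hb R A E) (spectrum_shift_fun phi z).
  move=> c f g Hf Hg; have Hcfg := Hb_lin Ac c Hf Hg.
  rewrite (spectrum_shift_funE _ _ Hf) (spectrum_shift_funE _ _ Hg).
  apply: (etrans (spectrum_shift_funE _ _ Hcfg)).
  apply: (etrans (congr1 phi (tau_lin A_mult A_AB A_reg z c Hf Hg))).
  by apply: pL; apply: (tau_Hb A_mult A_AB A_reg).
split=> //.
- by move=> f nf; rewrite /spectrum_shift_fun asboolF.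
- move=> f g Hf Hg; rewrite (spectrum_shift_funE _ _ Hf) (spectrum_shift_funE _ _ Hg).
  apply: (etrans (spectrum_shift_funE _ _ (Hb_mul A_mult Hf Hg))).
  apply: (etrans (congr1 phi (tau_mul A_mult A_AB A_reg z Hf Hg))).
  by apply: pM; apply: (tau_Hb A_mult A_AB A_reg).
- have [K [r [K0 r0 phiK]]] := spectrum_tau_bounded phi z.
  apply: (bounded_functional_continuous Ac sL K0 r0) => f Hf.
  by rewrite spectrum_shift_funE//; exact: phiK.
- exists (fun=> 1); first exact: Hb_cst.
  rewrite (spectrum_shift_funE _ _ (Hb_cst 1)) (tau_cst A_mult A_AB A_reg) spectrum_cst.
  by apply/eqP; exact: oner_neq0.
Qed.

Definition spectrum_shift phi z : spectrum A E := Spectrum (spectrum_shift_character phi z).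

Lemma spectrum_shiftE phi z f : Hb A f -> spectrum_shift phi z f = phi (tau z f).
Proof. exact: spectrum_shift_funE. Qed.

Lemma spectrum_shiftD phi z w :
  spectrum_shift (spectrum_shift phi z) w = spectrum_shift phi (z + w).
Proof.
apply: spectrum_eq => f Hf; apply: (etrans (spectrum_shiftE _ w Hf)).
apply: (etrans (spectrum_shiftE phi z (tau_Hb A_mult A_AB A_reg w Hf))).
rewrite (tau_tau A_mult A_AB A_reg z w Hf) (addrC w).
exact: (esym (spectrum_shiftE phi _ Hf)).
Qed.

Lemma spectrum_shift0 phi : spectrum_shift phi 0 = phi.
Proof.
by apply: spectrum_eq => f Hf; rewrite spectrum_shiftE// (tau0 A_mult A_AB A_reg).
Qed.

Lemma basic_nbhsE phi (e : R) :
  basic_nbhs phi e = [set spectrum_shift phi z | z in [set z | rnorm z < e]].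
Proof.
apply/seteqP; split=> psi /= [z ze].
  move=> pz; exists z => //; apply: spectrum_eq => f Hf.
  by rewrite spectrum_shiftE// pz.
by move=> <-; exists z => // f Hf; rewrite spectrum_shiftE.
Qed.

(** On linear functionals the norm of the ideal of degree 1 is at most the norm of the
    dual, so the restriction of a character to the dual is continuous. *)
Lemma spectrum_piE phi (g : dual E) : spectrum_pi phi g = phi g.
Proof.
have pL := char_linear (spectrumP phi).
have gL : linear (fun g : dual E => phi g).
  move=> a u v; exact: (pL a _ _ (Hb_dual u) (Hb_dual v)).
have [K [r [K0 r0 phiK]]] := spectrum_bounded phi.
have gC : cont_linear (fun g : dual E => phi g).
  apply/asboolP; split=> //; apply: (lin_bounded_continuous gL (M := K * r)) => u.
  have [Bu u1] := dual_ideal A_mult u; apply: (le_trans (phiK _ _ Bu)).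
  by rewrite expr1 -mulrA !ler_wpM2l// ltW.
have := @xgetPex _ (0 : bidual E) [set z : bidual E | forall g : dual E, z g = phi g].
by apply; exists (Dual gC).
Qed.

Lemma spectrum_pi_shift phi z : spectrum_pi (spectrum_shift phi z) = spectrum_pi phi + z.
Proof.
apply/val_inj/funext => g.
rewrite -[RHS]/(spectrum_pi phi g + z g) -[LHS]/(spectrum_pi _ g) !spectrum_piE.
rewrite (spectrum_shiftE _ _ (Hb_dual g)) (tau_dual A_mult A_AB A_reg).
rewrite (functionalD (char_linear (spectrumP phi)) (Hb_cst _) (Hb_dual g)).
by rewrite spectrum_cst addrC.
Qed.

Lemma basic_nbhs_open phi (e : R) : 0 < e -> open (basic_nbhs phi e).
Proof.
move=> e0; exists [set basic_nbhs phi e]; last by rewrite bigcup_set1.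
move=> _ ->; apply: (@finI_from1 _ _ _ id).
by exists phi, e.
Qed.

Lemma spectrum_continuous (T : topologicalType) (h : T -> spectrum A E) :
  (forall phi (e : R), 0 < e -> open (h @^-1` basic_nbhs phi e)) -> continuous h.
Proof.
move=> ho t W; rewrite /= nbhsE => -[_ [[Bs sB <-] [V BV Vt] BW]].
apply: (@filterS _ (nbhs t) _ (h @^-1` V)).
  by move=> s Vs; apply: BW; exists V.
have [D sD IDV] := sB _ BV; rewrite -IDV preimage_bigcap.
apply: filter_bigI => U UD.
have [psi [e [e0 UE]]] : exists psi (e : R), 0 < e /\ U = basic_nbhs psi e.
  by have := sD _ UD; rewrite inE.
apply: open_nbhs_nbhs; split; first by rewrite /= UE; exact: ho.
by move: Vt; rewrite -IDV => /(_ U UD).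
Qed.

Definition orbit_of phi : set (spectrum A E) := range (spectrum_shift phi).

Lemma orbit_of_shift phi z : orbit_of (spectrum_shift phi z) = orbit_of phi.
Proof.
apply/seteqP; split=> _ [w _ <-].
  by exists (z + w) => //; rewrite spectrum_shiftD.
by exists (w - z) => //; rewrite spectrum_shiftD addrC subrK.
Qed.

Lemma orbit_of_refl phi : orbit_of phi phi.
Proof. by exists 0 => //; rewrite spectrum_shift0. Qed.

Lemma orbit_of_open phi : open (orbit_of phi).
Proof.
rewrite openE => psi [z _ <-]; rewrite /interior nbhsE.
exists (basic_nbhs (spectrum_shift phi z) 1); first split.
- exact: basic_nbhs_open.
- by rewrite basic_nbhsE; exists 0; rewrite /= ?rnorm0// spectrum_shift0.
- by rewrite basic_nbhsE => _ [w _ <-]; rewrite -(orbit_of_shift phi z); exists w.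
Qed.

Lemma orbit_of_closed phi : closed (orbit_of phi).
Proof.
rewrite -openC openE => psi npsi; rewrite /interior nbhsE.
exists (orbit_of psi); first by split; [exact: orbit_of_open|exact: orbit_of_refl].
move=> _ [w _ <-] [z _ zw]; apply: npsi.
have := orbit_of_refl psi; rewrite -(orbit_of_shift psi w) -zw.
by rewrite orbit_of_shift.
Qed.

(** The segment from phi to its translate is continuous by the very choice of the
    basic neighbourhoods, which are small translations. *)
Lemma spectrum_shift_path phi z : continuous (fun t : R => spectrum_shift phi (ofR t *: z)).
Proof.
apply: spectrum_continuous => psi e e0; rewrite basic_nbhsE openE.
move=> t -[w we wt]; rewrite /interior.
have z1 : 0 < rnorm z + 1 by rewrite ltr_wpDl ?rnorm_ge0.
apply/nbhs_ballP; exists ((e - rnorm w) / (rnorm z + 1)) => /=.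
  by rewrite divr_gt0// subr_gt0.
move=> s; rewrite -ball_normE/= ltr_pdivlMr// => st.
exists (w + ofR (s - t) *: z) => /=.
  apply: (le_lt_trans (ler_rnormD _ _)); rewrite -ltrBrDl; apply: le_lt_trans st.
  by rewrite rnormZ rnorm_ofR distrC ler_wpM2l// lerDl.
have -> : ofR s *: z = ofR t *: z + ofR (s - t) *: z.
  by rewrite -scalerDl -[ofR t + _](rmorphD (real_complex R)) addrC subrK.
apply: (etrans (esym (spectrum_shiftD psi w _))).
apply: (etrans (congr1 (fun p => spectrum_shift p _) wt)).
exact: spectrum_shiftD.
Qed.

(** Orbits are open, and so is the complement of one, a union of orbits; segments make
    them connected. *)
Lemma connected_component_orbit phi :
  connected_component [set: spectrum A E] phi = orbit_of phi.
Proof.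
apply/seteqP; split.
  have Sc : connected (connected_component [set: spectrum A E] phi).
    exact: component_connected.
  have Sphi := @connected_component_refl _ [set: spectrum A E] phi I.
  rewrite -(Sc (connected_component setT phi `&` orbit_of phi)).
  - by apply: subIsetr.
  - by exists phi; split=> //; exact: orbit_of_refl.
  - by exists (orbit_of phi) => //; exact: orbit_of_open.
  - by exists (orbit_of phi) => //; exact: orbit_of_closed.
move=> _ [z _ <-].
pose h (t : R) := spectrum_shift phi (ofR t *: z).
apply: (@connected_component_max _ _ (h @` `[0, 1])).
- exists 0; first by rewrite /= in_itv/= lexx ler01.
  by rewrite /h (_ : ofR 0 = 0 :> C)// scale0r spectrum_shift0.
- exact: subsetT.
- apply: connected_continuous_connected; first exact: segment_connected.
  by apply: continuous_subspaceT; exact: spectrum_shift_path.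
exists 1; first by rewrite /= in_itv/= lexx ler01.
by rewrite /h (_ : ofR 1 = 1 :> C)// scale1r.
Qed.

End spectrum_translations.

(** * The extension of a function to the spectrum *)

Section extension.
Variables (R : realType) (A : nat -> polyclass R) (E : banachType R).
Hypotheses (A_mult : multiplicative_seq A) (A_AB : AB_closed A) (A_reg : regular_at A E).
Hypothesis A_wd : weakly_differentiable A.
Local Notation C := (cplx R).
Local Notation B := (with_constants A).
Local Notation J := (@bidual_embed R E).
Let Ac : coherent A := A_mult.1.
Let BI := with_constants_ideal Ac.

(** Weak differentiability is applied on the bidual, to the extended polynomial
    AB P_k and to the functional Q |-> phi (Q \o J): it puts each coefficient
    of the expansion of phi (tau z f) in powers of z into the ideal. The binomial
    coefficients and all constants are absorbed by the decrease of the norms of P_k. *)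
Lemma spectrum_ext_orbit_Hb (phi : spectrum A E) (f : E -> C) : Hb A f ->
  Hb A (fun z : bidual E => phi (tau z f)).
Proof.
move=> /(Hb_expands Ac) fP; have [BP Pr _] := fP.
have [al al1 AB] := with_constants_AB Ac A_reg A_AB.
have [K [r [K0 r0 phiK]]] := spectrum_bounded A_mult phi.
have [d d1 Bd] := with_constants_weak_diff A_wd.
have [c c1 Bc] := with_constants_partial Ac.
have JB k (Q : bidual E -> C) := @ideal_comp_contraction _ k _ (BI k) _ _ J Q
  (@bidual_embed_linear R E) (@rnorm_bidual_embed R E).
have phiL := char_linear (spectrumP phi).
have BAB k : B k (bidual E) (aron_berner k (taylor f k)) by case: (AB k _ (BP k)).
pose F k i z := phi (partial_poly k i (aron_berner k (taylor f k)) z \o J).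
have FB k i : (i <= k)%N -> B i (bidual E) (F k i) /\
    pnorm (B i) (F k i) <=
      d ^+ k * (K * r ^+ (k - i)) * pnorm (B k) (aron_berner k (taylor f k) : bidual E -> C).
  move=> ik; apply: (Bd (bidual E) k i _ (fun Q => phi (Q \o J)) _ ik (BAB k)).
  - move=> a Q Q' BQ BQ'.
    exact: (phiL a _ _ (Hb_ideal Ac (JB _ _ BQ).1) (Hb_ideal Ac (JB _ _ BQ').1)).
  - by rewrite mulr_ge0// exprn_ge0// ltW.
  move=> Q BQ; have [BQJ QJ] := JB _ _ BQ; apply: (le_trans (phiK _ _ BQJ)).
  by rewrite -mulrA ler_wpM2l// ler_wpM2l// exprn_ge0// ltW.
pose D k i := if (i <= k)%N then 'C(k, i)%:R *: F k i else 0.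
pose q := 2 * (d * ((1 + r) * al)).
have d0 : 0 <= d := le_trans ler01 d1; have al0 : 0 <= al := le_trans ler01 al1.
have r1 : 0 <= 1 + r by rewrite addr_ge0// ltW.
have q0 : 0 <= q by rewrite /q !mulr_ge0.
pose u k := K * q ^+ k * pnorm (B k) (taylor f k).
have P0 k : 0 <= pnorm (B k) (taylor f k) := pnorm_ge0 (BI k) (BP k).
have BD k i : B i (bidual E) (D k i).
  rewrite /D; case: leqP => ik; last exact: (ideal0 (BI i)).
  exact: (ideal_scale (BI i) _ (FB k i ik).1).
have Du k i : pnorm (B i) (D k i) <= u k.
  rewrite /D; case: leqP => ik; last by rewrite (pnorm0 (BI i)) /u !mulr_ge0// exprn_ge0.
  have [BF Fle] := FB k i ik; rewrite (ideal_normZ (BI i))// rnorm_nat.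
  apply: (@le_trans _ _ (2 ^+ k * (d ^+ k * (K * (1 + r) ^+ k) *
      (al ^+ k * pnorm (B k) (taylor f k))))); last first.
    by rewrite /u /q !exprMn le_eqVlt; apply/orP; left; apply/eqP; ring.
  apply: ler_pM => //; first exact: (pnorm_ge0 (BI i) BF).
    by rewrite -natrX ler_nat bin_le_exp2.
  apply: (le_trans Fle); apply: ler_pM.
  - by rewrite !mulr_ge0 ?exprn_ge0// ltW.
  - exact: (pnorm_ge0 (BI k) (BAB k)).
  - rewrite ler_wpM2l ?exprn_ge0// ler_wpM2l//.
    apply: (@le_trans _ _ ((1 + r) ^+ (k - i))).
      by rewrite lerXn2r ?nnegrE ?(ltW r0)// lerDr.
    by rewrite ler_weXn2l ?leq_subr// lerDl ltW.
  - by case: (AB k _ (BP k)).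
have ur : rapid u by apply: rapidM_geom.
have D0 k i : (k < i)%N -> D k i = 0 by rewrite /D ltnNge => /negbTE->.
have [] := expands_array BI BD Du ur D0 (f := fun z => phi (tau z f)); last first.
  by move=> T [fT _ _ _]; exact: (expands_Hb Ac fT).
move=> z; have := spectrum_tau A_mult A_AB A_reg phi z fP; congr (csum _ _).
apply/funext => k; rewrite (reindex_inj rev_ord_inj)/=; apply: eq_bigr => i _.
have ik : (i <= k)%N by rewrite -ltnS.
rewrite /D ik subSS /tau_array /affine_array leq_subr subKn// bin_sub//.
have := partial_embed_ideal Ac (fun k p Bp => (AB k p Bp).1) z ik (BP k) => BPk.
exact: (functionalZ Ac phiL _ (Hb_ideal Ac BPk)).
Qed.

Lemma Hb_translate (F : banachType R) (g : F -> C) a : Hb A g -> Hb A (fun x => g (a + x)).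
Proof.
move=> /(Hb_expands Ac) gP; have [c c1 Bc] := with_constants_partial Ac.
by have [Q gQ] := expands_translate BI c1 Bc a gP; exact: (expands_Hb Ac gQ).
Qed.

End extension.

Theorem theorem3p23 (R : realType) (E : completeNormedModType (cplx R))
    (A : nat -> polyclass R)
    (A_mult : multiplicative_seq A) (A_AB : AB_closed A)
    (A_reg : regular_at A E) (A_wd : weakly_differentiable A)
    (f : E -> cplx R) (fHb : Hb A f)
    (S : set (spectrum A E)) (phi : spectrum A E)
    (S_comp : S = connected_component [set: spectrum A E] phi) :
  Hb A (spectrum_ext f \o 'pinv_(fun=> phi) S (@spectrum_pi R A E)).
Proof.
have G := Hb_translate A_mult (- spectrum_pi phi)
  (spectrum_ext_orbit_Hb A_mult A_AB A_reg A_wd phi fHb).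
suff -> : spectrum_ext f \o 'pinv_(fun=> phi) S (@spectrum_pi R A E) =
    fun w : bidual E => phi (tau (- spectrum_pi phi + w) f) by [].
have SE : S = orbit_of A_mult A_AB A_reg phi.
  by rewrite S_comp; exact: connected_component_orbit.
apply/funext => w /=; set psi := 'pinv_(fun=> phi) S _ w.
have wS : (@spectrum_pi R A E @` S) w.
  exists (spectrum_shift A_mult A_AB A_reg phi (- spectrum_pi phi + w)).
    by rewrite SE; exists (- spectrum_pi phi + w).
  by rewrite spectrum_pi_shift addrA subrr add0r.
(* w is attained on S, so the default value phi of the inverse is not taken. *)
have psiw : spectrum_pi psi = w by apply: pinvK; rewrite inE.
have : S psi by exact: (@funS _ _ (spectrum_pi (E := E) @` S) S
  ('pinv_(fun=> phi) S (@spectrum_pi R A E)) w wS).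
rewrite SE => -[z _ zpsi].
have zw : z = - spectrum_pi phi + w.
  by rewrite -psiw -zpsi spectrum_pi_shift addrA addNr add0r.
by rewrite /spectrum_ext -zpsi -zw spectrum_shiftE.
Qed.
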